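(* Let $e_1$ be a positive integer, $p_1$ a prime, $q_1=p_1^{e_1}$, and let $n,m$ be positive divisors of $q_1+1$. Put $M=\mathrm{lcm}(n,m)$, $m_1=p_1\bmod M$ and $m_2=M-m_1$. If $p_2$ is a prime such that $\mathcal{F}_{n,m}^{(p_2)}$ is maximal and $p_2\equiv m_2\pmod M$, then $$a(\mathcal{F}_{n,m}^{(p_1)})+a(\mathcal{F}_{n,m}^{(p_2)})=g(\mathcal{F}_{n,m}^{(p_1)}).$$
   Context: For integers $a$ and $b\geq 1$, $a \bmod b$ denotes the residue of $a$ in $\{0,1,\dots,b-1\}$. For positive integers $n,m$ and a prime $p$ not dividing $nm$, $\mathcal{F}_{n,m}^{(p)}$ denotes the function field $K(U,V)$ with $U^n+V^m+1=0$ over a base field $K$ of characteristic $p$ (either an algebraically closed field or a finite field $\mathbb{F}_{q^2}$ with $q$ a power of $p$; the genus and $a$-number do not depend on this choice). Its genus is $g(\mathcal{F}_{n,m}^{(p)})=\frac{(n-1)(m-1)+1-\gcd(n,m)}{2}$. ''$\mathcal{F}_{n,m}^{(p)}$ is maximal'' means that for some power $q=p^{e}$, $e\ge1$, it is $\mathbb{F}_{q^2}$-maximal when considered over $\mathbb{F}_{q^2}$ (i.e. it has $q^2+1+2gq$ places of degree one); equivalently (known fact) both $n$ and $m$ divide $q+1$. Cartier operator: let $F/K$ be a function field over a perfect field $K$ of characteristic $p>0$ and let $t$ be a separating element. Every differential $\omega$ of $F/K$ can be written uniquely as $\omega=(x_0^p+x_1^pt+\cdots+x_{p-1}^pt^{p-1})\,dt$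 with $x_i\in F$, and $\mathcal{C}(\omega):=x_{p-1}\,dt$; this does not depend on $t$, and $\mathcal{C}$ maps holomorphic differentials to holomorphic differentials. The $a$-number $a(F)$ is the $K$-dimension of the kernel of $\mathcal{C}$ acting on the holomorphic differentials of $F$. *)

(* Defs.v *)
From HB Require Import structures.
From mathcomp Require Import all_boot all_order all_algebra all_field.
From mathcomp Require Import boolp classical_sets functions cardinality.

Set Implicit Arguments.
Unset Strict Implicit.
Unset Printing Implicit Defensive.

Import GRing.Theory.
Local Open Scope classical_set_scope.
Local Open Scope card_scope.
Local Open Scope ring_scope.

(* An extension F / K is given by a ring morphism iota : K -> F. *)

Section FunctionField.
Variables (K F : fieldType) (iota : {rmorphism K -> F}).

(* The intermediate field K(t). *)
Definition simple_subfield (t : F) : set F :=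
  [set y | exists P Q : {poly K},
     (map_poly iota Q).[t] != 0 /\
     y = (map_poly iota P).[t] / (map_poly iota Q).[t]].

(* F / K(t) is separable algebraic; as F / K has transcendence degree 1 in all
   uses below, t is then transcendental over K. *)
Definition separating (t : F) : Prop :=
  forall y : F, exists f : {poly F},
    [/\ forall i, simple_subfield t f`_i, separable_poly f & root f y].

(* A place of F / K is represented by its valuation ring O. *)
Record is_place (O : set F) : Prop := IsPlace {
  place_const : range iota `<` O;
  place_proper : O `<` setT;
  place_sub : forall x y, O x -> O y -> O (x - y);
  place_mul : forall x y, O x -> O y -> O (x * y);
  place_val : forall z, O z \/ O z^-1
}.

(* The case z = 0 is listed separately because 0^-1 = 0. *)
Definition place_ideal (O : set F) : set F :=
  [set z | O z /\ (z = 0 \/ ~ O z^-1)].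

Definition prime_element (O : set F) (t : F) : Prop :=
  place_ideal O = [set t * z | z in O].

(* The residue field O / P is K. *)
Definition degree_one_place (O : set F) : Prop :=
  is_place O /\ forall z, O z -> exists c : K, place_ideal O (z - iota c).

Definition is_derivation (D : F -> F) : Prop :=
  [/\ forall x y, D (x + y) = D x + D y,
      forall x y, D (x * y) = x * D y + y * D x &
      forall c, D (iota c) = 0].

Definition derivation := {D : F -> F | is_derivation D}.

(* Differentials of F / K are seen as functions on the K-derivations of F:
   f dt is D |-> f * D t.  Since the derivations form a one-dimensional
   F-space, f dt = g dz iff f = g * D_t z, where D_t t = 1. *)
Definition differential := derivation -> F^o.

Definition diff (t : F) : differential := fun D => sval D t.

(* w is regular at the place O: w = f dt with t a prime element of O and f in
   O.  The choice of t does not matter when K is perfect. *)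
Definition regular_at (O : set F) (w : differential) : Prop :=
  exists t f : F, [/\ prime_element O t, O f & w = f *: diff t].

Definition holomorphic : set differential :=
  [set w | forall O, is_place O -> regular_at O w].

(* The graph w |-> w' of the Cartier operator in characteristic p. *)
Definition cartier (p : nat) (w w' : differential) : Prop :=
  exists (t : F) (x : nat -> F),
    [/\ separating t,
        w = (\sum_(i < p) x i ^+ p * t ^+ i) *: diff t &
        w' = x p.-1 *: diff t].

(* b is a K-basis of W, i.e. c |-> \sum_i c_i b_i is a bijection K^d -> W. *)
Definition is_basis (W : set differential) (d : nat) (b : 'I_d -> differential)
  : Prop :=
  set_bij [set: 'rV[K]_d] W (fun c => \sum_(i < d) iota (c 0 i) *: b i).

(* The K-dimension of W, and 0 if there is no finite basis. *)
Definition Kdim (W : set differential) : nat :=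
  xget 0%N [set d | exists b : 'I_d -> differential, is_basis W b].

(* The constant field is K for the function fields below, so that this is the
   usual genus of F / K. *)
Definition genus : nat := Kdim holomorphic.

Definition a_number (p : nat) : nat :=
  Kdim [set w | holomorphic w /\ cartier p w 0].

(* F = K(u, v); the outer variable of A and B is sent to u, the inner to v. *)
Definition generated_by (u v : F) : Prop :=
  forall y : F, exists A B : {poly {poly K}},
    let ev (C : {poly {poly K}}) :=
      (map_poly (map_poly iota) C).[u%:P].[v] in
    ev B != 0 /\ y = ev A / ev B.

End FunctionField.

Definition has_order (K : fieldType) (N : nat) : Prop := [set: K] #= `I_N.

Definition base_field (p : nat) (K : fieldType) : Prop :=
  p \in [pchar K] /\
  (GRing.closed_field_axiom K \/
   exists2 e, (0 < e)%N & has_order K ((p ^ e) ^ 2)).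

(* F / K is F_{n,m}^(p) over the base field K: the function field K(u, v) with
   u^n + v^m + 1 = 0.  The polynomial U^n + V^m + 1 is irreducible when p does
   not divide n m, so these conditions determine F / K up to isomorphism. *)
Definition fermat_function_field (n m p : nat) (K F : fieldType)
    (iota : {rmorphism K -> F}) : Prop :=
  [/\ (0 < n)%N && (0 < m)%N, prime p && ~~ (p %| n * m)%N, base_field p K &
      exists u v : F,
        [/\ ~ algebraicOver iota v, generated_by iota u v &
            u ^+ n + v ^+ m + 1 = 0]].

(* F_{n,m}^(p) is F_{q^2}-maximal for some q = p^e with e >= 1. *)
Definition fermat_maximal (n m p : nat) : Prop :=
  exists e : nat, let q := (p ^ e)%N in
  exists (K F : fieldType) (iota : {rmorphism K -> F}),
    [/\ (0 < e)%N, has_order K (q ^ 2), fermat_function_field n m p iota &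
        [set O | degree_one_place iota O]
          #= `I_(q ^ 2 + 1 + 2 * genus iota * q)].

(* Main.v *)
Require Import Defs.
From HB Require Import structures.
From mathcomp Require Import all_boot all_order all_algebra all_field.
From mathcomp Require Import ring zify.
From mathcomp Require Import boolp classical_sets functions cardinality.

(* The differential omega = - dv / (n u^(n-1)) generates the differentials of
   F = K(u, v) over F and is a local generator at all places with v finite.
   Every place O of F is the localization of a plane model of F, smooth over
   its first coordinate, so that O is stable under a suitable multiple of d/dv;
   this makes regularity of z omega at O a condition on z alone.  Since every
   proper ideal of a subring of F is contained in the prime of some place, a
   z with z omega regular at the finite places lies in K[u, v], and regularity at
   infinity bounds its weighted degree.  So the u^(i-1) v^(j-1) omega with
   i, j > 0 and i m + j n < n m form a basis of the holomorphic differentials.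

   A differential with C(w) = 0 is exact, and d/dv has p-th power 0; expanding
   u^(i-n) with u^n = - (v^m + 1) shows that the Cartier operator maps basis
   elements to distinct multiples of basis elements or to 0, the image of index
   (p i' mod n, p j' mod m) having index (i', j') if i' m + j' n < n m and being
   0 otherwise.  Hence a is the number of (i', j') with i' m + j' n >= n m whose
   multiple by p has weight < n m.  As p2 = - p1 modulo lcm(n, m), for p2 the
   last condition becomes "weight > n m" for the multiple by p1, so that the two
   a-numbers add up to the number of (i', j') with i' m + j' n > n m, which is g
   by the symmetry (i, j) -> (n - i, m - j). *)

Set Implicit Arguments.
Unset Strict Implicit.
Unset Printing Implicit Defensive.

Import GRing.Theory.
Local Open Scope classical_set_scope.
Local Open Scope ring_scope.

(** * Places *)

(** A place is a bare valuation ring: no discreteness and no prime element is given, while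
    regularity quantifies over prime elements. The plane models supply both. A generator h of the
    polynomials whose value at x lies in P has a unit derivative, because K is perfect; smoothness
    over the x-line then makes h(x) a prime element, and D(h(x)) is a unit times D x. The affine
    curve is smooth, so u or v can be taken as x at finite places. At infinity the projective curve
    may be singular, and two monomials in u, v with exponent matrix of determinant 1 give a smooth
    model instead.

    The relation [cartier] is existential in t, so its kernel is not visibly linear. From C(w) = 0
    only exactness w = dy is kept; with E = d/dv it gives E^(p-1)(w/dv) = E^p y = 0, a condition
    that can be tested on monomials. The converse exhibits a decomposition for t = v and so needs v
    to be separating.

    In the final count the weight n m lies between a strict and a weak inequality. Since p times a
    weight is congruent modulo n m to the weight of the multiple by p, and p is prime to n m, both
    weights equal n m at the same time. *)

Section PlaceTheory.
Variables (K F : fieldType) (iota : {rmorphism K -> F}).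
Variable O : set F.
Hypothesis OP : is_place iota O.

Lemma place_iota c : O (iota c).
Proof. by have [sub _] := place_const OP; apply: sub; exists c. Qed.

Lemma place0 : O 0. Proof. by rewrite -(rmorph0 iota); exact: place_iota. Qed.

Lemma place1 : O 1. Proof. by rewrite -(rmorph1 iota); exact: place_iota. Qed.

Lemma placeN x : O x -> O (- x).
Proof. by move=> Ox; rewrite -sub0r; apply: (place_sub OP) => //; exact: place0. Qed.

Lemma placeD x y : O x -> O y -> O (x + y).
Proof. by move=> Ox /placeN Oy; rewrite -[y]opprK; apply: (place_sub OP). Qed.

Lemma placeM x y : O x -> O y -> O (x * y).
Proof. exact: (place_mul OP). Qed.

Lemma placeX x k : O x -> O (x ^+ k).
Proof.
move=> Ox; elim: k => [|k IHk]; first by rewrite expr0; exact: place1.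
by rewrite exprS; exact: placeM.
Qed.

Lemma place_sum (I : Type) (r : seq I) (P : pred I) (f : I -> F) :
  (forall i, P i -> O (f i)) -> O (\sum_(i <- r | P i) f i).
Proof. by move=> Of; apply: (big_ind O) => //; [exact: place0 | exact: placeD]. Qed.

Lemma place_natr k : O k%:R.
Proof. by rewrite -(rmorph_nat iota); exact: place_iota. Qed.

Lemma place_idealW z : place_ideal O z -> O z. Proof. by case. Qed.

Lemma place_ideal0 : place_ideal O 0.
Proof. by split; [exact: place0 | left]. Qed.

Lemma place_ideal_unit z : O z^-1 -> z != 0 -> ~ place_ideal O z.
Proof. by move=> Oz /eqP z0 [_ []]. Qed.

Lemma place_ideal1 : ~ place_ideal O 1.
Proof. by apply: place_ideal_unit; rewrite ?invr1 ?oner_eq0 //; exact: place1. Qed.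

Lemma placeV z : O z -> ~ place_ideal O z -> z != 0 /\ O z^-1.
Proof.
move=> Oz nPz; split; first by apply/eqP => z0; apply: nPz; rewrite z0; exact: place_ideal0.
by apply: contrapT => nO; apply: nPz; split=> //; right.
Qed.

Lemma place_idealV z : ~ O z -> place_ideal O z^-1.
Proof.
move=> nOz; split; first by have [] := place_val OP z.
by right; rewrite invrK.
Qed.

Lemma place_idealMr x y : O x -> place_ideal O y -> place_ideal O (x * y).
Proof.
move=> Ox [Oy Py]; split; first exact: placeM.
have [->|x0] := eqVneq x 0; first by left; rewrite mul0r.
case: Py => [->|nOy]; first by left; rewrite mulr0.
right=> Oxy; apply: nOy; have -> : y^-1 = x * (x * y)^-1.
  by rewrite invfM mulrA mulfV // mul1r.
exact: placeM.
Qed.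

Lemma place_idealMl x y : place_ideal O x -> O y -> place_ideal O (x * y).
Proof. by move=> Px Oy; rewrite mulrC; exact: place_idealMr. Qed.

Lemma place_idealN x : place_ideal O x -> place_ideal O (- x).
Proof. by move=> Px; rewrite -mulN1r; apply: place_idealMr => //; exact/placeN/place1. Qed.

Lemma place_idealD x y : place_ideal O x -> place_ideal O y -> place_ideal O (x + y).
Proof.
move=> Px Py; have [->|x0] := eqVneq x 0; first by rewrite add0r.
have [->|y0] := eqVneq y 0; first by rewrite addr0.
have [Oxy|Oyx] := place_val OP (x / y).
  have -> : x + y = (1 + x / y) * y by rewrite mulrDl mul1r divfK // addrC.
  by apply: place_idealMr => //; apply: placeD => //; exact: place1.
have -> : x + y = (1 + (x / y)^-1) * x by rewrite invf_div mulrDl mul1r divfK.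
by apply: place_idealMr => //; apply: placeD => //; exact: place1.
Qed.

Lemma place_idealB x y : place_ideal O x -> place_ideal O y -> place_ideal O (x - y).
Proof. by move=> Px /place_idealN; exact: place_idealD. Qed.

Lemma place_ideal_prime x y : O x -> O y -> place_ideal O (x * y) ->
  place_ideal O x \/ place_ideal O y.
Proof.
move=> Ox Oy Pxy; have [|nPx] := pselect (place_ideal O x); [by left | right].
have [x0 Ox'] := placeV Ox nPx.
by rewrite -[y](mulKf x0); exact: place_idealMr.
Qed.

Lemma place_idealX x k : (0 < k)%N -> place_ideal O x -> place_ideal O (x ^+ k).
Proof.
case: k => // k _ Px; rewrite exprS; apply: place_idealMl => //.
exact/placeX/place_idealW.
Qed.

Lemma place_ideal_exp x k : O x -> place_ideal O (x ^+ k) -> place_ideal O x.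
Proof.
move=> Ox; elim: k => [|k IHk]; first by rewrite expr0 => /place_ideal1.
rewrite exprS => /place_ideal_prime[] //; exact: placeX.
Qed.

(** Valuation rings are integrally closed: for [x] outside [O] the inverse is in P, hence so is 1 =
    x^k x^-k. *)
Lemma place_exp x k : (0 < k)%N -> O (x ^+ k) -> O x.
Proof.
move=> k0 Oxk; apply: contrapT => nOx; have := place_idealX k0 (place_idealV nOx).
have x0 : x != 0 by apply/eqP => x0; apply: nOx; rewrite x0; exact: place0.
move/(place_idealMr Oxk); rewrite exprVn mulfV ?expf_neq0 //.
exact: place_ideal1.
Qed.

Lemma place_unitM x y : O x -> O y -> ~ place_ideal O x -> ~ place_ideal O y ->
  ~ place_ideal O (x * y).
Proof. by move=> Ox Oy nx ny /(place_ideal_prime Ox Oy)[]. Qed.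

Lemma place_unitX x k : O x -> ~ place_ideal O x -> ~ place_ideal O (x ^+ k).
Proof. by move=> Ox nx /(place_ideal_exp Ox). Qed.

Lemma place_unitDl x y : place_ideal O x -> ~ place_ideal O y -> ~ place_ideal O (x + y).
Proof. by move=> Px nPy Pxy; apply: nPy; rewrite -[y](addKr x) addrC; exact: place_idealB. Qed.

Lemma place_iota_unit c : c != 0 -> ~ place_ideal O (iota c).
Proof.
move=> c0; apply: place_ideal_unit; rewrite ?fmorph_eq0 -?fmorphV //; exact: place_iota.
Qed.

End PlaceTheory.

(** * Chevalley's extension of subrings to places *)

Section PlaceExtension.
Variables (K F : fieldType) (iota : {rmorphism K -> F}).

Record subring_set (A : set F) : Prop := SubringSet {
  subring_set1 : A 1;
  subring_setB : forall x y, A x -> A y -> A (x - y);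
  subring_setM : forall x y, A x -> A y -> A (x * y)
}.

Record ideal_set (A J : set F) : Prop := IdealSet {
  ideal_setS : J `<=` A;
  ideal_set0 : J 0;
  ideal_setB : forall x y, J x -> J y -> J (x - y);
  ideal_setM : forall x y, A x -> J y -> J (x * y)
}.

Section SubringTheory.
Variables (A : set F) (A_ring : subring_set A).

Lemma subring_set0 : A 0.
Proof. by rewrite -(subrr 1); apply: subring_setB => //; exact: subring_set1. Qed.

Lemma subring_setN x : A x -> A (- x).
Proof. by move=> Ax; rewrite -sub0r; apply: subring_setB => //; exact: subring_set0. Qed.

Lemma subring_setD x y : A x -> A y -> A (x + y).
Proof. by move=> Ax /subring_setN Ay; rewrite -[y]opprK; exact: subring_setB. Qed.

Lemma subring_setX x k : A x -> A (x ^+ k).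
Proof.
move=> Ax; elim: k => [|k IHk]; first by rewrite expr0; exact: subring_set1.
by rewrite exprS; exact: subring_setM.
Qed.

Lemma subring_set_sum (I : Type) (r : seq I) (P : pred I) (f : I -> F) :
  (forall i, P i -> A (f i)) -> A (\sum_(i <- r | P i) f i).
Proof. by move=> Af; apply: (big_ind A) => //; [exact: subring_set0 | exact: subring_setD]. Qed.

Variables (J : set F) (J_ideal : ideal_set A J).

Lemma ideal_setN x : J x -> J (- x).
Proof. by move=> Jx; rewrite -sub0r; apply: (ideal_setB J_ideal) => //; exact: (ideal_set0 J_ideal). Qed.

Lemma ideal_setD x y : J x -> J y -> J (x + y).
Proof. by move=> Jx /ideal_setN Jy; rewrite -[y]opprK; exact: (ideal_setB J_ideal). Qed.

Lemma ideal_set_sum (I : Type) (r : seq I) (P : pred I) (f : I -> F) :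
  (forall i, P i -> J (f i)) -> J (\sum_(i <- r | P i) f i).
Proof. by move=> Jf; apply: (big_ind J) => //; [exact: (ideal_set0 J_ideal) | exact: ideal_setD]. Qed.

End SubringTheory.

Definition coef_in (J : set F) (P : {poly F}) := forall i, J P`_i.

(** For a subring A this is A[z]; for an ideal J of A it is the extended ideal J A[z]. *)
Definition adjoin_set (J : set F) (z : F) : set F :=
  [set y | exists2 P : {poly F}, coef_in J P & y = P.[z]].

Lemma coef_in1 A : subring_set A -> coef_in A 1.
Proof.
move=> Ar i; rewrite coef1; case: eqP => _; first exact: subring_set1.
exact: subring_set0.
Qed.

Lemma adjoin_subring A z : subring_set A -> subring_set (adjoin_set A z).
Proof.
move=> Ar; split.
- by exists 1; [exact: coef_in1 | rewrite hornerC].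
- move=> _ _ [P AP ->] [Q AQ ->]; exists (P - Q); last by rewrite hornerD hornerN.
  by move=> i; rewrite coefB; exact: subring_setB.
- move=> _ _ [P AP ->] [Q AQ ->]; exists (P * Q); last by rewrite hornerM.
  by move=> i; rewrite coefM; apply: subring_set_sum => // j _; exact: subring_setM.
Qed.

Lemma adjoin_ideal A J z : subring_set A -> ideal_set A J ->
  ideal_set (adjoin_set A z) (adjoin_set J z).
Proof.
move=> Ar Ji; split.
- by move=> _ [P JP ->]; exists P => // i; exact: (ideal_setS Ji).
- by exists 0; [move=> i; rewrite coef0; exact: (ideal_set0 Ji) | rewrite horner0].
- move=> _ _ [P AP ->] [Q AQ ->]; exists (P - Q); last by rewrite hornerD hornerN.
  by move=> i; rewrite coefB; exact: (ideal_setB Ji).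
- move=> _ _ [P AP ->] [Q AQ ->]; exists (P * Q); last by rewrite hornerM.
  by move=> i; rewrite coefM; apply: (ideal_set_sum Ji) => // j _; exact: (ideal_setM Ji).
Qed.

Lemma sub_adjoin A z : A 0 -> A `<=` adjoin_set A z.
Proof.
move=> A0 a Aa; exists a%:P; last by rewrite hornerC.
by move=> i; rewrite coefC; case: eqP.
Qed.

Lemma mem_adjoin A z : subring_set A -> adjoin_set A z z.
Proof.
move=> Ar; exists 'X; last by rewrite hornerX.
by move=> i; rewrite coefX; case: eqP => _; [exact: subring_set1 | exact: subring_set0].
Qed.

(* If both J[z] and J[1/z] contained 1, the representation of 1 of the larger
   degree could be shortened with the help of the other one. *)
Lemma adjoin_shorten A J z (P Q : {poly F}) :
    subring_set A -> ideal_set A J -> ~ J 1 -> z != 0 -> coef_in J P -> coef_in J Q ->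
    P.[z] = 1 -> Q.[z^-1] = 1 -> (0 < size P)%N -> (size Q <= size P)%N ->
  exists P' : {poly F}, [/\ coef_in J P', P'.[z] = 1 & (size P' < size P)%N].
Proof.
move=> Ar Ji J1 z0 JP JQ Pz Qz sP sQP.
set k := (size P).-1; have sPk : size P = k.+1 by rewrite /k prednK.
pose P1 := \poly_(i < k) P`_i.
pose R := \poly_(i < k) Q`_(k - i).
(* This is 1 - Q_0 times the relation P(z) = 1, in which the top power z^k (1 - Q_0) is rewritten as
   R(z) by means of Q(1/z) = 1. *)
pose P' := (1 - Q`_0) *: P1 + (Q`_0)%:P + P`_k *: R.
have AJ x : J x -> A x by exact: (ideal_setS Ji).
exists P'; split.
- move=> i; rewrite !coefD !coefZ coefC !coef_poly.
  apply: (ideal_setD Ji); first apply: (ideal_setD Ji).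
  + apply: (ideal_setM Ji); last by case: ifP => _; [exact: JP | exact: (ideal_set0 Ji)].
    by apply: subring_setB => //; [exact: subring_set1 | exact: AJ].
  + by case: eqP => _; [exact: JQ | exact: (ideal_set0 Ji)].
  + apply: (ideal_setM Ji); first exact: AJ.
    by case: ifP => _; [exact: JQ | exact: (ideal_set0 Ji)].
- have ePz : P1.[z] + P`_k * z ^+ k = 1.
    by rewrite -Pz horner_poly [in RHS]horner_coef sPk big_ord_recr.
  have eQz : Q`_0 + \sum_(j < k) Q`_j.+1 * z^-1 ^+ j.+1 = 1.
    have sQk : (size Q <= k.+1)%N by rewrite -sPk.
    rewrite -Qz (horner_coef_wide _ sQk) [in RHS]big_ord_recl expr0 mulr1.
    by [].
  have eRz : R.[z] = z ^+ k * (1 - Q`_0).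
    rewrite -eQz addrC addKr mulr_sumr horner_poly (reindex_inj rev_ord_inj) /=.
    apply: eq_bigr => i _; have ltik := ltn_ord i.
    rewrite subKn // mulrCA; congr (_ * _).
    by rewrite exprVn -[in z ^+ k](subnK ltik) exprD mulfK ?expf_neq0.
  rewrite !hornerE eRz; move: ePz => /(canRL (addrK _)) ->.
  by ring.
- have k0 : (0 < k)%N.
    rewrite lt0n; apply/eqP => k0; apply: J1; rewrite -Pz.
    by rewrite (size1_polyC (_ : size P <= 1)%N) ?hornerC ?sPk ?k0.
  rewrite sPk ltnS (leq_trans (size_polyD _ _)) // geq_max.
  rewrite (leq_trans (size_polyD _ _)) //= ?geq_max.
    by rewrite (leq_trans (size_scale_leq _ _)) ?size_poly.
  rewrite (leq_trans (size_scale_leq _ _)) ?size_poly //.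
  by rewrite (leq_trans (size_polyC_leq1 _)).
Qed.

Lemma adjoin_min A J z : subring_set A -> ideal_set A J -> ~ J 1 -> adjoin_set J z 1 ->
  exists P : {poly F}, [/\ coef_in J P, P.[z] = 1 &
    forall Q : {poly F}, coef_in J Q -> Q.[z] = 1 -> (size P <= size Q)%N].
Proof.
move=> Ar Ji J1 [P0 JP0 P0z].
pose S k := `[< exists P : {poly F}, [/\ coef_in J P, P.[z] = 1 & size P = k] >].
have exS : exists k, S k by exists (size P0); apply/asboolP; exists P0.
have [k /asboolP [P [JP Pz sP]] kmin] := ex_minnP exS.
exists P; split=> // Q JQ Qz; rewrite sP; apply: kmin; apply/asboolP.
by exists Q.
Qed.

(** In representations of 1 of least degree in z and in 1/z, the longer one could still be
    shortened. *)
Lemma adjoin_proper A J z : subring_set A -> ideal_set A J -> ~ J 1 -> z != 0 ->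
  ~ (adjoin_set J z 1 /\ adjoin_set J z^-1 1).
Proof.
move=> Ar Ji J1 z0 [Jz Jz'].
have [P [JP Pz Pmin]] := adjoin_min Ar Ji J1 Jz.
have [Q [JQ Qz Qmin]] := adjoin_min Ar Ji J1 Jz'.
have pos (R : {poly F}) y : R.[y] = 1 -> (0 < size R)%N.
  move=> Ry; rewrite lt0n size_poly_eq0; apply/eqP => R0.
  by move/eqP: Ry; rewrite R0 horner0 eq_sym oner_eq0.
have z0' : z^-1 != 0 by rewrite invr_eq0.
case: (leqP (size Q) (size P)) => [QP|/ltnW PQ].
  have [P' [JP' P'z]] := adjoin_shorten Ar Ji J1 z0 JP JQ Pz Qz (pos _ _ Pz) QP.
  by rewrite ltnNge Pmin.
have Pz' : P.[(z^-1)^-1] = 1 by rewrite invrK.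
have [Q' [JQ' Q'z]] := adjoin_shorten Ar Ji J1 z0' JQ JP Qz Pz' (pos _ _ Qz) PQ.
by rewrite ltnNge Qmin.
Qed.

(** A pair (A, J) that is maximal among those with 1 not in J is a valuation ring with an ideal of
    nonunits. The nonzero element of [I] is such a nonunit; it makes the ring different from F and
    from K. *)
Theorem place_extension (B I : set F) : subring_set B -> ideal_set B I ->
    range iota `<=` B -> ~ I 1 -> (exists2 b, I b & b != 0) ->
  exists O : set F, [/\ is_place iota O, B `<=` O & I `<=` place_ideal O].
Proof.
move=> Br Ii KB I1 [b Ib b0].
(* A pair (A, J) is coded as a set of tagged elements, so that Zorn's lemma for
   inclusion applies. *)
pose ring_part (X : set (bool * F)) : set F := [set y | X (true, y)].
pose ideal_part (X : set (bool * F)) : set F := [set y | X (false, y)].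
pose good X := [/\ subring_set (ring_part X), ideal_set (ring_part X) (ideal_part X),
  B `<=` ring_part X, I `<=` ideal_part X & ~ ideal_part X 1].
pose code (A J : set F) : set (bool * F) := [set x | if x.1 then A x.2 else J x.2].
have [] := @Zorn_bigcup _ (fun X => X = set0 \/ good X).
  move=> C Cgood Ctot.
  have [C0|] := pselect (forall X, C X -> X = set0).
    by left; apply: bigcup0 => X /C0.
  move=> /existsNP [X0 /not_implyP [CX0 X0n]]; right.
  have gX0 : good X0 by case: (Cgood _ CX0).
  have common x y : (\bigcup_(X in C) X) x -> (\bigcup_(X in C) X) y ->
      exists X, [/\ C X, good X, X x & X y].
    move=> [X CX Xx] [Y CY Yy].
    have [XY|YX] := Ctot _ _ CX CY.
      exists Y; split=> //; last exact: XY.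
      by case: (Cgood _ CY) => // Y0; move: Yy; rewrite Y0.
    exists X; split=> //; last exact: YX.
    by case: (Cgood _ CX) => // X0'; move: Xx; rewrite X0'.
  have [rX0 iX0 BX0 IX0 _] := gX0.
  split.
  - split; first by exists X0 => //; exact: (subring_set1 rX0).
    + move=> x y /common /[apply] -[X [CX [rX _ _ _ _] Xx Xy]].
      by exists X => //; exact: (subring_setB rX).
    + move=> x y /common /[apply] -[X [CX [rX _ _ _ _] Xx Xy]].
      by exists X => //; exact: (subring_setM rX).
  - split.
    + move=> x /[dup] /common /[apply] -[X [CX [_ iX _ _ _] Xx _]].
      by exists X => //; exact: (ideal_setS iX).
    + by exists X0 => //; exact: (ideal_set0 iX0).
    + move=> x y /common /[apply] -[X [CX [_ iX _ _ _] Xx Xy]].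
      by exists X => //; exact: (ideal_setB iX).
    + move=> x y /common /[apply] -[X [CX [_ iX _ _ _] Xx Xy]].
      by exists X => //; exact: (ideal_setM iX).
  - by move=> x Bx; exists X0 => //; exact: BX0.
  - by move=> x Ix; exists X0 => //; exact: IX0.
  - by move=> /[dup] /common /[apply] -[X [CX [_ _ _ _ nX] Xx _]].
move=> X [X_good Xmax].
have {X_good} [rX iX BX IX nX] : good X.
  case: X_good => // X0; exfalso; apply: (Xmax (code B I)); last by right; split.
  rewrite X0; split; last by move=> /(_ (true, 1)) /(_ (subring_set1 Br)).
  by [].
set O := ring_part X; set P := ideal_part X in iX IX nX.
(* If 1 is not in P[z], the pair (O[z], P[z]) is good, and maximality puts z into O. *)
have dichotomy z : adjoin_set P z 1 \/ O z.
  have [|nPz] := pselect (adjoin_set P z 1); [by left | right].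
  apply: contrapT => nOz; apply: (Xmax (code (adjoin_set O z) (adjoin_set P z))).
    split.
      move=> [[] y] Xy.
        by apply: sub_adjoin => //; exact: (subring_set0 rX).
      by apply: sub_adjoin => //; exact: (ideal_set0 iX).
    by move=> /(_ (true, z)) Xz; apply/nOz/Xz; exact: mem_adjoin.
  right; split.
  - exact: adjoin_subring.
  - exact: adjoin_ideal.
  - by move=> y /BX Oy; apply: sub_adjoin => //; exact: (subring_set0 rX).
  - by move=> y /IX Py; apply: sub_adjoin => //; exact: (ideal_set0 iX).
  - exact: nPz.
have Oval z : O z \/ O z^-1.
  have [->|z0] := eqVneq z 0; first by left; exact: (subring_set0 rX).
  have [Pz|] := dichotomy z; last by left.
  have [Pz'|] := dichotomy z^-1; last by right.
  by case: (adjoin_proper rX iX nX z0).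
have Punit y : P y -> y != 0 -> ~ O y^-1.
  by move=> Py y0 Oy; apply: nX; rewrite -(mulVf y0); exact: (ideal_setM iX).
have Pb : P b by exact: IX.
exists O; split=> //.
  split=> //.
  - split; first by move=> _ [c _ <-]; apply: BX; apply: KB; exists c.
    move=> /(_ b) []; first exact: (ideal_setS iX).
    move=> c _ cb; apply: (Punit b) => //; apply: BX; apply: KB; exists c^-1 => //.
    by rewrite fmorphV cb.
  - by split=> // /(_ b^-1) Ob; apply: (Punit b) => //; exact: Ob.
  - exact: (subring_setB rX).
  - exact: (subring_setM rX).
move=> y /IX Py; split; first exact: (ideal_setS iX).
by have [|y0] := eqVneq y 0; [left | right; exact: Punit].
Qed.

End PlaceExtension.

(** * Local rings of plane curves *)

Section PthPowers.

Lemma pth_power_sum (R : comNzRingType) p (I : Type) (r : seq I) (P : pred I) (f g : I -> R) :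
  p \in [pchar R] -> (forall i, P i -> f i = g i ^+ p) ->
  \sum_(i <- r | P i) f i = (\sum_(i <- r | P i) g i) ^+ p.
Proof.
move=> pR fg; rewrite -(pFrobenius_autE pR) rmorph_sum /=.
by apply: eq_bigr => i Pi; rewrite fg // pFrobenius_autE.
Qed.

Definition perfect (K : fieldType) (p : nat) :=
  p \in [pchar K] /\ forall c : K, exists d, c = d ^+ p.

(** Only exponents divisible by p survive, and perfectness supplies p-th roots of their
    coefficients. *)
Lemma deriv0_pth_power (K : fieldType) p (f : {poly K}) :
  perfect K p -> f^`() = 0 -> exists g : {poly K}, f = g ^+ p.
Proof.
move=> [pK rootK] f0.
have pKX : p \in [pchar {poly K}] by rewrite pchar_poly.
have p0 : (0 < p)%N by rewrite prime_gt0 // (pcharf_prime pK).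
have coef_pth i : exists g : {poly K}, f`_i *: 'X^i = g ^+ p.
  have [/dvdnP [k ->]|npi] := boolP (p %| i)%N.
    have [d ->] := rootK f`_(k * p); exists (d *: 'X^k).
    by rewrite exprZn -exprM.
  exists 0; rewrite expr0n eqn0Ngt p0 /=.
  suff -> : f`_i = 0 by rewrite scale0r.
  case: i npi => [|i] npi; first by rewrite dvdn0 in npi.
  have := coef_deriv f i; rewrite f0 coef0 -mulr_natr => /esym/eqP.
  rewrite mulf_eq0 => /orP[/eqP //|]; rewrite -(dvdn_pcharf pK).
  by rewrite (negbTE npi).
have [g fg] := choice coef_pth.
exists (\sum_(i < size f) g i).
by rewrite -(pth_power_sum _ pKX (fun (i : 'I_(size f)) _ => fg i)) -poly_def coefK.
Qed.

End PthPowers.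

Section Evaluation.
Variables (K : fieldType) (F : comNzRingType) (iota : {rmorphism K -> F}).

Definition ev1 (x : F) : {poly K} -> F := horner_eval x \o map_poly iota.
HB.instance Definition _ x := GRing.RMorphism.copy (ev1 x) (horner_eval x \o map_poly iota).

(** The inner variable goes to [x] and the outer one to [y]: elements of K[x][Y] are evaluated at Y
    = y. *)
Definition ev2 (x y : F) : {poly {poly K}} -> F := horner_eval y \o map_poly (ev1 x).
HB.instance Definition _ x y :=
  GRing.RMorphism.copy (ev2 x y) (horner_eval y \o map_poly (ev1 x)).

Lemma ev1E x P : ev1 x P = (map_poly iota P).[x]. Proof. by []. Qed.

Lemma ev1C x c : ev1 x c%:P = iota c.
Proof. by rewrite ev1E map_polyC hornerC. Qed.

Lemma ev1X x : ev1 x 'X = x.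
Proof. by rewrite ev1E map_polyX hornerX. Qed.

Lemma ev2E x y C : ev2 x y C = (map_poly (ev1 x) C).[y]. Proof. by []. Qed.

Lemma ev2C x y P : ev2 x y P%:P = ev1 x P.
Proof. by rewrite ev2E map_polyC hornerC. Qed.

Lemma ev2X x y : ev2 x y 'X = y.
Proof. by rewrite ev2E map_polyX hornerX. Qed.

Lemma ev2D x y A B : ev2 x y (A + B) = ev2 x y A + ev2 x y B.
Proof. exact: rmorphD. Qed.

Lemma ev2B x y A B : ev2 x y (A - B) = ev2 x y A - ev2 x y B.
Proof. exact: rmorphB. Qed.

Lemma ev2M x y A B : ev2 x y (A * B) = ev2 x y A * ev2 x y B.
Proof. exact: rmorphM. Qed.

Lemma ev1M x A B : ev1 x (A * B) = ev1 x A * ev1 x B.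
Proof. exact: rmorphM. Qed.

Lemma ev2Z x y P C : ev2 x y (P *: C) = ev1 x P * ev2 x y C.
Proof. by rewrite -mul_polyC rmorphM /= ev2C. Qed.

Lemma ev2_sum x y C : ev2 x y C = \sum_(i < size C) ev1 x C`_i * y ^+ i.
Proof. by rewrite -{1}[C]coefK poly_def rmorph_sum /=; apply: eq_bigr => i _;
  rewrite ev2Z rmorphXn /= ev2X. Qed.

Lemma ev2_horner x y C :
  ev2 x y C = (map_poly (map_poly iota) C).[y%:P].[x].
Proof.
rewrite ev2_sum (@horner_coef_wide _ (size C) (map_poly (map_poly iota) C)) ?size_poly //.
rewrite -[RHS]/(horner_eval x _) rmorph_sum /=.
by apply: eq_bigr => i _; rewrite /horner_eval hornerM coef_map -polyC_exp hornerC.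
Qed.

End Evaluation.

Section EvaluationSubring.
Variables (K F : fieldType) (iota : {rmorphism K -> F}).

Lemma ev2_sub (A : set F) x y C : subring_set A -> range iota `<=` A -> A x -> A y ->
  A (ev2 iota x y C).
Proof.
move=> Ar KA Ax Ay.
have AKx P : A (ev1 iota x P).
  rewrite ev1E horner_coef; apply: subring_set_sum => // i _.
  apply: subring_setM => //; last exact: subring_setX.
  by rewrite coef_map; apply: KA; exists P`_i.
rewrite ev2_sum; apply: subring_set_sum => // i _.
by apply: subring_setM => //; exact: subring_setX.
Qed.

Lemma place_subring O : is_place iota O -> subring_set O.
Proof. by move=> OP; split; [exact: (place1 OP) | exact: (place_sub OP) | exact: (place_mul OP)]. Qed.

Lemma place_ev2 O x y C : is_place iota O -> O x -> O y -> O (ev2 iota x y C).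
Proof.
move=> OP Ox Oy; apply: ev2_sub => //; first exact: place_subring.
by move=> _ [c _ <-]; exact: (place_iota OP).
Qed.

Lemma place_ev1 O x P : is_place iota O -> O x -> O (ev1 iota x P).
Proof. by move=> OP Ox; rewrite -(ev2C iota x x); exact: place_ev2. Qed.

Lemma subring_range_ev2 x y : subring_set (range (ev2 iota x y)).
Proof.
split; first by exists 1 => //; rewrite rmorph1.
- by move=> _ _ [A _ <-] [B _ <-]; exists (A - B) => //; rewrite ev2B.
- by move=> _ _ [A _ <-] [B _ <-]; exists (A * B) => //; rewrite ev2M.
Qed.

Lemma iota_range_ev2 x y : range iota `<=` range (ev2 iota x y).
Proof. by move=> _ [c _ <-]; exists c%:P%:P => //; rewrite ev2C ev1C. Qed.

Lemma range_ev2_fst x y : range (ev2 iota x y) x.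
Proof. by exists 'X%:P => //; rewrite ev2C ev1X. Qed.

Lemma range_ev2_snd x y : range (ev2 iota x y) y.
Proof. by exists 'X => //; rewrite ev2X. Qed.

End EvaluationSubring.

Opaque ev1 ev2.

Section Derivations.
Variables (K F : fieldType) (iota : {rmorphism K -> F}).
Variables (D : F -> F) (DP : is_derivation iota D).

Lemma derD x y : D (x + y) = D x + D y. Proof. by case: DP. Qed.

Lemma derM x y : D (x * y) = x * D y + y * D x. Proof. by case: DP. Qed.

Lemma der_iota c : D (iota c) = 0. Proof. by case: DP. Qed.

Lemma der0 : D 0 = 0. Proof. by have := der_iota 0; rewrite rmorph0. Qed.

Lemma der1 : D 1 = 0. Proof. by have := der_iota 1; rewrite rmorph1. Qed.

Lemma der_sum (I : Type) (r : seq I) (P : pred I) (f : I -> F) :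
  D (\sum_(i <- r | P i) f i) = \sum_(i <- r | P i) D (f i).
Proof. by apply: (big_morph D); [exact: derD | exact: der0]. Qed.

Lemma derX x k : D (x ^+ k) = k%:R * x ^+ k.-1 * D x.
Proof.
elim: k => [|[|k] IHk]; first by rewrite expr0 der1 !mul0r.
  by rewrite expr1 expr0 !mul1r.
by rewrite exprS derM IHk /= !exprS !mulrS; ring.
Qed.

Lemma derX_log x k : x != 0 -> D (x ^+ k) = x ^+ k * (k%:R * D x / x).
Proof.
move=> x0; rewrite derX; case: k => [|k] /=; first by rewrite !mul0r mulr0.
by rewrite exprS; field.
Qed.

Lemma derV x : D x^-1 = - D x / x ^+ 2.
Proof.
have [->|x0] := eqVneq x 0; first by rewrite invr0 der0 oppr0 mul0r.
have := der1; rewrite -(mulfV x0) derM => /eqP.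
rewrite addr_eq0 => /eqP e; apply: (mulfI x0); rewrite e.
by field.
Qed.

Lemma der_div x y : y != 0 -> D (x / y) = (D x * y - x * D y) / y ^+ 2.
Proof. by move=> y0; rewrite derM derV; field. Qed.

Lemma der_ev1 x P : D (ev1 iota x P) = ev1 iota x P^`() * D x.
Proof.
elim/poly_ind: P => [|P c IHP]; first by rewrite deriv0 !rmorph0 der0 mul0r.
rewrite derivD derivC addr0 derivM derivX mulr1 !rmorphD !rmorphM /= !ev1X ev1C.
by rewrite derD derM der_iota addr0 IHP; ring.
Qed.

(** Chain rule; [map_poly (@deriv K)] is the partial derivative in the inner variable. *)
Lemma der_ev2 x y C :
  D (ev2 iota x y C) =
    ev2 iota x y (map_poly (@deriv K) C) * D x + ev2 iota x y C^`() * D y.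
Proof.
elim/poly_ind: C => [|C P IHC].
  by rewrite deriv0 map_poly0 !rmorph0 der0 !mul0r addr0.
have -> : map_poly (@deriv K) (C * 'X + P%:P) =
    map_poly (@deriv K) C * 'X + P^`()%:P.
  apply/polyP => i; rewrite coef_map_id0 ?deriv0 // !coefD !coefMX !coefC.
  by rewrite coef_map_id0 ?deriv0 // derivD; do !case: ifP => _ //; rewrite deriv0.
rewrite derivD derivC addr0 derivM derivX mulr1 !rmorphD !rmorphM /= !ev2X !ev2C.
by rewrite derD derM der_ev1 IHC; ring.
Qed.

End Derivations.

Section Chart.
Variables (K F : fieldType) (iota : {rmorphism K -> F}) (p : nat).
Hypothesis K_perfect : perfect K p.
Variables (x y : F) (O : set F) (f : {poly {poly K}}).
Hypotheses (OP : is_place iota O) (Ox : O x) (Oy : O y).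
Hypothesis gen : forall z, exists A B, ev2 iota x y B != 0 /\
  z = ev2 iota x y A / ev2 iota x y B.
Hypotheses (f_monic : f \is monic) (f_root : ev2 iota x y f = 0).
Hypothesis f_sep : ~ place_ideal O (ev2 iota x y f^`()).

Local Notation ev := (ev2 iota x y).
Local Notation evx := (ev1 iota x).
Local Notation P := (place_ideal O).

Let Oev C : O (ev C). Proof. exact: place_ev2. Qed.
Let Oevx C : O (evx C). Proof. exact: place_ev1. Qed.

Lemma ev2_integral r : integralOver evx (ev r).
Proof.
rewrite ev2E; apply: integral_horner; last by exists f => //; apply/eqP; rewrite -ev2E.
by apply/integral_poly => i; rewrite coef_map; exact: integral_id.
Qed.

(** The lowest nonzero coefficient of an integral equation of [ev r] over K[x] is a multiple of
    [ev r]. It is sought after evaluation at x, which is not assumed transcendental. *)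
Lemma chart_algebraic r : ev r != 0 ->
  exists c s, evx c != 0 /\ evx c = ev r * ev s.
Proof.
move=> r0.
have [g g_monic /rootP gr] := ev2_integral r.
have exk : exists k, evx g`_k != 0.
  exists (size g).-1; rewrite -lead_coefE (monicP g_monic) rmorph1.
  exact: oner_neq0.
have [k gk kmin] := ex_minnP exk.
have q_root : ev2 iota x (ev r) (drop_poly k g) = 0.
  have : ev2 iota x (ev r) g = 0 by [].
  rewrite -[g in ev2 _ _ _ g](poly_take_drop k) rmorphD rmorphM rmorphXn /= ev2X.
  rewrite [X in X + _](_ : _ = 0) ?add0r => [/eqP|].
    by rewrite mulf_eq0 expf_eq0 (negbTE r0) andbF orbF => /eqP.
  rewrite ev2_sum big1 // => i _; rewrite coef_take_poly.
  case: ltnP => ik; last by rewrite rmorph0 mul0r.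
  have [->|/kmin] := eqVneq (evx g`_i) 0; first by rewrite mul0r.
  by rewrite leqNgt ik.
move: q_root; rewrite -(poly_take_drop 1 (drop_poly k g)) rmorphD rmorphM rmorphXn /=.
have -> : take_poly 1 (drop_poly k g) = (g`_k)%:P.
  apply/polyP => i; rewrite coef_take_poly coefC coef_drop_poly.
  by case: i.
rewrite ev2X ev2C => /eqP; rewrite addr_eq0 => /eqP gkE.
have [s _ sE] : range ev (- ev2 iota x (ev r) (drop_poly 1 (drop_poly k g))).
  apply: subring_setN; first exact: subring_range_ev2.
  apply: ev2_sub; first exact: subring_range_ev2.
  - exact: iota_range_ev2.
  - exact: range_ev2_fst.
  - by exists r.
by exists g`_k, s; split=> //; rewrite gkE sE mulrN mulrC.
Qed.

(** Among the nonzero polynomials with value in P, one of least degree divides all others. If h'(x)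
    were in P, minimality would give h' = 0, so h = g^p, and g would be a smaller choice. *)
Lemma chart_generator : exists h : {poly K},
  [/\ h != 0, evx h != 0, P (evx h), ~ P (evx h^`()) & forall c, P (evx c) -> h %| c].
Proof.
(* The denominator of a function outside O lies in P, and so does its multiple in K[x]. *)
have [c0 c0n [c0nz Pc0]] : exists2 c, evx c != 0 & evx c != 0 /\ P (evx c).
  have /existsNP [z nOz] : ~ (setT `<=` O) by have [] := place_proper OP.
  have {nOz} nOz : ~ O z by move=> Oz; apply: nOz.
  have z0 : z != 0 by apply/eqP => z0; apply: nOz; rewrite z0; exact: (place0 OP).
  have [A [B [B0 zE]]] := gen z.
  have A0 : ev A != 0 by apply: contra_neq z0 => A0; rewrite zE A0 mul0r.
  have PB : P (ev B).
    have -> : ev B = ev A * z^-1 by rewrite zE invf_div mulrCA mulfV ?mulr1.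
    by apply: (place_idealMr OP) => //; exact: (place_idealV OP).
  have [c [s [c0 cE]]] := chart_algebraic B0.
  by exists c => //; split=> //; rewrite cE; exact: (place_idealMl OP).
pose S k := `[< exists c : {poly K}, [/\ c != 0, P (evx c) & size c = k] >].
have exS : exists k, S k.
  exists (size c0); apply/asboolP; exists c0; split=> //.
  by apply: contra_neq c0n => ->; rewrite rmorph0.
have [k /asboolP [h [h0 Ph hk]] hmin] := ex_minnP exS.
have {hmin} hmin c : P (evx c) -> c != 0 -> (size h <= size c)%N.
  by move=> Pc c1; rewrite hk; apply: hmin; apply/asboolP; exists c.
have h_gen c : P (evx c) -> h %| c.
  move=> Pc; apply/modp_eq0P/eqP; apply: contraT => r0.
  have : P (evx (c %% h)).
    have -> : c %% h = c - c %/ h * h by rewrite {2}(divp_eq c h) addrC addKr.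
    rewrite rmorphB rmorphM; apply: (place_idealB OP) => //.
    by apply: (place_idealMr OP) => //; exact: place_ev1.
  by move=> /hmin /(_ r0); rewrite leqNgt ltn_modp h0.
have sh : (1 < size h)%N.
  rewrite ltnNge; apply/negP => /size1_polyC hE; apply: (@place_iota_unit _ _ _ _ OP h`_0).
    by apply: contra_neq h0 => h00; rewrite hE h00.
  by rewrite -(ev1C iota x) -hE.
exists h; split=> //.
- apply: contra_neq c0n => h00.
  by have /dvdpP [q ->] := h_gen _ Pc0; rewrite rmorphM /= h00 mulr0.
- move=> Ph'; have h'0 : h^`() = 0.
    apply/eqP; apply: contraT => h'0; have := hmin _ Ph' h'0.
    by rewrite leqNgt lt_size_deriv.
  have [g gE] := deriv0_pth_power K_perfect h'0.
  have g0 : g != 0 by apply: contra_neq h0 => g0; rewrite gE g0 expr0n gtn_eqF // prime_gt0 // (pcharf_prime K_perfect.1).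
  have Pg : P (evx g).
    by apply: (place_ideal_exp OP (k := p)) => //; rewrite -rmorphXn -gE.
  have := hmin _ Pg g0; have := size_exp g p; rewrite -gE => sE.
  have p1 : (1 < p)%N by rewrite prime_gt1 // (pcharf_prime K_perfect.1).
  move: sE sh; case: (size h) => // a; case: (size g) => [|b] /= -> //.
  rewrite !ltnS => b1; have {b1} : (0 < b)%N by case: b b1.
  by move=> b0; rewrite leqNgt ltn_Pmulr.
Qed.

(* Let k have minimal degree in Y among the polynomials with value in P and
   unit leading coefficient.  Pseudo-division by k shows that h(x) and k(x, y)
   generate P /\ K[x, y] locally; differentiating lc^N f = q k + h s shows that q
   is a unit at O, so that k is locally a multiple of h. *)
Lemma chart_uniformizer : exists h : {poly K},
  [/\ evx h != 0, P (evx h), ~ P (evx h^`()),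
    forall c, P (evx c) -> h %| c &
    forall r, P (ev r) -> exists e s, ~ P (ev e) /\ ev e * ev r = evx h * ev s].
Proof.
have [h [h0 hx0 Ph Ph' h_gen]] := chart_generator.
exists h; split=> //.
pose S k := `[< exists g : {poly {poly K}},
  [/\ P (ev g), ~ P (evx (lead_coef g)) & size g = k] >].
have exS : exists k, S k.
  exists (size f); apply/asboolP; exists f; split=> //.
    by rewrite f_root; exact: (place_ideal0 OP).
  by rewrite (monicP f_monic) rmorph1; exact: (place_ideal1 OP).
have [d /asboolP [k [Pk lk kd]] kmin] := ex_minnP exS.
have {kd} kmin g : P (ev g) -> (size g < size k)%N -> P (evx (lead_coef g)).
  move=> Pg gk; apply: contrapT => lg; move: gk; rewrite kd ltnNge kmin //.
  by apply/asboolP; exists g.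
have k0 : k != 0.
  by apply/eqP => k0; apply: lk; rewrite k0 lead_coef0 rmorph0; exact: (place_ideal0 OP).
(* By minimality of [k] the leading coefficient of [r] is divisible by [h]; removing the leading
   term and repeating reaches all coefficients. *)
have small r : P (ev r) -> (size r < size k)%N -> exists s, r = h *: s.
  have [N] := ubnP (size r); elim: N r => // N IHN r; rewrite ltnS => rN Pr rk.
  have [->|r0] := eqVneq r 0; first by exists 0; rewrite scaler0.
  have /h_gen /dvdpP [c cE] := kmin r Pr rk.
  pose l : {poly {poly K}} := (lead_coef r)%:P * 'X^((size r).-1).
  have sl : (size (r - l)%R < size r)%N.
    rewrite -[X in (_ < X)%N]prednK ?size_poly_gt0 // ltnS.
    apply/leq_sizeP => j; rewrite leq_eqVlt coefB coefCM coefXn => /predU1P[<-|lj].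
      by rewrite eqxx mulr1 subrr.
    rewrite gtn_eqF // mulr0 subr0 nth_default //.
    by rewrite -[size r]prednK ?size_poly_gt0.
  have Pl : P (ev l).
    rewrite rmorphM /= ev2C cE rmorphM /=.
    by apply: (place_idealMl OP); first exact: (place_idealMr OP).
  have lE : l = h *: (c *: 'X^((size r).-1)).
    by rewrite scalerA mulrC -cE /l mul_polyC.
  move: l sl Pl lE => l sl Pl lE.
  have [||s sE] := IHN (r - l) (leq_trans sl rN).
  - by rewrite ev2B; exact: (place_idealB OP).
  - exact: ltn_trans sl rk.
  by exists (s + c *: 'X^((size r).-1)); rewrite scalerDr -sE -lE subrK.
have division r : P (ev r) -> exists N q s,
    (lead_coef k ^+ N) *: r = q * k + h *: s.
  move=> Pr; have divE := Pdiv.Idomain.divp_eq r k.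
  have [||s sE] := small (r %% k).
  - have -> : r %% k = (lead_coef k ^+ scalp r k) *: r - r %/ k * k.
      by rewrite divE addrC addKr.
    rewrite ev2B ev2M ev2Z; apply: (place_idealB OP).
      by apply: (place_idealMr OP) => //; exact: place_ev1.
    exact: (place_idealMr OP).
  - by rewrite Pdiv.Idomain.ltn_modpN0.
  by exists (scalp r k), (r %/ k), s; rewrite -sE.
have Pf : P (ev f) by rewrite f_root; exact: (place_ideal0 OP).
have lkN N : ~ P (evx (lead_coef k ^+ N)).
  by rewrite rmorphXn; apply: (place_unitX OP) => //; exact: place_ev1.
have [N [q [s fE]]] := division f Pf.
have Pq : ~ P (ev q).
  move=> Pq; have := congr1 (fun g => ev g^`()) fE.
  rewrite derivD derivM !derivZ !ev2D !ev2M !ev2Z => e.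
  have : P (evx (lead_coef k ^+ N) * ev f^`()).
    rewrite e; apply: (place_idealD OP); last exact: (place_idealMl OP).
    apply: (place_idealD OP); first exact: (place_idealMr OP).
    exact: (place_idealMl OP).
  by apply: (place_unitM OP) => //; exact: place_ev1.
have qk : ev q * ev k = - evx h * ev s.
  have := congr1 ev fE; rewrite ev2Z f_root mulr0 ev2D ev2M ev2Z => /esym/eqP.
  by rewrite addr_eq0 mulNr => /eqP.
move=> r Pr; have [N' [q' [s' rE]]] := division r Pr.
(* Multiply l^N' r = q' k + h s' by q, where l is the leading coefficient of k, and substitute q k =
   - h s. *)
exists (lead_coef k ^+ N' *: q), (q * s' - q' * s); split.
  by rewrite ev2Z; apply: (place_unitM OP) => //; exact: place_ev1.
have := congr1 ev rE; rewrite ev2D ev2M !ev2Z ev2B !ev2M => e.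
rewrite mulrAC e mulrDl -mulrA [ev k * _]mulrC qk.
by ring.
Qed.

(** Extracting h(x) from [ev r] terminates because each step also removes a factor h from a multiple
    c(x) of [ev r], whose degree decreases; the induction keeps the multiple up to a unit e. *)
Lemma chart_order h : evx h != 0 -> P (evx h) ->
    (forall c, P (evx c) -> h %| c) ->
    (forall r, P (ev r) -> exists e s, ~ P (ev e) /\ ev e * ev r = evx h * ev s) ->
  forall r, ev r != 0 -> exists k e s,
    [/\ ~ P (ev e), ~ P (ev s) & ev e * ev r = evx h ^+ k * ev s].
Proof.
move=> h0 Ph h_gen loc.
suff claim N : forall (c : {poly K}) r r' e, (size c <= N)%N -> evx c != 0 -> ~ P (ev e) ->
    ev e * evx c = ev r * ev r' -> exists k e s,
    [/\ ~ P (ev e), ~ P (ev s) & ev e * ev r = evx h ^+ k * ev s].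
  move=> r /chart_algebraic [c [s [c0 cE]]].
  apply: (claim (size c) c r s 1) => //; rewrite rmorph1 ?mul1r //.
  exact: (place_ideal1 OP).
elim: N => [|N IHN] c r r' e cN c0 Pe eE.
  by move: c0; move: cN; rewrite leqn0 size_poly_eq0 => /eqP ->; rewrite rmorph0 eqxx.
have [Pr|nPr] := pselect (P (ev r)); last first.
  by exists 0%N, 1, r; rewrite rmorph1 expr0 !mul1r; split=> //; exact: (place_ideal1 OP).
have [e1 [r1 [Pe1 r1E]]] := loc r Pr.
have Pc : P (evx c).
  have : P (ev e * evx c) by rewrite eE; exact: (place_idealMl OP).
  by case/(place_ideal_prime OP) => //; exact: place_ev1.
have /dvdpP [c1 c1E] := h_gen c Pc.
have c10 : evx c1 != 0 by apply: contra_neq c0 => c10; rewrite c1E rmorphM /= c10 mul0r.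
have hn : h != 0 by apply: contra_neq h0 => ->; rewrite rmorph0.
have sh : (1 < size h)%N.
  rewrite ltnNge; apply/negP => /size1_polyC hE; apply: (@place_iota_unit _ _ _ _ OP h`_0).
    by apply: contra_neq hn => h00; rewrite hE h00.
  by rewrite -(ev1C iota x) -hE.
have c1n : c1 != 0 by apply: contra_neq c10 => ->; rewrite rmorph0.
have [|||k [e2 [s [Pe2 Ps sE]]]] := IHN c1 r1 r' (e1 * e) _ c10.
- move: cN; rewrite c1E size_mul //; case: (size h) sh => [|[|a]] // _.
  by rewrite addnS addnS /= ltnS; apply: leq_trans; rewrite leq_addr.
- by rewrite ev2M; exact: (place_unitM OP).
- apply: (mulfI h0); rewrite ev2M [RHS]mulrA -r1E -[RHS]mulrA -eE c1E.
  by rewrite ev1M; ring.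
exists k.+1, (e2 * e1), s; split=> //.
  by rewrite ev2M; exact: (place_unitM OP).
by rewrite ev2M -mulrA r1E mulrCA sE exprS mulrA.
Qed.

(** Numerator and denominator are powers of h(x) times units. A larger power in the denominator
    would make 1 the product of z with an element of P. *)
Lemma chart_local z : O z -> exists A B, ~ P (ev B) /\ z = ev A / ev B.
Proof.
move=> Oz; have [h [h0 Ph _ h_gen loc]] := chart_uniformizer.
have [A [B [B0 zE]]] := gen z.
have ord := chart_order h0 Ph h_gen loc.
have nz e : ~ P (ev e) -> ev e != 0.
  by move=> Pe; apply/eqP => e0; apply: Pe; rewrite e0; exact: (place_ideal0 OP).
have [A0|A0] := eqVneq (ev A) 0.
  exists 0, 1; rewrite rmorph0 mul0r zE A0 mul0r rmorph1; split=> //.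
  exact: (place_ideal1 OP).
have [k [e [s [Pe Ps sE]]]] := ord A A0.
have [l [e' [s' [Pe' Ps' sE']]]] := ord B B0.
have [[e0 e'0] [s0 s'0]] := ((nz _ Pe, nz _ Pe'), (nz _ Ps, nz _ Ps')).
have eA : ev A = evx h ^+ k * ev s / ev e by rewrite -sE; field.
have eB : ev B = evx h ^+ l * ev s' / ev e' by rewrite -sE'; field.
have [lk|kl] := leqP l k.
  exists (h%:P ^+ (k - l) * s * e'), (e * s'); split.
    by rewrite ev2M; exact: (place_unitM OP).
  rewrite !ev2M rmorphXn /= ev2C zE eA eB -[in LHS](subnK lk) exprD.
  have hl : evx h ^+ l != 0 by rewrite expf_neq0.
  by field; rewrite hl e0 e'0 s'0.
exfalso; apply: (place_ideal1 OP).
have -> : 1 = z * (evx h ^+ (l - k) * ((ev s' * ev e) * (ev s * ev e')^-1)).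
  rewrite zE eA eB -{1}(subnK (ltnW kl)) exprD.
  have hl : evx h ^+ (l - k) != 0 by rewrite expf_neq0.
  have hk : evx h ^+ k != 0 by rewrite expf_neq0.
  move: (_ ^+ _) hl (evx h ^+ k) hk => H1 hl H2 hk.
  by field; rewrite ?hl ?hk ?e0 ?e'0 ?s0 ?s'0.
apply: (place_idealMr OP) => //; apply: (place_idealMl OP).
  by apply: (place_idealX OP) => //; rewrite subn_gt0.
apply: (placeM OP); first exact: (placeM OP).
rewrite -ev2M; have [] // := placeV OP (Oev (s * e')).
by rewrite ev2M; exact: (place_unitM OP).
Qed.

Lemma chart_derivation (D : F -> F) : is_derivation iota D -> O (D x) -> O (D y) ->
  forall z, O z -> O (D z).
Proof.
move=> DP ODx ODy z /chart_local [A [B [PB ->]]].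
have [B0 OB] := placeV OP (Oev B) PB.
have ODev C : O (D (ev C)).
  by rewrite (der_ev2 DP); apply: (placeD OP); apply: (placeM OP) => //; exact: place_ev2.
rewrite (der_div DP) //.
apply: (placeM OP); last by rewrite -exprVn; exact: (placeX OP).
by apply: (place_sub OP); exact: (placeM OP).
Qed.

(** Besides a prime element h(x), this yields the unit factor h'(x) in D(h(x)) = h'(x) D x. *)
Lemma chart_prime : exists h : {poly K},
  prime_element O (evx h) /\ ~ P (evx h^`()).
Proof.
have [h [h0 Ph Ph' _ loc]] := chart_uniformizer.
exists h; split=> //; apply/seteqP; split=> z /=.
  move=> Pz; have [A [B [PB zE]]] := chart_local (place_idealW Pz).
  have [B0 OB] := placeV OP (Oev B) PB.
  have PA : P (ev A).
    have -> : ev A = z * ev B by rewrite zE divfK.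
    exact: (place_idealMl OP).
  have [e [s [Pe sE]]] := loc A PA.
  have [e0 Oe] := placeV OP (Oev e) Pe.
  exists (ev s / ev e / ev B); first by do 2!apply: (placeM OP) => //.
  by rewrite zE !mulrA -sE; field; rewrite B0.
by move=> [y' Oy' <-]; exact: (place_idealMl OP).
Qed.

End Chart.

(** * The Fermat polynomial *)

Section FermatPolynomial.

Definition fermat_poly (K : fieldType) n m : {poly {poly K}} := 'X^n + ('X^m + 1)%:P.

Lemma irreducible_factor (K : fieldType) (f : {poly K}) : (1 < size f)%N ->
  exists2 g, irreducible_poly g & g %| f.
Proof.
have [N] := ubnP (size f); elim: N f => // N IHN f; rewrite ltnS => fN f1.
have [irr|] := pselect (irreducible_poly f); first by exists f.
move=> nirr; have [g [g1 gf ngf]] : exists g : {poly K}, [/\ size g != 1%N, g %| f & ~~ (g %= f)].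
  apply: contrapT => /forallNP H; apply: nirr; split=> // g g1 gf.
  by apply: contraT => ngf; case: (H g).
have f0 : f != 0 by rewrite -size_poly_gt0 ltnW.
have g0 : g != 0 by apply: contraTneq gf => ->; rewrite dvd0p.
have gf' : (size g < size f)%N.
  by rewrite ltn_neqAle (dvdp_leq f0 gf) andbT (dvdp_size_eqp gf).
have [||h irrh hg] := IHN g.
- exact: leq_trans gf' fN.
- by rewrite ltn_neqAle eq_sym g1 size_poly_gt0.
by exists h => //; exact: dvdp_trans hg gf.
Qed.

Lemma exists_root_extension (K : fieldType) (f : {poly K}) : (1 < size f)%N ->
  exists (L : fieldType) (j : {rmorphism K -> L}) (b : L), root (map_poly j f) b.
Proof.
move=> /irreducible_factor [g /irredp_FAdjoin [L _ [b gb _]] gf].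
exists L, (in_alg L), b; have /dvdpP [q ->] := gf.
by rewrite rmorphM rootM gb orbT.
Qed.

Lemma scale_of_root (L : fieldType) (b : L) (A : {poly {poly L}}) :
  map_poly (horner_eval b) A = 0 -> exists B, A = ('X - b%:P) *: B.
Proof.
move=> A0; have ex i : exists c, A`_i = c * ('X - b%:P).
  apply/dvdpP; rewrite dvdp_XsubCl /root -[_.[_]]/(horner_eval b _) -coef_map A0.
  by rewrite coef0.
have [c cE] := choice ex.
exists (\poly_(i < size A) c i); apply/polyP => i; rewrite coefZ coef_poly.
case: ltnP => Ai; first by rewrite cE mulrC.
by rewrite mulr0 nth_default.
Qed.

(* Eisenstein's criterion at a simple root b of g, where c clears the
   denominators of a factorization over the fraction field L(V). *)
Lemma eisenstein (L : fieldType) (b : L) (g g1 c : {poly L}) (q A : {poly {poly L}}) n :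
    (0 < n)%N -> g = ('X - b%:P) * g1 -> g1.[b] != 0 -> c != 0 ->
    c *: ('X^n + g%:P) = q * A -> (size A <= n)%N -> (size A <= 1)%N.
Proof.
move=> n0 gE g1b.
have [N] := ubnP (size c); elim: N c q A => // N IHN c q A; rewrite ltnS => cN c0 fE An.
have Xb0 : 'X - b%:P != 0 :> {poly L} by rewrite polyXsubC_eq0.
have scaleI (B C : {poly {poly L}}) : ('X - b%:P) *: B = ('X - b%:P) *: C -> B = C.
  by rewrite -!mul_polyC => /(mulfI (_ : ('X - b%:P)%:P != 0)); apply; rewrite polyC_eq0.
have sizef : size ('X^n + g%:P : {poly {poly L}}) = n.+1.
  rewrite size_polyDl size_polyXn // (leq_ltn_trans (size_polyC_leq1 _)) //.
have redE : map_poly (horner_eval b) q * map_poly (horner_eval b) A = c.[b] *: 'X^n.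
  rewrite -rmorphM -fE /= map_polyZ rmorphD /= map_polyXn map_polyC /=.
  by rewrite /horner_eval gE hornerM hornerXsubC subrr mul0r addr0.
(* If V - b divides c, it divides q or A and can be cancelled, which lowers the degree of c. *)
have [cb|cb] := eqVneq c.[b] 0.
  have /dvdpP [c1 c1E] : 'X - b%:P %| c by rewrite dvdp_XsubCl /root cb.
  have c10 : c1 != 0 by apply: contra_neq c0 => c10; rewrite c1E c10 mul0r.
  have c1N : (size c1 < N)%N.
    by move: cN; rewrite c1E size_mul // size_XsubC addn2.
  move: redE; rewrite cb scale0r => /eqP; rewrite mulf_eq0 => /orP[] /eqP /scale_of_root [B BE].
    apply: (IHN c1 B A) => //; apply: scaleI.
    by rewrite scalerA mulrC -c1E fE BE scalerAl.
  have AB : size A = size B by rewrite BE size_scale.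
  rewrite AB; apply: (IHN c1 q B) => //; last by rewrite -AB.
  apply: scaleI.
  by rewrite scalerA mulrC -c1E fE BE scalerAr.
rewrite leqNgt; apply/negP => A1.
set a := map_poly _ A in redE; set d := map_poly _ q in redE.
have [A0 q0] : A != 0 /\ q != 0.
  have : q * A != 0 by rewrite -fE -mul_polyC mulf_eq0 polyC_eq0 negb_or c0 -size_poly_gt0 sizef.
  by rewrite mulf_eq0 negb_or => /andP[].
have sqA : (size q + size A = n.+2)%N.
  have : size (q * A) = n.+1 by rewrite -fE size_scale.
  rewrite size_mul // => e; rewrite -[LHS]prednK ?e //.
  by rewrite addn_gt0 !size_poly_gt0 q0.
(* Modulo V - b the product is a nonzero multiple of U^n, and both factors have degree below n; so
   neither constant term can be nonzero. *)
have Xn_dvd r : coprimep 'X^n r -> forall s, r * s = c.[b] *: 'X^n -> (size s <= n)%N -> False.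
  move=> cop s rs sn; have : 'X^n %| s.
    by rewrite -(Gauss_dvdpr _ cop) rs -mul_polyC dvdp_mull.
  have s0 : s != 0.
    apply/eqP => s0; move/eqP: rs; rewrite s0 mulr0 eq_sym -mul_polyC mulf_eq0.
    by rewrite polyC_eq0 (negbTE cb) -size_poly_eq0 size_polyXn.
  by move/(dvdp_leq s0); rewrite size_polyXn => /leq_trans/(_ sn); rewrite ltnn.
have copX (r : {poly L}) : r.[0] != 0 -> coprimep 'X^n r.
  by move=> r0; rewrite coprimep_pexpl // coprimep_sym coprimepX.
have sa : (size a <= size A)%N by exact: size_poly.
have sd : (size d <= size q)%N by exact: size_poly.
have a0 : a.[0] = 0.
  apply/eqP; apply: contraT => a0; case: (Xn_dvd _ (copX _ a0) d); first by rewrite mulrC.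
  by apply: leq_trans sd _; lia.
have d0 : d.[0] = 0.
  apply/eqP; apply: contraT => d0; case: (Xn_dvd _ (copX _ d0) a) => //.
  exact: leq_trans sa _.
have /dvdpP [A1' A1E] : 'X - b%:P %| A`_0.
  by rewrite dvdp_XsubCl /root -[_.[_]]/(horner_eval b _) -coef_map -horner_coef0 a0.
have /dvdpP [q1' q1E] : 'X - b%:P %| q`_0.
  by rewrite dvdp_XsubCl /root -[_.[_]]/(horner_eval b _) -coef_map -horner_coef0 d0.
have cgE : c * g = q`_0 * A`_0.
  rewrite -coef0M -fE coefZ coefD coefC /= coefXn eq_sym gtn_eqF //.
  by rewrite add0r.
(* Both constant terms being divisible by V - b, their product c g is divisible by its square,
   although b is a simple root of g and no root of c. *)
have : c * g1 = ('X - b%:P) * (q1' * A1').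
  apply: (mulfI Xb0); move: cgE; rewrite gE A1E q1E => e.
  by rewrite mulrCA e; ring.
move/(congr1 (fun h => h.[b])); rewrite !hornerM hornerXsubC subrr mul0r => /eqP.
by rewrite mulf_eq0 (negbTE cb) (negbTE g1b).
Qed.

(** As m is nonzero in K, V^m + 1 has a simple root in some extension of K, where Eisenstein's
    criterion applies. *)
Lemma fermat_factor (K : fieldType) n m (c : {poly K}) (q A : {poly {poly K}}) :
    (0 < n)%N -> (0 < m)%N -> m%:R != 0 :> K -> c != 0 ->
    c *: fermat_poly K n m = q * A -> (size A <= n)%N -> (size A <= 1)%N.
Proof.
move=> n0 m0 mK c0 fE An.
have sg : (1 < size ('X^m + 1 : {poly K})%R)%N.
  by rewrite size_polyDl size_polyXn ?size_poly1.
have [L [j [b gb]]] := exists_root_extension sg.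
have gE0 : map_poly j ('X^m + 1) = 'X^m + 1 by rewrite rmorphD /= map_polyXn rmorph1.
have /dvdpP [g1 g1E] : 'X - b%:P %| ('X^m + 1 : {poly L}) by rewrite dvdp_XsubCl -gE0.
have bm : b ^+ m = -1.
  by apply/eqP; rewrite -addr_eq0; move: gb; rewrite gE0 /root !hornerE.
have b0 : b != 0.
  apply: contra_eq_neq bm => ->; rewrite expr0n gtn_eqF //= eq_sym oppr_eq0.
  exact: oner_neq0.
have g1b : g1.[b] != 0.
  have := congr1 (fun h => h^`().[b]) g1E.
  rewrite derivD derivXn derivC addr0 derivM derivXsubC mulr1 !hornerE subrr mulr0 add0r.
  move=> <-; rewrite hornerMn hornerXn -mulr_natr mulf_neq0 ?expf_neq0 //.
  by rewrite -(rmorph_nat j) fmorph_eq0.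
have sE (B : {poly {poly K}}) : size (map_poly (map_poly j) B) = size B.
  by apply: size_map_inj_poly; [exact: map_poly_inj | exact: rmorph0].
rewrite -sE; apply: (@eisenstein L b ('X^m + 1) g1 (map_poly j c) (map_poly (map_poly j) q) _ n).
- by [].
- by rewrite mulrC.
- by [].
- by rewrite map_poly_eq0.
- rewrite -rmorphM -fE /= map_polyZ /=; congr (_ *: _).
  by rewrite -gE0 -map_polyC -[X in X + _](map_polyXn (map_poly j)) -rmorphD.
- by rewrite sE.
Qed.

Variables (K F : fieldType) (iota : {rmorphism K -> F}) (n m : nat) (u v : F).
Hypotheses (n0 : (0 < n)%N) (m0 : (0 < m)%N) (mK : m%:R != 0 :> K).
Hypothesis v_trans : ~ algebraicOver iota v.
Hypothesis uv : u ^+ n + v ^+ m + 1 = 0.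

Lemma ev1_inj c : ev1 iota v c = 0 -> c = 0.
Proof.
move=> c0; apply/eqP; apply: contraT => cn; case: v_trans; exists c => //.
exact/eqP.
Qed.

Lemma size_fermat_poly : size (fermat_poly K n m) = n.+1.
Proof.
rewrite size_polyDl size_polyXn // (leq_ltn_trans (size_polyC_leq1 _)) //.
Qed.

Lemma fermat_monic : fermat_poly K n m \is monic.
Proof.
rewrite monicE /fermat_poly lead_coefDl ?lead_coefXn // size_polyXn.
by rewrite (leq_ltn_trans (size_polyC_leq1 _)).
Qed.

Lemma ev2_fermat : ev2 iota v u (fermat_poly K n m) = 0.
Proof. by rewrite ev2D ev2C !rmorphD !rmorphXn /= ev2X ev1X rmorph1 addrA. Qed.

(** A relation of least degree in U pseudo-divides the Fermat polynomial; were its degree below n,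
    it would be a constant in K[V], and v would be algebraic. *)
Lemma ev2_ker_size A : ev2 iota v u A = 0 -> A != 0 -> (n < size A)%N.
Proof.
move=> A0 An.
pose S k := `[< exists B : {poly {poly K}},
  [/\ ev2 iota v u B = 0, B != 0 & size B = k] >].
have exS : exists k, S k by exists (size A); apply/asboolP; exists A.
have [k /asboolP [B [B0 Bn <-]] kmin] := ex_minnP exS.
have {kmin} kmin C : ev2 iota v u C = 0 -> C != 0 -> (size B <= size C)%N.
  by move=> C0 Cn; apply: kmin; apply/asboolP; exists C.
apply: leq_trans (kmin _ A0 An); rewrite ltnNge; apply/negP => Bs.
have divE := Pdiv.Idomain.divp_eq (fermat_poly K n m) B.
have r0 : fermat_poly K n m %% B = 0.
  apply/eqP; apply: contraT => rn; have := kmin (fermat_poly K n m %% B).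
  rewrite leqNgt Pdiv.Idomain.ltn_modpN0 //; apply=> //.
  have := congr1 (ev2 iota v u) divE.
  by rewrite ev2Z ev2_fermat mulr0 ev2D ev2M B0 mulr0 add0r.
rewrite r0 addr0 in divE.
have := fermat_factor n0 m0 mK _ divE Bs; rewrite expf_neq0 ?lead_coef_eq0 // => /(_ isT).
move=> /size1_polyC BE; move: B0; rewrite BE ev2C => /ev1_inj B0.
by move: Bn; rewrite BE B0 eqxx.
Qed.

Lemma ev2_ker A : ev2 iota v u A = 0 -> exists Q, A = Q * fermat_poly K n m.
Proof.
move=> A0; have divE := Pdiv.IdomainMonic.divp_eq fermat_monic A.
exists (A %/ fermat_poly K n m); rewrite {1}divE.
suff -> : A %% fermat_poly K n m = 0 by rewrite addr0.
apply/eqP; apply: contraT => rn.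
have : (n < size (A %% fermat_poly K n m)%R)%N.
  apply: ev2_ker_size => //; have := congr1 (ev2 iota v u) divE.
  by rewrite A0 ev2D ev2M ev2_fermat mulr0 add0r.
rewrite ltnNge -ltnS -size_fermat_poly Pdiv.Idomain.ltn_modpN0 //.
by rewrite -size_poly_gt0 size_fermat_poly.
Qed.

End FermatPolynomial.

(** * Differentials of the Fermat function field *)

Section DerivationUniqueness.
Variables (K F : fieldType) (iota : {rmorphism K -> F}) (x y : F).
Hypothesis gen : forall z, exists A B, ev2 iota x y B != 0 /\
  z = ev2 iota x y A / ev2 iota x y B.

Lemma derivation_ext D D' : is_derivation iota D -> is_derivation iota D' ->
  D x = D' x -> D y = D' y -> D =1 D'.
Proof.
move=> DP DP' Dx Dy z; have [A [B [B0 ->]]] := gen z.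
by rewrite (der_div DP) // (der_div DP') // !(der_ev2 DP) !(der_ev2 DP') Dx Dy.
Qed.

Lemma derivation_scale D c : is_derivation iota D -> is_derivation iota (fun z => c * D z).
Proof.
move=> DP; split=> [a b|a b|a].
- by rewrite (derD DP) mulrDr.
- by rewrite (derM DP); ring.
- by rewrite (der_iota DP) mulr0.
Qed.

End DerivationUniqueness.

Section Fermat.
Variables (K F : fieldType) (iota : {rmorphism K -> F}) (n m : nat) (u v : F).

Record fermat_curve : Prop := FermatCurve {
  fermat_n0 : (0 < n)%N;
  fermat_m0 : (0 < m)%N;
  fermat_nK : n%:R != 0 :> K;
  fermat_mK : m%:R != 0 :> K;
  fermat_trans : ~ algebraicOver iota v;
  fermat_gen : generated_by iota u v;
  fermat_eq : u ^+ n + v ^+ m + 1 = 0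
}.

Hypothesis C : fermat_curve.

Local Notation ev := (ev2 iota v u).

Lemma fermat_genE z : exists A B, ev B != 0 /\ z = ev A / ev B.
Proof.
have [A [B /= [B0 zE]]] := fermat_gen C z.
by exists A, B; rewrite !ev2_horner.
Qed.

Lemma fermat_nF : n%:R != 0 :> F.
Proof. by rewrite -(rmorph_nat iota) fmorph_eq0; exact: fermat_nK. Qed.

Lemma fermat_v0 : v != 0.
Proof.
apply/eqP => v0; apply: (fermat_trans C); exists 'X; rewrite ?polyX_eq0 //.
by rewrite map_polyX /root hornerX v0.
Qed.

Lemma fermat_u0 : u != 0.
Proof.
apply/eqP => u0; apply: (fermat_trans C); exists ('X^m + 1).
  by rewrite -size_poly_eq0 size_polyDl size_polyXn ?size_poly1 ?ltnS ?(fermat_m0 C).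
have := fermat_eq C; rewrite u0 expr0n gtn_eqF ?(fermat_n0 C) //= add0r => e.
by rewrite rmorphD /= map_polyXn rmorph1 /root hornerD hornerXn hornerC e.
Qed.

Lemma fermat_kernel A : ev A = 0 -> exists Q, A = Q * fermat_poly K n m.
Proof. exact: (ev2_ker (fermat_n0 C) (fermat_m0 C) (fermat_mK C) (fermat_trans C) (fermat_eq C)). Qed.

Lemma fermat_kernel_size A : ev A = 0 -> (size A <= n)%N -> A = 0.
Proof.
move=> A0 An; apply/eqP; apply: contraTT An => An; rewrite -ltnNge.
exact: (ev2_ker_size (fermat_n0 C) (fermat_m0 C) (fermat_mK C) (fermat_trans C) (fermat_eq C) A0 An).
Qed.

Section Construction.

(** The derivation with D u = f_V and D v = - f_U kills f = U^n + V^m + 1 and needs no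
    denominators. *)
Let du : F := m%:R * v ^+ m.-1.
Let dv : F := - (n%:R * u ^+ n.-1).
Let dnum A : F := ev A^`() * du + ev (map_poly (@deriv K) A) * dv.

Lemma deriv_coefM (A B : {poly {poly K}}) : map_poly (@deriv K) (A * B) =
  map_poly (@deriv K) A * B + A * map_poly (@deriv K) B.
Proof.
apply/polyP => i; rewrite coefD !coefM coef_map coefM raddf_sum -big_split /=.
by apply: eq_bigr => j _; rewrite derivM !coef_map.
Qed.

Lemma deriv_coefD (A B : {poly {poly K}}) :
  map_poly (@deriv K) (A + B) = map_poly (@deriv K) A + map_poly (@deriv K) B.
Proof. exact: raddfD. Qed.

Lemma deriv_coefB (A B : {poly {poly K}}) :
  map_poly (@deriv K) (A - B) = map_poly (@deriv K) A - map_poly (@deriv K) B.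
Proof. exact: raddfB. Qed.

Lemma deriv_coef_map (c : {poly K}) : map_poly (@deriv K) (map_poly polyC c) = 0.
Proof. by apply/polyP => i; rewrite !coef_map /= derivC coef0. Qed.

Let dnumD A B : dnum (A + B) = dnum A + dnum B.
Proof. by rewrite /dnum derivD deriv_coefD !ev2D; ring. Qed.

Let dnumB A B : dnum (A - B) = dnum A - dnum B.
Proof. by rewrite /dnum derivB deriv_coefB !ev2B; ring. Qed.

Let dnumM A B : dnum (A * B) = ev A * dnum B + ev B * dnum A.
Proof. by rewrite /dnum derivM deriv_coefM !ev2D !ev2M; ring. Qed.

Let dnumC c : dnum c%:P%:P = 0.
Proof.
by rewrite /dnum derivC map_polyC /= derivC !rmorph0 !mul0r addr0.
Qed.

Let dnum1 : dnum 1 = 0. Proof. exact: (dnumC 1). Qed.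

Let dnum_fermat : dnum (fermat_poly K n m) = 0.
Proof.
rewrite /dnum /fermat_poly derivD derivXn derivC addr0 deriv_coefD.
rewrite map_polyC /= derivD derivXn derivC addr0.
have -> : map_poly (@deriv K) 'X^n = 0 by rewrite -(map_polyXn (@polyC K)) deriv_coef_map.
rewrite add0r ev2C !rmorphMn !rmorphXn /= ev2X ev1X -[_ *+ n]mulr_natl -[_ *+ m]mulr_natl.
by rewrite /du /dv; ring.
Qed.

Let dnum_ker A : ev A = 0 -> dnum A = 0.
Proof.
move=> /fermat_kernel [Q ->]; rewrite dnumM dnum_fermat mulr0 add0r.
by rewrite (ev2_fermat _ (fermat_eq C)) mul0r.
Qed.

Lemma exists_derivation : exists D, [/\ is_derivation iota D,
  D u = m%:R * v ^+ m.-1 & D v = - (n%:R * u ^+ n.-1)].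
Proof.
pose val A B := (dnum A * ev B - ev A * dnum B) / ev B ^+ 2.
have [D DE] : exists D : F -> F, forall A B, ev B != 0 -> D (ev A / ev B) = val A B.
  have [num /choice [den ndE]] := choice fermat_genE.
  exists (fun z => val (num z) (den z)) => A B B0.
  have [] := ndE (ev A / ev B).
  set A' := num _; set B' := den _ => B'0 e.
  have eA : ev A = ev A' / ev B' * ev B by rewrite -e divfK.
  (* For two fractions with the same value the cross difference is a multiple of the Fermat
     polynomial, which [dnum] kills; so the quotient rule does not depend on the fraction picked by
     [choice]. *)
  have : dnum (A * B' - A' * B) = 0.
    by apply: dnum_ker; rewrite ev2B !ev2M eA; field.
  rewrite dnumB !dnumM eA => /eqP; rewrite subr_eq0 => /eqP e1.
  rewrite /val eA.
  have -> : dnum A = (ev A' * dnum B + ev B * dnum A' - ev A' / ev B' * ev B * dnum B') / ev B'.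
    by rewrite -e1; field.
  by field; rewrite B0 B'0.
exists D; split.
- split=> [a b|a b|c].
  + have [A [B [B0 ->]]] := fermat_genE a; have [A' [B' [B'0 ->]]] := fermat_genE b.
    have BB0 : ev (B * B') != 0 by rewrite ev2M mulf_neq0.
    have -> : ev A / ev B + ev A' / ev B' = ev (A * B' + A' * B) / ev (B * B').
      by rewrite ev2D !ev2M; field; rewrite B0 B'0.
    rewrite !DE // /val dnumD !dnumM ev2D !ev2M.
    by field; rewrite B0 B'0.
  + have [A [B [B0 ->]]] := fermat_genE a; have [A' [B' [B'0 ->]]] := fermat_genE b.
    have BB0 : ev (B * B') != 0 by rewrite ev2M mulf_neq0.
    have -> : ev A / ev B * (ev A' / ev B') = ev (A * A') / ev (B * B').
      by rewrite !ev2M; field; rewrite B0 B'0.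
    rewrite !DE // /val !dnumM !ev2M.
    by field; rewrite B0 B'0.
  + have -> : iota c = ev c%:P%:P / ev 1 by rewrite ev2C ev1C rmorph1 divr1.
    rewrite DE ?rmorph1 ?oner_neq0 // /val dnumC dnum1.
    by rewrite !mul0r mulr0 subrr mul0r.
- have -> : u = ev 'X / ev 1 by rewrite ev2X rmorph1 divr1.
  rewrite DE ?rmorph1 ?oner_neq0 // /val dnum1 /dnum derivX.
  rewrite -(map_polyX (@polyC K)) deriv_coef_map map_polyX !rmorph0 !rmorph1 ev2X /du.
  by rewrite mul0r addr0 mul1r mulr1 mulr0 subr0 expr1n divr1.
- have -> : v = ev 'X%:P / ev 1 by rewrite ev2C ev1X rmorph1 divr1.
  rewrite DE ?rmorph1 ?oner_neq0 // /val dnum1 /dnum derivC.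
  rewrite map_polyC /= derivX !rmorph0 !rmorph1 /dv.
  by rewrite mul0r add0r mul1r mulr1 mulr0 subr0 expr1n divr1.
Qed.

End Construction.

Lemma fermat_derivation_rel D : is_derivation iota D ->
  n%:R * u ^+ n.-1 * D u + m%:R * v ^+ m.-1 * D v = 0.
Proof.
move=> DP; have := congr1 D (fermat_eq C).
by rewrite !(derD DP) !(derX DP) (der1 DP) (der0 DP) addr0.
Qed.

Section Differentials.
Variable D : F -> F.
Hypotheses (DP : is_derivation iota D) (Du : D u = m%:R * v ^+ m.-1)
  (Dv : D v = - (n%:R * u ^+ n.-1)).

Lemma fermat_Dv0 : D v != 0.
Proof. by rewrite Dv oppr_eq0 mulf_neq0 ?expf_neq0 ?fermat_nF ?fermat_u0. Qed.

(** The differentiated Fermat equation determines D' u from D' v, so derivations form a line over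
    F. *)
Lemma fermat_derivationE D' : is_derivation iota D' -> forall z, D' z = D' v / D v * D z.
Proof.
move=> DP'; apply: (derivation_ext fermat_genE DP' (derivation_scale _ DP)).
  by rewrite divfK ?fermat_Dv0.
have := fermat_derivation_rel DP'; rewrite -Du -[n%:R * _]opprK -Dv mulNr addrC => /eqP.
rewrite subr_eq0 => /eqP e; apply: (mulfI fermat_Dv0); rewrite -e.
by field; rewrite fermat_Dv0.
Qed.

(** Normalized to take the value 1 at [D], so that dt = D t omega and coefficients are read off at
    [D]. *)
Definition omega : differential iota := fun D' => sval D' v / D v.

Lemma diffE t : @diff _ _ iota t = D t *: omega.
Proof.
apply/funext => -[D' DP']; rewrite /diff /omega /= (fermat_derivationE DP' t).
by rewrite mulrC.
Qed.

Lemma omega_inj z z' : z *: omega = z' *: omega -> z = z'.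
Proof.
move/(congr1 (fun w => w (exist _ D DP))); rewrite /omega /=.
by rewrite !fctE /= mulfV ?fermat_Dv0 // /GRing.scale /= !mulr1.
Qed.

(** Every dt with t prime is (c D t) c^-1 omega with c D t in O, and c D t0 is a unit. Hence c^-1
    omega generates the differentials regular at O. *)
Lemma regular_omegaE O c t0 z : is_place iota O -> c != 0 ->
    (forall x, O x -> O (c * D x)) -> prime_element O t0 -> ~ place_ideal O (c * D t0) ->
  regular_at O (z *: omega) <-> O (z * c).
Proof.
move=> OP c0 cD t0P cDt0.
have prime_in t : prime_element O t -> O t.
  move=> tP; have : [set t * z | z in O] t by exists 1; [exact: (place1 OP) | rewrite mulr1].
  by rewrite -tP => /place_idealW.
have [cDt00 OcDt0] := placeV OP (cD _ (prime_in _ t0P)) cDt0.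
split=> [[t [f [tP Of]]]|Ozc].
  rewrite diffE scalerA => /omega_inj ->.
  by rewrite -mulrA [D t * c]mulrC; apply: (placeM OP) => //; exact/cD/prime_in.
exists t0, (z * c / (c * D t0)); split=> //; first exact: (placeM OP).
rewrite diffE scalerA; congr (_ *: _); move: cDt00; rewrite mulf_eq0 negb_or => /andP[_ D0].
by field; rewrite c0 D0.
Qed.

End Differentials.

End Fermat.

(** * Places of the Fermat function field *)

Section FractionSet.
Variables (K F : fieldType) (iota : {rmorphism K -> F}).

Definition frac_set (x y : F) : set F :=
  [set z | exists A B, ev2 iota x y B != 0 /\ z = ev2 iota x y A / ev2 iota x y B].

Variables x y : F.
Local Notation ev := (ev2 iota x y).

Lemma frac_set_ev A : frac_set x y (ev A).
Proof. by exists A, 1; rewrite rmorph1 divr1 oner_neq0. Qed.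

Lemma frac_set_subring : subring_set (frac_set x y).
Proof.
split; first by rewrite -(rmorph1 ev); exact: frac_set_ev.
- move=> _ _ [A [B [B0 ->]]] [A' [B' [B'0 ->]]].
  exists (A * B' - A' * B), (B * B'); rewrite ev2B !ev2M mulf_neq0 //; split=> //.
  by field; rewrite B0 B'0.
- move=> _ _ [A [B [B0 ->]]] [A' [B' [B'0 ->]]].
  exists (A * A'), (B * B'); rewrite !ev2M mulf_neq0 //; split=> //.
  by field; rewrite B0 B'0.
Qed.

Lemma frac_setV z : frac_set x y z -> frac_set x y z^-1.
Proof.
move=> [A [B [B0 ->]]]; have [A0|A0] := eqVneq (ev A) 0.
  by rewrite A0 mul0r invr0 -(rmorph0 ev); exact: frac_set_ev.
by exists B, A; rewrite invf_div.
Qed.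

Lemma frac_set_fst : frac_set x y x.
Proof. by rewrite -{2}(ev1X iota x) -(ev2C iota x y); exact: frac_set_ev. Qed.

Lemma frac_set_snd : frac_set x y y.
Proof. by rewrite -{2}(ev2X iota x y); exact: frac_set_ev. Qed.

Lemma frac_set_iota : range iota `<=` frac_set x y.
Proof. by move=> _ [c _ <-]; rewrite -(ev1C iota x) -(ev2C iota x y); exact: frac_set_ev. Qed.

Lemma frac_set_sub x' y' : frac_set x y x' -> frac_set x y y' ->
  frac_set x' y' `<=` frac_set x y.
Proof.
move=> xx yy z [A [B [_ ->]]].
have sub C : frac_set x y (ev2 iota x' y' C).
  by apply: ev2_sub => //; [exact: frac_set_subring | exact: frac_set_iota].
by apply: (subring_setM frac_set_subring) => //; exact: frac_setV.
Qed.

End FractionSet.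

Section FermatPlaces.
Variables (K F : fieldType) (iota : {rmorphism K -> F}) (p n m : nat) (u v : F).
Hypotheses (C : fermat_curve iota n m u v) (K_perfect : perfect K p).
Variable D : F -> F.
Hypotheses (DP : is_derivation iota D) (Du : D u = m%:R * v ^+ m.-1)
  (Dv : D v = - (n%:R * u ^+ n.-1)).
Variable O : set F.
Hypothesis OP : is_place iota O.

Local Notation P := (place_ideal O).
Local Notation omega := (@omega _ _ iota v D).

Let n0 := fermat_n0 C.
Let m0 := fermat_m0 C.
Let u0 : u != 0 := fermat_u0 C.
Let v0 : v != 0 := fermat_v0 C.

Let natr_unit k : k%:R != 0 :> K -> ~ P k%:R.
Proof. by move=> k0; rewrite -(rmorph_nat iota); exact: (place_iota_unit OP). Qed.

Lemma finite_place_u : O v -> O u.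
Proof.
move=> Ov; apply: (place_exp OP n0).
have -> : u ^+ n = - (v ^+ m + 1) by apply/eqP; rewrite -addr_eq0 addrA (fermat_eq C).
by apply/(placeN OP)/(placeD OP); [exact: (placeX OP) | exact: (place1 OP)].
Qed.

(* A plane model of F smooth over the x-line at the place O, in which the
   derivation c D generates the regular ones. *)
Record good_chart (x y c : F) (f : {poly {poly K}}) : Prop := GoodChart {
  chart_x : O x;
  chart_y : O y;
  chart_gen : forall z, frac_set iota x y z;
  chart_monic : f \is monic;
  chart_root : ev2 iota x y f = 0;
  chart_sep : ~ P (ev2 iota x y f^`());
  chart_Dx : O (c * D x);
  chart_Dx_unit : ~ P (c * D x);
  chart_Dy : O (c * D y)
}.

Lemma good_chart_local x y c f : good_chart x y c f -> forall z, O z ->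
  exists a b, [/\ range (ev2 iota x y) a, range (ev2 iota x y) b, ~ P b & z = a / b].
Proof.
case=> Ox Oy gen fm fr fs _ _ _ z Oz.
have [A [B [PB ->]]] := chart_local K_perfect OP Ox Oy gen fm fr fs Oz.
by exists (ev2 iota x y A), (ev2 iota x y B); split.
Qed.

Lemma good_chart_regular x y c f : c != 0 -> good_chart x y c f ->
  forall z, regular_at O (z *: omega) <-> O (z * c).
Proof.
move=> c0 [Ox Oy gen fm fr fs ODx PDx ODy] z.
have cDP := derivation_scale c DP.
have [h [hP hh]] := chart_prime K_perfect OP Ox Oy gen fm fr fs.
apply: (regular_omegaE C DP Du Dv z OP c0 _ hP).
  exact: (chart_derivation K_perfect OP Ox Oy gen fm fr fs cDP ODx ODy).
rewrite (der_ev1 DP) mulrCA; apply: (place_unitM OP) => //.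
exact: place_ev1.
Qed.

(** u and v are not both in P. If u is a unit, so is f_U and v is the coordinate; otherwise v is a
    unit, so is f_V, and u is the coordinate. In both cases D of the coordinate is a unit, whence c
    = 1. *)
Lemma finite_chart : O v -> exists x y f, good_chart x y 1 f /\
  range (ev2 iota x y) `<=` range (ev2 iota v u).
Proof.
move=> Ov; have Ou := finite_place_u Ov.
have ODu : O (D u) by rewrite Du; apply: (placeM OP); [exact: (place_natr OP) | exact: (placeX OP)].
have ODv : O (D v).
  by rewrite Dv; apply/(placeN OP)/(placeM OP); [exact: (place_natr OP) | exact: (placeX OP)].
have swap (x y : F) : (x = u \/ x = v) -> (y = u \/ y = v) ->
    range (ev2 iota x y) `<=` range (ev2 iota v u).
  move=> xE yE _ [A _ <-]; apply: ev2_sub.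
  - exact: subring_range_ev2.
  - exact: iota_range_ev2.
  - by case: xE => ->; [exact: range_ev2_snd | exact: range_ev2_fst].
  - by case: yE => ->; [exact: range_ev2_snd | exact: range_ev2_fst].
have [Pu|nPu] := pselect (P u).
  have nPv : ~ P v.
    move=> Pv; apply: (place_ideal1 OP).
    have -> : 1 = - (u ^+ n + v ^+ m) by apply/eqP; rewrite -addr_eq0 addrC (fermat_eq C).
    by apply/(place_idealN OP)/(place_idealD OP); apply: (place_idealX OP).
  exists u, v, (fermat_poly K m n); split; last by apply: swap; [left | right].
  split; rewrite ?mul1r //.
  - move=> z; apply: (@frac_set_sub _ _ iota u v v u); last exact: (fermat_genE C).
      exact: frac_set_snd.
    exact: frac_set_fst.
  - exact: fermat_monic.
  - have vu : v ^+ m + u ^+ n + 1 = 0 by rewrite [v ^+ m + _]addrC; exact: (fermat_eq C).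
    exact: (ev2_fermat _ vu).
  - rewrite /fermat_poly derivD derivXn derivC addr0 rmorphMn rmorphXn /= ev2X -mulr_natl.
    apply: (place_unitM OP); [exact: (place_natr OP)|exact: (placeX OP)| |exact: (place_unitX OP)].
    exact/natr_unit/(fermat_mK C).
  - rewrite Du; apply: (place_unitM OP); [exact: (place_natr OP)|exact: (placeX OP)| |exact: (place_unitX OP)].
    exact/natr_unit/(fermat_mK C).
exists v, u, (fermat_poly K n m); split; last by apply: swap; [right | left].
split; rewrite ?mul1r //.
- exact: (fermat_genE C).
- exact: fermat_monic.
- exact: (ev2_fermat _ (fermat_eq C)).
- rewrite /fermat_poly derivD derivXn derivC addr0 rmorphMn rmorphXn /= ev2X -mulr_natl.
  apply: (place_unitM OP); [exact: (place_natr OP)|exact: (placeX OP)| |exact: (place_unitX OP)].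
  exact/natr_unit/(fermat_nK C).
- rewrite Dv => /(place_idealN OP); rewrite opprK; apply: (place_unitM OP);
    [exact: (place_natr OP)|exact: (placeX OP)| |exact: (place_unitX OP)].
  exact/natr_unit/(fermat_nK C).
Qed.

Lemma finite_place_local : O v -> forall z, O z -> exists a b,
  [/\ range (ev2 iota v u) a, range (ev2 iota v u) b, ~ P b & z = a / b].
Proof.
move=> /finite_chart [x [y [f [ch sub]]]] z Oz.
have [a [b [Ra Rb Pb zE]]] := good_chart_local ch Oz.
by exists a, b; split=> //; exact: sub.
Qed.

Lemma finite_place_regular : O v -> forall z, regular_at O (z *: omega) <-> O z.
Proof.
move=> /finite_chart [x [y [f [ch _]]]] z.
by rewrite -[X in O X]mulr1; apply: (good_chart_regular _ ch); exact: oner_neq0.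
Qed.

(* At infinity n = d n', m = d m' and b n' = a m' + 1; the function s has a
   simple zero and w^d is congruent to -1. *)
Variables (d n' m' a b : nat).
Hypotheses (nE : n = (d * n')%N) (mE : m = (d * m')%N) (bezout : (b * n' = a * m' + 1)%N).

Definition inf_s := u ^+ a / v ^+ b.
Definition inf_w := u ^+ n' / v ^+ m'.
Local Notation s := inf_s.
Local Notation w := inf_w.

(** The exponent matrix of (s, w) in (u, v) has determinant b n' - a m' = 1, so u and v are Laurent
    monomials in s and w. *)
Lemma inf_v : v = w ^+ a / s ^+ n'.
Proof.
rewrite /w /s !expr_div_n -!exprM.
have -> : (b * n' = m' * a + 1)%N by rewrite bezout mulnC.
rewrite exprD expr1 [(n' * a)%N]mulnC.
by field; rewrite ?v0 ?expf_neq0.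
Qed.

Lemma inf_u : u = w ^+ b / s ^+ m'.
Proof.
rewrite /w /s !expr_div_n -!exprM.
have -> : (n' * b = a * m' + 1)%N by rewrite -bezout mulnC.
rewrite exprD expr1 [(m' * b)%N]mulnC.
by field; rewrite ?u0 ?expf_neq0.
Qed.

Lemma inf_s0 : s != 0.
Proof. by rewrite mulf_neq0 ?invr_eq0 ?expf_neq0. Qed.

Lemma inf_w0 : w != 0.
Proof. by rewrite mulf_neq0 ?invr_eq0 ?expf_neq0. Qed.

Lemma inf_wd : w ^+ d = - 1 - 1 / v ^+ m.
Proof.
rewrite /w expr_div_n -!exprM ![(_ * d)%N]mulnC -nE -mE.
have -> : u ^+ n = - v ^+ m - 1.
  by apply/eqP; rewrite -subr_eq0 !opprD !opprK addrA (fermat_eq C).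
by field; rewrite expf_neq0.
Qed.

Lemma inf_vm : 1 / v ^+ m = s ^+ (n' * m) / w ^+ (a * m).
Proof. by rewrite {1}inf_v expr_div_n -!exprM invf_div mul1r. Qed.

Lemma inf_Ds : D s = s * (a%:R * D u / u - b%:R * D v / v).
Proof.
rewrite /s (der_div DP) ?expf_neq0 // !(derX_log DP) //.
by field; rewrite ?u0 ?v0 ?expf_neq0.
Qed.

Lemma inf_Dw : D w = w * (n'%:R * D u / u - m'%:R * D v / v).
Proof.
rewrite /w (der_div DP) ?expf_neq0 // !(derX_log DP) //.
by field; rewrite ?u0 ?v0 ?expf_neq0.
Qed.

(** Chosen to make c D s a unit at infinity: D s / s = (a m v^m - b n (v^m + 1)) / (u v), and a m -
    b n = - d. *)
Definition inf_c := u * v / (v ^+ m * s).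

Lemma inf_c0 : inf_c != 0.
Proof.
apply: mulf_neq0; first exact: mulf_neq0.
by rewrite invr_eq0; apply: mulf_neq0; [exact: expf_neq0 | exact: inf_s0].
Qed.

Let DuE : D u = m%:R * v ^+ m / v.
Proof. by rewrite Du -[in v ^+ m](prednK m0) exprS; field. Qed.

Let DvE : D v = n%:R * (v ^+ m + 1) / u.
Proof.
have -> : v ^+ m + 1 = - u ^+ n by apply/eqP; rewrite -addr_eq0 addrC addrA (fermat_eq C).
by rewrite Dv -[in u ^+ n](prednK n0) exprS; field.
Qed.

Lemma inf_cDs : inf_c * D s = - d%:R - b%:R * n%:R / v ^+ m.
Proof.
have bnE : (b * n = a * m + d)%N.
  by rewrite nE mE mulnCA bezout mulnDr muln1 [(a * (d * _))%N]mulnCA.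
have an : a%:R * m%:R = b%:R * n%:R - d%:R :> F.
  by rewrite -!natrM bnE natrD addrK.
transitivity (a%:R * m%:R - b%:R * n%:R * (1 + 1 / v ^+ m)).
  by rewrite inf_Ds DuE DvE /inf_c; field; rewrite ?u0 ?v0 ?inf_s0 ?expf_neq0.
by rewrite an; field; rewrite ?expf_neq0.
Qed.

(** The terms in v^m cancel since m' n = n' m; the remaining 1 / v^m contains enough powers of s to
    absorb the denominator s. *)
Lemma inf_cDw : inf_c * D w = - (n'%:R * m%:R) * w / (v ^+ m * s).
Proof.
have nm : m'%:R * n%:R = n'%:R * m%:R :> F.
  by rewrite -!natrM; congr (_%:R); rewrite nE mE; lia.
transitivity (w * (n'%:R * m%:R * v ^+ m - m'%:R * n%:R * (v ^+ m + 1)) / (v ^+ m * s)).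
  by rewrite inf_Dw DuE DvE /inf_c; field; rewrite ?u0 ?v0 ?inf_s0 ?expf_neq0.
by rewrite nm; field; rewrite ?u0 ?v0 ?inf_s0 ?expf_neq0.
Qed.

(** The equation w^d = - 1 - 1 / v^m after inserting 1 / v^m = s^(n' m) / w^(a m) and multiplying by
    w^(a m). *)
Definition inf_poly : {poly {poly K}} := 'X^(a * m + d) + ('X^(a * m) + ('X^(n' * m))%:P).

Let d0 : (0 < d)%N. Proof. by move: n0; rewrite nE muln_gt0 => /andP[]. Qed.
Let n'0 : (0 < n')%N. Proof. by move: n0; rewrite nE muln_gt0 => /andP[]. Qed.

Lemma inf_poly_monic : inf_poly \is monic.
Proof.
rewrite monicE /inf_poly lead_coefDl ?lead_coefXn // size_polyXn ltnS.
rewrite (leq_trans (size_polyD _ _)) // geq_max size_polyXn.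
rewrite (leq_trans (size_polyC_leq1 _)) ?addn_gt0 ?d0 ?orbT //.
by rewrite -addn1 leq_add2l d0.
Qed.

Lemma inf_poly_root : ev2 iota s w inf_poly = 0.
Proof.
rewrite /inf_poly !ev2D ev2C !rmorphXn /= !ev2X ev1X exprD inf_wd inf_vm.
by field; rewrite expf_neq0 ?inf_w0.
Qed.

(** The factor w, a unit at infinity, avoids the exponent a m - 1, which is truncated for a = 0. *)
Lemma inf_poly_sep :
  w * ev2 iota s w inf_poly^`() = w ^+ (a * m) * (- d%:R - (a * m + d)%:R / v ^+ m).
Proof.
have wX k : w * (w ^+ k.-1 *+ k) = k%:R * w ^+ k.
  by rewrite mulrnAr -mulr_natl; case: k => [|k]; rewrite ?mul0r //= -exprS.
rewrite /inf_poly !derivD !derivXn derivC addr0 ev2D !rmorphMn !rmorphXn /= ev2X.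
rewrite mulrDr !wX exprD inf_wd natrD.
by field; rewrite expf_neq0.
Qed.

Hypothesis Ov : ~ O v.

Let Pvm : P (1 / v ^+ m).
Proof. by rewrite mul1r -exprVn; apply: (place_idealX OP) => //; exact: (place_idealV OP). Qed.

Lemma inf_w_unit : O w /\ ~ P w.
Proof.
have Pwd : ~ P (w ^+ d).
  rewrite inf_wd addrC; apply: (place_unitDl OP); first exact: (place_idealN OP).
  by move/(place_idealN OP); rewrite opprK; exact: (place_ideal1 OP).
have Owd : O (w ^+ d).
  rewrite inf_wd; apply: (place_sub OP); last exact: place_idealW.
  exact/(placeN OP)/(place1 OP).
have Ow := place_exp OP d0 Owd; split=> // /(place_idealX OP d0).
exact: Pwd.
Qed.

Lemma inf_w_inv : O w^-1.
Proof. by have [Ow Pw] := inf_w_unit; have [] := placeV OP Ow Pw. Qed.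

Lemma inf_s_ideal : P s.
Proof.
have [Ow _] := inf_w_unit.
have sE : s ^+ n' = w ^+ a * v^-1.
  have e : v * s ^+ n' = w ^+ a by rewrite {1}inf_v divfK ?expf_neq0 ?inf_s0.
  by rewrite -e mulrAC mulfV ?mul1r.
have Psn : P (s ^+ n').
  rewrite sE; apply: (place_idealMr OP); first exact: (placeX OP).
  exact: (place_idealV OP).
apply: (place_ideal_exp OP _ Psn); apply: (place_exp OP n'0).
exact: place_idealW.
Qed.

Lemma inf_chart : good_chart s w inf_c inf_poly.
Proof.
have [Ow Pw] := inf_w_unit; have Ps := inf_s_ideal.
have dK : d%:R != 0 :> K.
  by apply: contra_neq (fermat_nK C) => d0'; rewrite nE natrM d0' mul0r.
(* Modulo P only - d remains, and d is invertible as a divisor of n. *)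
have Pd k : ~ P (- d%:R - k%:R * (1 / v ^+ m)).
  rewrite addrC; apply: (place_unitDl OP).
    by apply/(place_idealN OP)/(place_idealMr OP) => //; exact: (place_natr OP).
  by move/(place_idealN OP); rewrite opprK; exact: natr_unit.
have Od k : O (- d%:R - k%:R * (1 / v ^+ m)).
  apply: (place_sub OP); first by apply/(placeN OP)/(place_natr OP).
  by apply: (placeM OP); [exact: (place_natr OP) | exact: place_idealW].
have cDsE : inf_c * D s = - d%:R - (b * n)%:R * (1 / v ^+ m).
  by rewrite inf_cDs natrM mul1r.
split=> //.
- exact: place_idealW.
- move=> z; apply: (@frac_set_sub _ _ iota s w v u); last exact: (fermat_genE C).
    rewrite [X in frac_set _ _ _ X]inf_v; apply: (subring_setM (frac_set_subring _ _ _)).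
      by apply: (subring_setX (frac_set_subring _ _ _)); exact: frac_set_snd.
    apply: frac_setV; apply: (subring_setX (frac_set_subring _ _ _)).
    exact: frac_set_fst.
  rewrite [X in frac_set _ _ _ X]inf_u; apply: (subring_setM (frac_set_subring _ _ _)).
    by apply: (subring_setX (frac_set_subring _ _ _)); exact: frac_set_snd.
  apply: frac_setV; apply: (subring_setX (frac_set_subring _ _ _)).
  exact: frac_set_fst.
- exact: inf_poly_monic.
- exact: inf_poly_root.
- move=> Pf; have : P (w * ev2 iota s w inf_poly^`()) by exact: (place_idealMr OP).
  rewrite inf_poly_sep -[(v ^+ m)^-1]mul1r.
  apply: (place_unitM OP) => //; first exact: (placeX OP).
  exact: (place_unitX OP).
- by rewrite cDsE.
- by rewrite cDsE.
- have -> : inf_c * D w =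
      - (n'%:R * m%:R) * w * (s ^+ (n' * m).-1 * (w^-1) ^+ (a * m)).
    rewrite inf_cDw invfM -[(v ^+ m)^-1]mul1r inf_vm exprVn.
    have nm0 : (0 < n' * m)%N by rewrite muln_gt0 n'0.
    rewrite -[in s ^+ (n' * m)](prednK nm0) exprS.
    by field; rewrite inf_s0 ?expf_neq0 ?inf_w0.
  have Ow' := inf_w_inv; have Os := place_idealW Ps.
  apply: (placeM OP); last by apply: (placeM OP); exact: (placeX OP).
  apply: (placeM OP) => //; apply/(placeN OP)/(placeM OP); exact: (place_natr OP).
Qed.

Lemma infinite_place_regular z : regular_at O (z *: omega) <-> O (z * inf_c).
Proof. exact: (good_chart_regular inf_c0 inf_chart). Qed.

End FermatPlaces.

(** * Weighted degrees and holomorphic differentials *)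

Section Weight.
Variables (K : fieldType) (n' m' : nat).
Hypothesis n'0 : (0 < n')%N.

Definition polyCC : K -> {poly {poly K}} := polyC \o polyC.
HB.instance Definition _ := GRing.RMorphism.copy polyCC (polyC \o polyC).

(* Substituting V = X^n' and U = Y X^m' turns the weighted degree with
   wt U = m' and wt V = n' into the degree in X over K[Y]. *)
Definition weight_map : {poly {poly K}} -> {poly {poly K}} :=
  ev2 polyCC 'X^n' ('X%:P * 'X^m').
HB.instance Definition _ := GRing.RMorphism.on weight_map.

Lemma weight_mapD A B : weight_map (A + B) = weight_map A + weight_map B.
Proof. exact: rmorphD. Qed.

Lemma weight_mapM A B : weight_map (A * B) = weight_map A * weight_map B.
Proof. exact: rmorphM. Qed.

Lemma weight_mapE C : weight_map C =
  \sum_(i < size C) \sum_(j < size C`_i) (C`_i`_j *: 'X^i)%:P * 'X^(i * m' + j * n').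
Proof.
rewrite /weight_map ev2_sum; apply: eq_bigr => i _.
rewrite ev1E (@horner_coef_wide _ (size C`_i)) ?size_poly // mulr_suml.
apply: eq_bigr => j _; rewrite coef_map /= /polyCC /=.
rewrite exprMn -!exprM -mul_polyC exprD -polyC_exp polyCM mulnC [(i * m')%N]mulnC.
by ring.
Qed.

(** The power of Y records the exponent of U, so monomials of equal weight do not cancel. *)
Lemma weight_map_coef C N k : (weight_map C)`_N`_k =
  \sum_(j < size C`_k) C`_k`_j *+ (k * m' + j * n' == N)%N.
Proof.
have E i : (\sum_(j < size C`_i) (C`_i`_j *: 'X^i)%:P * 'X^(i * m' + j * n'))`_N`_k =
    (\sum_(j < size C`_i) C`_i`_j *+ (i * m' + j * n' == N)%N) *+ (k == i).
  rewrite coef_sum -[RHS]mulr_natr mulr_suml -/(coefp k _) raddf_sum /=.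
  apply: eq_bigr => j _; rewrite coefCM coefXn eq_sym; case: eqP => _.
    by rewrite mulr1 coefZ coefXn mulr1n.
  by rewrite mulr0 coef0 mul0r.
rewrite weight_mapE coef_sum -/(coefp k _) raddf_sum /=.
under eq_bigr do rewrite E.
have [kC|Ck] := ltnP k (size C).
  rewrite (bigD1 (Ordinal kC)) //= eqxx mulr1n [X in _ + X]big1 ?addr0 // => i /eqP ik.
  by case: eqP => // ki; case: ik; apply: val_inj.
rewrite [C`_k]nth_default // size_poly0 big_ord0 big1 // => i _.
by rewrite gtn_eqF // (leq_trans (ltn_ord i)).
Qed.

Lemma weight_map_size C k j e :
  (size (weight_map C) <= e)%N -> C`_k`_j != 0 -> (k * m' + j * n' < e)%N.
Proof.
move=> Ce Ckj; rewrite ltnNge; apply: contra Ckj => eN.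
have := weight_map_coef C (k * m' + j * n') k.
rewrite [(weight_map C)`_(k * m' + j * n')]nth_default ?(leq_trans Ce) // coef0.
have [jC|Cj] := ltnP j (size C`_k); last by rewrite (nth_default _ Cj).
rewrite (bigD1 (Ordinal jC)) //= eqxx mulr1n big1 ?addr0 => [<- //|i ij].
rewrite eqn_add2l eqn_pmul2r //; case: eqP => // ij'.
by case/eqP: ij; apply: val_inj.
Qed.

Lemma weight_map_coef_size C N : (size ((weight_map C)`_N)%R <= size C)%N.
Proof.
apply/leq_sizeP => k Ck; rewrite weight_map_coef [C`_k]nth_default //.
by rewrite size_poly0 big_ord0.
Qed.

Lemma weight_mapX : weight_map 'X = 'X%:P * 'X^m'.
Proof. by rewrite /weight_map ev2X. Qed.

Lemma weight_mapXC : weight_map 'X%:P = 'X^n'.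
Proof. by rewrite /weight_map ev2C ev1X. Qed.

Lemma weight_map_mono i j : weight_map ('X^i * 'X%:P ^+ j) =
  ('X^i)%:P * 'X^(i * m' + j * n').
Proof.
rewrite rmorphM !rmorphXn /= weight_mapX weight_mapXC exprMn -!exprM exprD -polyC_exp.
by rewrite mulnC [(n' * j)%N]mulnC mulrA.
Qed.

Lemma weight_map_fermat n m : (n * m' = m * n')%N ->
  weight_map (fermat_poly K n m) = ('X^n + 1)%:P * 'X^(m * n') + 1.
Proof.
move=> nm; rewrite /fermat_poly !rmorphD !rmorph1 !rmorphXn /= weight_mapX weight_mapXC.
rewrite exprMn -!exprM [(m' * n)%N]mulnC nm [(n' * m)%N]mulnC -polyC_exp.
by ring.
Qed.

(* The leading form of a multiple of the Fermat polynomial is divisible by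
   Y^n + 1, which is prime to Y and of degree larger than that of Z. *)
Lemma weight_bound n m (Z C Q : {poly {poly K}}) i j e :
    (0 < n)%N -> (n * m' = m * n')%N -> (0 < m)%N -> (size Z <= n)%N ->
    Z * ('X^i * 'X%:P ^+ j) = C + Q * fermat_poly K n m ->
    (size (weight_map C) <= e)%N ->
  (size (weight_map Z) + (i * m' + j * n') <= e)%N \/ weight_map Z = 0.
Proof.
move=> n0 nm m0 Zn ZE Ce.
have [->|Z0] := eqVneq (weight_map Z) 0; [by right | left].
rewrite leqNgt; apply/negP => eZ.
have := congr1 weight_map ZE; rewrite weight_mapM weight_mapD [weight_map (Q * _)]weight_mapM weight_map_mono.
rewrite weight_map_fermat // => E.
set N := (i * m' + j * n')%N in eZ E.
have Xi0 : 'X^i != 0 :> {poly K} by rewrite -size_poly_eq0 size_polyXn.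
have sL : size (weight_map Z * (('X^i)%:P * 'X^N)) = (size (weight_map Z) + N)%N.
  by rewrite mulrA size_mulXn ?mulf_neq0 ?polyC_eq0 // mulrC mul_polyC size_scale // addnC.
have sf : (1 < size (('X^n + 1)%:P * 'X^(m * n') : {poly {poly K}})%R)%N.
  have Xn0 : ('X^n + 1 : {poly K}) != 0.
    by rewrite -size_poly_eq0 size_polyDl size_polyXn ?size_poly1 ?ltnS.
  by rewrite size_mulXn ?polyC_eq0 // size_polyC Xn0 addn1 ltnS muln_gt0 m0.
(* Under the assumption being refuted, C has too small a degree in X to affect the leading
   coefficients. *)
have lead : lead_coef (weight_map Z) * 'X^i =
    lead_coef (weight_map Q) * ('X^n + 1).
  have <- : lead_coef (weight_map Z * (('X^i)%:P * 'X^N)) = lead_coef (weight_map Z) * 'X^i.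
    by rewrite !lead_coefM lead_coefXn mulr1 lead_coefC.
  have <- : lead_coef (weight_map Q * (('X^n + 1)%:P * 'X^(m * n') + 1)) =
      lead_coef (weight_map Q) * ('X^n + 1).
    rewrite lead_coefM lead_coefDl ?size_poly1 //.
    by rewrite lead_coefM lead_coefXn mulr1 lead_coefC.
  have -> : weight_map Q * (('X^n + 1)%:P * 'X^(m * n') + 1) =
      weight_map Z * (('X^i)%:P * 'X^N) - weight_map C by rewrite E [weight_map C + _]addrC addrK.
  by rewrite lead_coefDl // sL size_opp (leq_ltn_trans Ce).
have cop : coprimep ('X^n + 1) ('X^i : {poly K}).
  rewrite coprimep_sym coprimep_expl // coprimep_sym coprimepX /root !hornerE.
  by rewrite expr0n gtn_eqF //= add0r oner_eq0.
have : 'X^n + 1 %| lead_coef (weight_map Z).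
  by rewrite -(Gauss_dvdpl _ cop) lead dvdp_mull.
move/dvdp_leq; rewrite lead_coef_eq0 => /(_ Z0); rewrite size_polyDl size_polyXn ?size_poly1 //.
move/leq_trans/(_ (weight_map_coef_size _ _))/leq_trans/(_ Zn).
by rewrite ltnn.
Qed.

End Weight.

Import Order.TTheory Num.Theory.

Section Holomorphic.
Variables (K F : fieldType) (iota : {rmorphism K -> F}) (p n m : nat) (u v : F).
Hypotheses (C : fermat_curve iota n m u v) (K_perfect : perfect K p).
Variable D : F -> F.
Hypotheses (DP : is_derivation iota D) (Du : D u = m%:R * v ^+ m.-1)
  (Dv : D v = - (n%:R * u ^+ n.-1)).
Variables (d n' m' a b : nat).
Hypotheses (nE : n = (d * n')%N) (mE : m = (d * m')%N) (bezout : (b * n' = a * m' + 1)%N).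

Local Notation omega := (@omega _ _ iota v D).
Local Notation ev := (ev2 iota v u).
Local Notation Phi := (weight_map n' m').
Local Notation s := (inf_s u v a b).
Local Notation w := (inf_w u v n' m').
Local Notation c := (inf_c m u v a b).

Let n0 := fermat_n0 C.
Let m0 := fermat_m0 C.
Let u0 : u != 0 := fermat_u0 C.
Let v0 : v != 0 := fermat_v0 C.
Let n'0 : (0 < n')%N. Proof. by move: n0; rewrite nE muln_gt0 => /andP[]. Qed.
Let d0 : (0 < d)%N. Proof. by move: n0; rewrite nE muln_gt0 => /andP[]. Qed.
Let nm' : (n * m' = m * n')%N. Proof. by rewrite nE mE; lia. Qed.

(* The functions of weight at most k, i.e. with a pole of order at most k at
   all the places at infinity. *)
Definition wle (k : int) (x : F) : Prop := exists i j e A,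
  [/\ x * (u ^+ i * v ^+ j) = ev A, (size (Phi A) <= e.+1)%N &
    e%:Z = (i * m' + j * n')%:Z + k].

Lemma wle_const l : wle 0 (iota l).
Proof.
exists 0%N, 0%N, 0%N, l%:P%:P; split=> //.
  by rewrite !expr0 !mulr1 ev2C ev1C.
by rewrite /weight_map ev2C ev1C size_polyC_leq1.
Qed.

Lemma wle_mono k k' x : (k <= k')%R -> wle k x -> wle k' x.
Proof.
move=> kk [i [j [e [A [xE Ae eE]]]]]; exists i, j, (e + `|k' - k|)%N, A; split=> //.
  by rewrite (leq_trans Ae) // ltnS leq_addr.
by lia.
Qed.

Let size_mul_le (A B : {poly {poly K}}) e e' : (size A <= e.+1)%N -> (size B <= e'.+1)%N ->
  (size (A * B)%R <= (e + e').+1)%N.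
Proof. by move=> Ae Be; rewrite (leq_trans (size_polyMleq _ _)) //; lia. Qed.

Let size_mono i j : (size (Phi ('X^i * 'X%:P ^+ j) : {poly {poly K}}) <= (i * m' + j * n').+1)%N.
Proof.
rewrite weight_map_mono mul_polyC (leq_trans (size_scale_leq _ _)) //.
by rewrite size_polyXn.
Qed.

Let ev_mono i j : ev ('X^i * 'X%:P ^+ j) = u ^+ i * v ^+ j.
Proof. by rewrite ev2M !rmorphXn /= ev2X ev2C ev1X. Qed.

Lemma wleM k k' x x' : wle k x -> wle k' x' -> wle (k + k') (x * x').
Proof.
move=> [i [j [e [A [xE Ae eE]]]]] [i' [j' [e' [A' [xE' Ae' eE']]]]].
exists (i + i')%N, (j + j')%N, (e + e')%N, (A * A'); split.
- by rewrite ev2M -xE -xE' !exprD; ring.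
- by rewrite weight_mapM; exact: size_mul_le.
- by rewrite !mulnDl; lia.
Qed.

Lemma wleD k x x' : wle k x -> wle k x' -> wle k (x + x').
Proof.
move=> [i [j [e [A [xE Ae eE]]]]] [i' [j' [e' [A' [xE' Ae' eE']]]]].
exists (i + i')%N, (j + j')%N, (e + (i' * m' + j' * n'))%N,
  (A * ('X^i' * 'X%:P ^+ j') + A' * ('X^i * 'X%:P ^+ j)); split.
- by rewrite ev2D 2!ev2M !ev_mono -xE -xE' !exprD; ring.
- rewrite weight_mapD (weight_mapM _ _ A) (weight_mapM _ _ A') (leq_trans (size_polyD _ _)) // geq_max.
  rewrite (size_mul_le Ae (size_mono _ _)) /=.
  have -> : (e + (i' * m' + j' * n') = e' + (i * m' + j * n'))%N by lia.
  exact: (size_mul_le Ae' (size_mono _ _)).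
- by rewrite !mulnDl; lia.
Qed.

Lemma wleB k x x' : wle k x -> wle k x' -> wle k (x - x').
Proof.
move=> kx kx'; apply: wleD => //; have -> : - x' = iota (- 1) * x'.
  by rewrite rmorphN1 mulN1r.
by rewrite -[k]add0r; apply: wleM => //; exact: wle_const.
Qed.

Lemma wle_mono_frac k x i j i' j' : x * (u ^+ i * v ^+ j) = u ^+ i' * v ^+ j' ->
  (i' * m' + j' * n')%:Z = (i * m' + j * n')%:Z + k -> wle k x.
Proof.
move=> xE kE; exists i, j, (i' * m' + j' * n')%N, ('X^i' * 'X%:P ^+ j').
by split; rewrite ?ev_mono.
Qed.

Lemma wle_ev A : wle (size (Phi A)) (ev A).
Proof.
exists 0%N, 0%N, (size (Phi A)), A; split=> //.
by rewrite !expr0 !mulr1.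
Qed.

(** By [weight_bound], adding multiples of the Fermat polynomial cannot lower the weight of a
    polynomial of degree below n in U. *)
Lemma wle_coef k (Z : {poly {poly K}}) i j : (size Z <= n)%N -> wle k (ev Z) -> Z`_i`_j != 0 ->
  (i * m' + j * n')%:Z <= k.
Proof.
move=> Zn [i' [j' [e [A [ZE Ae eE]]]]] Zij.
have : ev (Z * ('X^i' * 'X%:P ^+ j') - A) = 0 by rewrite ev2B ev2M ev_mono ZE subrr.
move=> /(fermat_kernel C) [Q QE].
have {QE} : Z * ('X^i' * 'X%:P ^+ j') = A + Q * fermat_poly K n m.
  by rewrite -QE addrC subrK.
move=> /(weight_bound n'0 n0 nm' m0 Zn) /(_ Ae).
have Pe e' : (size (Phi Z) <= e')%N -> (i * m' + j * n' < e')%N.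
  by move=> Pe; apply: (weight_map_size n'0 Pe).
case=> [bd|Z0]; last by have := Pe 0%N; rewrite Z0 size_poly0 => /(_ isT).
have := Pe (e.+1 - (i' * m' + j' * n'))%N.
by lia.
Qed.

Lemma wle_s : wle (- 1) s.
Proof.
apply: (@wle_mono_frac _ _ 0%N b a 0%N); last by rewrite bezout; lia.
by rewrite /inf_s !expr0 mul1r mulr1 divfK // expf_neq0.
Qed.

Lemma wle_w : wle 0 w.
Proof.
apply: (@wle_mono_frac _ _ 0%N m' n' 0%N); last by lia.
by rewrite /inf_w !expr0 mul1r mulr1 divfK // expf_neq0.
Qed.

Lemma wle_vV : wle (- 1) v^-1.
Proof.
apply: (@wle_mono (- n'%:Z)); first by lia.
apply: (@wle_mono_frac _ _ 0%N 1%N 0%N 0%N); last by lia.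
by rewrite !expr0 expr1 mul1r mulVf // mulr1.
Qed.

Lemma wle_subring : subring_set (wle 0).
Proof.
split; first by rewrite -(rmorph1 iota); exact: wle_const.
- by move=> x y; exact: wleB.
- by move=> x y x0 y0; have := wleM x0 y0; rewrite addr0.
Qed.

Let wle0M k x y : wle 0 x -> wle k y -> wle k (x * y).
Proof. by move=> x0 yk; have := wleM x0 yk; rewrite add0r. Qed.

(* The denominators of y in wle 0 and wle (-1) generate an ideal I.  If I were
   proper, its elements would be nonunits at some place at infinity, where y is
   however a fraction with a unit of wle 0 as denominator. *)
Lemma infinite_regular y : (forall O, is_place iota O -> ~ O v -> O y) ->
  exists2 f, wle (- 1) f & wle 0 ((1 - f) * y).
Proof.
move=> reg; pose I : set F := [set x | exists g h,
  [/\ x = g + h, wle 0 g, wle 0 (g * y) & wle (- 1) h]].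
have I_ideal : ideal_set (wle 0) I.
  have wl h : wle (- 1) h -> wle 0 h by exact: wle_mono.
  have w0 : wle 0 0 by exact: (subring_set0 wle_subring).
  split.
  - by move=> _ [g [h [-> g0 _ /wl h1]]]; exact: wleD.
  - exists 0, 0; rewrite addr0 mul0r; split=> //.
    have -> : 0 = 0 * v^-1 :> F by rewrite mul0r.
    by apply: wle0M => //; exact: wle_vV.
  - move=> _ _ [g [h [-> g0 gy h1]]] [g' [h' [-> g0' gy' h1']]].
    exists (g - g'), (h - h'); split; rewrite ?mulrBl; try exact: wleB.
    by ring.
  - move=> x _ x0 [g [h [-> g0 gy h1]]].
    exists (x * g), (x * h); split; rewrite ?mulrDr -?mulrA //; exact: wle0M.
have [[g [h [gh g0 gy h1]]]|I1] := pselect (I 1).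
  by exists h => //; rewrite gh addrK.
(* The summand from [wle (-1)] is in I to provide this element, which forces places above I to be
   infinite. *)
have IvV : I v^-1.
  exists 0, v^-1; rewrite add0r mul0r; split=> //; try exact: (subring_set0 wle_subring).
  exact: wle_vV.
have [|||O [OP BO IO]] := @place_extension _ _ iota (wle 0) I wle_subring I_ideal.
- by move=> _ [l _ <-]; exact: wle_const.
- by [].
- by exists v^-1; rewrite ?invr_eq0.
have nOv : ~ O v.
  move=> Ov; apply: (@place_ideal_unit _ O v^-1); rewrite ?invrK ?invr_eq0 //.
  exact: IO.
have Oy := reg O OP nOv.
have ch := inf_chart C DP Du Dv OP nE mE bezout nOv.
have [g [h [Rg Rh Ph yE]]] := good_chart_local K_perfect OP ch Oy.
have Rwle : range (ev2 iota s w) `<=` wle 0.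
  move=> _ [A _ <-]; apply: ev2_sub; first exact: wle_subring.
  - by move=> _ [l _ <-]; exact: wle_const.
  - by apply: wle_mono wle_s.
  - exact: wle_w.
have h0 : h != 0 by apply/eqP => h0; apply: Ph; rewrite h0; exact: (place_ideal0 OP).
exfalso; apply: Ph; apply: IO; exists h, 0; rewrite addr0; split=> //.
- exact: Rwle.
- by rewrite yE mulrC divfK //; exact: Rwle.
- have -> : 0 = 0 * v^-1 :> F by rewrite mul0r.
  by apply: wle0M; [exact: (subring_set0 wle_subring) | exact: wle_vV].
Qed.

(** A holomorphic differential is recognized as a multiple of omega through one place where it is
    regular, so a place must exist. Here 1 is not in the ideal [wle (-1)], by the weight bound. *)
Lemma exists_infinite_place : exists O, is_place iota O.
Proof.
have J : ideal_set (wle 0) (wle (- 1)).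
  split.
  - by move=> x; exact: wle_mono.
  - have -> : 0 = 0 * v^-1 :> F by rewrite mul0r.
    by apply: wle0M; [exact: (subring_set0 wle_subring) | exact: wle_vV].
  - by move=> x y; exact: wleB.
  - by move=> x y; exact: wle0M.
have [|||O [OP _ _]] := place_extension wle_subring J (iota := iota).
- by move=> _ [l _ <-]; exact: wle_const.
- rewrite -(rmorph1 ev) => /(@wle_coef _ _ 0%N 0%N).
  by rewrite size_poly1 coef1 /= coef1 oner_neq0 => /(_ n0 isT).
- by exists v^-1; [exact: wle_vV | rewrite invr_eq0].
by exists O.
Qed.

(** If the ideal of denominators of z in K[u, v] were proper, some finite place would have it inside
    P; but there z has a denominator that is a unit. *)
Lemma finite_regular z : (forall O, is_place iota O -> O v -> O z) -> range ev z.
Proof.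
move=> reg; pose R := range ev.
have Rr : subring_set R := subring_range_ev2 _ _ _.
pose I : set F := [set x | R x /\ R (x * z)].
have I_ideal : ideal_set R I.
  split.
  - by move=> x [].
  - by split; rewrite ?mul0r; exact: subring_set0.
  - by move=> x y [Rx Rxz] [Ry Ryz]; split; rewrite ?mulrBl; exact: subring_setB.
  - by move=> x y Rx [Ry Ryz]; split; rewrite -?mulrA; exact: subring_setM.
have [[_]|I1] := pselect (I 1); first by rewrite mul1r.
have [|||O [OP RO IO]] := @place_extension _ _ iota R I Rr I_ideal.
- exact: iota_range_ev2.
- by [].
- have [A [B [B0 zE]]] := fermat_genE C z.
  by exists (ev B) => //; split; [exists B | exists A => //; rewrite zE mulrC divfK].
have Ov : O v by apply: RO; exact: range_ev2_fst.
have [g [h [Rg Rh Ph zE]]] := finite_place_local C K_perfect Du Dv OP Ov (reg O OP Ov).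
have h0 : h != 0 by apply/eqP => h0; apply: Ph; rewrite h0; exact: (place_ideal0 OP).
by exfalso; apply/Ph/IO; split=> //; rewrite zE mulrC divfK.
Qed.

Lemma range_ev_reduced z : range ev z -> exists2 Z : {poly {poly K}}, (size Z <= n)%N & z = ev Z.
Proof.
move=> [A _ <-]; have fm := fermat_monic K m n0.
exists (A %% fermat_poly K n m).
  by rewrite -ltnS -(size_fermat_poly K m n0) Pdiv.Idomain.ltn_modpN0 // monic_neq0.
have := congr1 ev (Pdiv.IdomainMonic.divp_eq fm A).
by rewrite ev2D ev2M (ev2_fermat _ (fermat_eq C)) mulr0 add0r.
Qed.

(** The weight of 1 / c, that is (2g - 2) / d: the order of omega at infinity. *)
Let G : int := (m * n')%:Z - m'%:Z - n'%:Z - 1.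

(** In z = f z + (1 - f) z the second term has weight at most G, and f of weight -1 lowers any bound
    on the first; so a bound for z descends to G one step at a time. *)
Lemma pole_bound z : range ev z ->
  (forall O, is_place iota O -> ~ O v -> O (z * c)) -> wle G z.
Proof.
move=> [Z _ ZE] reg; have [f f1 fz] := infinite_regular reg.
have s0 : s != 0 := inf_s0 C _ _.
have c0 : c != 0 := inf_c0 C _ _.
have cV : wle G c^-1.
  apply: (@wle_mono_frac _ _ 1%N b.+1 a m); last by rewrite /G mul1n mulSn bezout; lia.
  rewrite /inf_c /inf_s invf_div expr1 exprS.
  by field; rewrite ?u0 ?v0 ?expf_neq0.
have key : wle G ((1 - f) * z).
  have -> : (1 - f) * z = ((1 - f) * (z * c)) * c^-1 by field.
  exact: wle0M.
suff down (k : nat) : wle (G + k%:Z) z -> wle G z.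
  apply: (down `|(size (Phi Z))%:Z - G|%N).
  by rewrite -[in wle _ _]ZE; apply: wle_mono (wle_ev Z); lia.
elim: k => [|k IHk]; first by rewrite addr0.
move=> zk; apply: IHk.
have -> : z = f * z + (1 - f) * z by ring.
apply: wleD; last by apply: wle_mono key; lia.
have := wleM f1 zk; rewrite (_ : - 1 + (G + k.+1%:Z) = G + k%:Z) //; lia.
Qed.

(** With w a unit, the exponent l of s is the order at infinity of u^i v^j c: the slack in the
    weight bound. *)
Let chart_monomial (W S U V : F) i j l : W != 0 -> S != 0 ->
    U = W ^+ b / S ^+ m' -> V = W ^+ a / S ^+ n' ->
    (m * n' = (i.+1 * m' + j.+1 * n') + l.+1)%N ->
  V ^+ j * (U ^+ i * (U * V / (V ^+ m * S))) =
    W ^+ (b * i.+1 + a * j.+1) * W^-1 ^+ (a * m) * S ^+ l.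
Proof.
move=> W0 S0 UE VE lE; have V0 : V != 0 by rewrite VE mulf_neq0 ?invr_eq0 ?expf_neq0.
transitivity (U ^+ i.+1 * V ^+ j.+1 / (V ^+ m * S)).
  by rewrite !exprS; field; rewrite S0 expf_neq0.
have Sl : S ^+ (n' * m) = S ^+ (m' * i.+1) * S ^+ (n' * j.+1) * S ^+ l * S.
  by rewrite -!exprD -exprSr; congr (_ ^+ _); rewrite mulnC lE; lia.
rewrite UE VE !expr_div_n -!exprM Sl exprD exprVn.
by field; rewrite ?expf_neq0 ?S0 ?W0.
Qed.

Lemma holomorphic_omegaE z : holomorphic (z *: omega) <->
  exists Z : {poly {poly K}}, [/\ (size Z <= n)%N, z = ev Z &
    forall i j, Z`_i`_j != 0 -> (i.+1 * m + j.+1 * n < n * m)%N].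
Proof.
split=> [hol|[Z [Zn -> Zb]] O OP].
  have Rz : range ev z.
    apply: finite_regular => O OP Ov.
    exact/(finite_place_regular C K_perfect DP Du Dv OP Ov)/hol.
  have zG : wle G z.
    apply: pole_bound => // O OP nOv.
    by apply/(infinite_place_regular C K_perfect DP Du Dv OP nE mE bezout nOv)/hol.
  have [Z Zn ZE] := range_ev_reduced Rz; exists Z; split=> // i j Zij.
  have := @wle_coef G Z i j Zn; rewrite -ZE => /(_ zG Zij) ijG.
  have : (i.+1 * m' + j.+1 * n' < m * n')%N by rewrite /G in ijG; rewrite !mulSn; lia.
  rewrite -(ltn_pmul2l d0) => h.
  have -> : (i.+1 * m + j.+1 * n = d * (i.+1 * m' + j.+1 * n'))%N by rewrite nE mE; lia.
  have -> : (n * m = d * (m * n'))%N by rewrite nE mE; lia.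
  exact: h.
have [Ov|nOv] := pselect (O v).
  apply/(finite_place_regular C K_perfect DP Du Dv OP Ov).
  exact: (place_ev2 _ OP Ov (finite_place_u C OP Ov)).
apply/(infinite_place_regular C K_perfect DP Du Dv OP nE mE bezout nOv).
have Os := place_idealW (inf_s_ideal C OP nE mE bezout nOv).
have [Ow _] := inf_w_unit C OP nE mE nOv.
have Ow' := inf_w_inv C OP nE mE nOv.
rewrite ev2_sum mulr_suml; apply: (place_sum OP) => i _.
rewrite ev1E (@horner_coef_wide _ (size Z`_i)) ?size_poly // !mulr_suml.
apply: (place_sum OP) => j _; rewrite coef_map /=.
have [->|Zij] := eqVneq Z`_i`_j 0; first by rewrite rmorph0 !mul0r; exact: (place0 OP).
rewrite -!mulrA; apply: (placeM OP); first exact: (place_iota OP).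
have ijG : (i.+1 * m' + j.+1 * n' < m * n')%N.
  have := Zb _ _ Zij.
  have -> : (i.+1 * m + j.+1 * n = d * (i.+1 * m' + j.+1 * n'))%N by rewrite nE mE; lia.
  have -> : (n * m = d * (m * n'))%N by rewrite nE mE; lia.
  by rewrite ltn_pmul2l.
(* The strict inequality makes this subtraction exact, so s occurs with a nonnegative exponent. *)
set l := (m * n' - (i.+1 * m' + j.+1 * n') - 1)%N.
rewrite (@chart_monomial (w) (s) u v i j l) //.
- by apply: (placeM OP); [apply: (placeM OP) |]; exact: (placeX OP).
- exact: (inf_w0 C).
- exact: (inf_s0 C).
- exact: (inf_u C bezout).
- exact: (inf_v C bezout).
- by rewrite /l; lia.
Qed.

End Holomorphic.

(** * The Cartier operator *)

Lemma fact_pchar_neq0 (R : fieldType) p k : p \in [pchar R] -> (k < p)%N ->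
  k`!%:R != 0 :> R.
Proof.
move=> pR; elim: k => [|k IHk] kp; first by rewrite oner_neq0.
by rewrite factS natrM mulf_neq0 ?IHk ?(ltnW kp) // -(dvdn_pcharf pR) gtnNdvd.
Qed.

Section IteratedDerivation.
Variables (K F : fieldType) (iota : {rmorphism K -> F}) (p : nat).
Hypothesis pK : p \in [pchar K].
Variable E : F -> F.
Hypothesis EP : is_derivation iota E.

Lemma pcharF : p \in [pchar F].
Proof. by rewrite (fmorph_pchar iota). Qed.

Lemma der_iterD k x y : iter k E (x + y) = iter k E x + iter k E y.
Proof. by elim: k => //= k ->; rewrite (derD EP). Qed.

Lemma der_iter0 k : iter k E 0 = 0.
Proof. by elim: k => //= k ->; rewrite (der0 EP). Qed.

Lemma der_iter_sum k (I : Type) (r : seq I) (P : pred I) (f : I -> F) :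
  iter k E (\sum_(i <- r | P i) f i) = \sum_(i <- r | P i) iter k E (f i).
Proof. by apply: (big_morph (iter k E)); [exact: der_iterD | exact: der_iter0]. Qed.

Lemma der_pth x : E (x ^+ p) = 0.
Proof. by rewrite (derX EP) (pcharf0 pcharF) !mul0r. Qed.

Lemma der_natr k : E k%:R = 0.
Proof. by rewrite -(rmorph_nat iota) (der_iota EP). Qed.

Lemma der_iterZ k c x : E c = 0 -> iter k E (c * x) = c * iter k E x.
Proof. by move=> c0; elim: k => //= k ->; rewrite (derM EP) c0 mulr0 addr0. Qed.

Lemma der_iter_leibniz k x y : iter k E (x * y) =
  \sum_(i < k.+1) ('C(k, i))%:R * (iter i E x * iter (k - i) E y).
Proof.
elim: k => [|k IHk]; first by rewrite big_ord_recl big_ord0 addr0 bin0 mul1r.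
pose f i j := iter i E x * iter j E y.
have step : iter k.+1 E (x * y) =
    \sum_(i < k.+1) 'C(k, i)%:R * f i (k - i).+1 + \sum_(i < k.+1) 'C(k, i)%:R * f i.+1 (k - i)%N.
  rewrite iterS IHk (der_sum EP) -big_split /=; apply: eq_bigr => i _.
  rewrite (derM EP) der_natr mulr0 addr0 (derM EP) /f /=.
  by rewrite -mulrDr [iter (k - i) E y * _]mulrC.
rewrite step [RHS]big_ord_recl /= bin0 mul1r ?subn0.
under [in RHS]eq_bigr => i _ do rewrite /bump add1n binS subSS natrD mulrDl.
rewrite [in RHS]big_split /= addrA; congr (_ + _).
rewrite big_ord_recl [in RHS]big_ord_recr /= (@bin_small k k.+1) // mul0r addr0 bin0 mul1r ?subn0.
congr (_ + _); apply: eq_bigr => i _.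
by rewrite /f /bump add1n -subSn ?subSS.
Qed.

(** The inner binomial coefficients in Leibniz' formula vanish modulo p. *)
Lemma der_iter_p x y : iter p E (x * y) = x * iter p E y + y * iter p E x.
Proof.
have p_pr := pcharf_prime pK.
rewrite der_iter_leibniz; case: p p_pr pcharF => // q q_pr qF.
rewrite big_ord_recl big_ord_recr /= bin0 mul1r ?subn0 /bump /= ?add1n binn mul1r subnn.
rewrite big1 ?add0r => [|i _]; first by rewrite [y * _]mulrC.
rewrite (_ : _%:R = 0) ?mul0r //; apply/eqP; rewrite -(dvdn_pcharf qF) add1n.
by apply: prime_dvd_bin => //=; rewrite ltnS ltn_ord.
Qed.

Lemma der_iter_p_derivation : is_derivation iota (iter p E).
Proof.
split; [exact: der_iterD | exact: der_iter_p |].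
move=> c; have := pcharf_prime pK; case: p => // q _.
by rewrite iterSr (der_iota EP) der_iter0.
Qed.

Variable v : F.
Hypothesis Ev : E v = 1.

Lemma der_iter_exp k e : iter k E (v ^+ e) = (e ^_ k)%:R * v ^+ (e - k).
Proof.
elim: k => [|k IHk]; first by rewrite ffactn0 mul1r subn0.
rewrite iterS IHk (derM EP) der_natr mulr0 addr0 (derX EP) Ev mulr1 ffactnSr natrM.
by rewrite mulrA subnS.
Qed.

(** The p - 1 consecutive factors e, ..., e - p + 2 miss only the residue class of e + 1. So the
    derivative of order p - 1 detects the exponents congruent to -1 modulo p. *)
Lemma ffact_pchar0 e : ~~ (p %| e.+1)%N -> (e ^_ p.-1)%:R = 0 :> F.
Proof.
move=> pe; apply/eqP; rewrite -(dvdn_pcharf pcharF) ffact_prod.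
have p_pr := pcharf_prime pK; have p0 := prime_gt0 p_pr.
have ep : (e %% p < p.-1)%N.
  rewrite ltn_neqAle -ltnS prednK // ltn_mod p0 andbT; apply: contra pe => /eqP ep.
  by rewrite (divn_eq e p) ep -addnS prednK // dvdn_addr ?dvdn_mull.
rewrite (bigD1 (Ordinal ep)) //= dvdn_mulr //.
by rewrite {1}(divn_eq e p) addnK dvdn_mull.
Qed.

Lemma ffact_pchar_neq0 t : (0 < t)%N -> ((p * t).-1 ^_ p.-1)%:R != 0 :> F.
Proof.
move=> t0; have p_pr := pcharf_prime pK; have p0 := prime_gt0 p_pr.
rewrite ffact_prod natr_prod; apply/prodf_neq0 => i _; rewrite -(dvdn_pcharf pcharF).
have ip : (i.+1 < p)%N by rewrite -[X in (_ < X)%N](prednK p0) ltnS ltn_ord.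
have pt : (p <= p * t)%N by rewrite leq_pmulr.
have -> : ((p * t).-1 - i = p * t - i.+1)%N by lia.
by rewrite dvdn_subr ?dvdn_mulr // ?gtnNdvd //; lia.
Qed.

End IteratedDerivation.

Section MonomialSums.
Variables (K : fieldType) (I : finType) (A : pred I) (al be : I -> nat) (c : I -> K).

Definition monomial_sum : {poly {poly K}} :=
  \sum_(t | A t) (c t *: 'X^(be t))%:P * 'X^(al t).

Lemma monomial_sum_coef i j : monomial_sum`_i`_j =
  \sum_(t | A t) c t *+ ((al t == i) && (be t == j)).
Proof.
rewrite /monomial_sum coef_sum -/(coefp j _) raddf_sum /=.
apply: eq_bigr => t _; rewrite coefCM coefXn eq_sym; case: eqP => _ /=; last first.
  by rewrite mulr0 coef0.
by rewrite mulr1 coefZ coefXn mulr_natr eq_sym.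
Qed.

Lemma monomial_sum_ev (F : comNzRingType) (iota : {rmorphism K -> F}) (x y : F) :
  ev2 iota x y monomial_sum = \sum_(t | A t) iota (c t) * (y ^+ al t * x ^+ be t).
Proof.
rewrite /monomial_sum rmorph_sum /=; apply: eq_bigr => t _.
rewrite ev2M ev2C rmorphXn /= ev2X -mul_polyC ev1M ev1C rmorphXn /= ev1X.
by ring.
Qed.

Lemma monomial_sum_size k : (forall t, A t -> (al t < k)%N) -> (size monomial_sum <= k)%N.
Proof.
move=> Ak; rewrite (leq_trans (size_sum _ _ _)) //; apply/bigmax_leqP => t At.
rewrite mul_polyC (leq_trans (size_scale_leq _ _)) // size_polyXn.
exact: Ak.
Qed.

End MonomialSums.

Lemma ord_pred_inj N (x y : 'I_N) : (0 < x)%N -> (0 < y)%N -> x.-1 = y.-1 -> x = y.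
Proof. by move=> x0 y0 e; apply: val_inj; rewrite /= -(prednK x0) e prednK. Qed.

Section Cartier.
Variables (K F : fieldType) (iota : {rmorphism K -> F}) (p n m : nat) (u v : F).
Hypotheses (C : fermat_curve iota n m u v) (K_perfect : perfect K p).
Variable D : F -> F.
Hypotheses (DP : is_derivation iota D) (Du : D u = m%:R * v ^+ m.-1)
  (Dv : D v = - (n%:R * u ^+ n.-1)).

Local Notation omega := (@omega _ _ iota v D).
Local Notation ev := (ev2 iota v u).

Let n0 := fermat_n0 C.
Let m0 := fermat_m0 C.
Let u0 : u != 0 := fermat_u0 C.
Let v0 : v != 0 := fermat_v0 C.
Let pK := K_perfect.1.
Let p_pr : prime p := pcharf_prime pK.
Let p0 : (0 < p)%N := prime_gt0 p_pr.
Let Dv0 : D v != 0 := fermat_Dv0 C Dv.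
Let nF : n%:R != 0 :> F := fermat_nF C.

Lemma monomial_indep (I : finType) (A : pred I) (al be : I -> nat) (c : I -> K) :
    (forall t, A t -> (al t < n)%N) ->
    (forall t t', A t -> A t' -> al t = al t' -> be t = be t' -> t = t') ->
    \sum_(t | A t) iota (c t) * (u ^+ al t * v ^+ be t) = 0 ->
  forall t, A t -> c t = 0.
Proof.
move=> An inj c0 t At.
have : monomial_sum A al be c = 0.
  apply: (fermat_kernel_size C); first by rewrite monomial_sum_ev.
  exact: monomial_sum_size.
move/(congr1 (fun Z : {poly {poly K}} => Z`_(al t)`_(be t))).
rewrite monomial_sum_coef !coef0 (bigD1 t) //= !eqxx mulr1n big1 ?addr0 // => t' /andP[At' tt'].
case: andP => // -[/eqP e1 /eqP e2].
by rewrite (inj t' t) ?eqxx in tt'.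
Qed.

(** This is d/dv; its iterate of order p - 1 stands in for the Cartier operator. *)
Let E z := (D v)^-1 * D z.

Let EP : is_derivation iota E. Proof. exact: derivation_scale. Qed.

Let Ev : E v = 1. Proof. exact: mulVf. Qed.

(** E^p is a derivation; it kills v because E v = 1, and then u by the Fermat equation. *)
Lemma iter_p_zero z : iter p E z = 0.
Proof.
have PP := der_iter_p_derivation pK EP.
have pv : iter p E v = 0.
  by case: p p_pr => [|[|q]] // _; rewrite !iterSr Ev (der1 EP) (der_iter0 EP).
have pu : iter p E u = 0.
  have := fermat_derivation_rel C PP; rewrite pv mulr0 addr0 => /eqP.
  by rewrite !mulf_eq0 (negbTE nF) expf_eq0 (negbTE u0) andbF => /eqP.
have zP : is_derivation iota (fun _ => 0).
  by split=> *; rewrite ?addr0 ?mulr0 ?addr0.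
exact: (derivation_ext (fermat_genE C) PP zP pv pu z).
Qed.

(** Integrate term by term: i + 1 is invertible for i < p - 1, and the term i = p - 1 has the factor
    x_(p-1) D t = 0. *)
Lemma cartier_zero_exact z : cartier p (z *: omega) 0 -> exists y, z = D y.
Proof.
move=> [t [x [_ zE x0]]]; move: zE x0; rewrite (diffE C DP Du Dv) !scalerA.
move=> /(omega_inj C DP Dv) ->.
have -> : (0 : differential iota) = 0 *: omega by rewrite scale0r.
move=> /(omega_inj C DP Dv) xt.
exists (\sum_(i < p.-1) x i ^+ p * (t ^+ i.+1 / i.+1%:R)).
rewrite (der_sum DP) mulr_suml.
transitivity (\sum_(i < p.-1.+1) x i ^+ p * t ^+ i * D t); first by rewrite prednK.
rewrite big_ord_recr /=.
rewrite [X in _ + X](_ : _ = 0) ?addr0.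
  apply: eq_bigr => i _. rewrite (derM DP) (der_pth pK DP) mulr0 addr0 -mulrA.
  congr (_ * _); rewrite (derM DP) (derX DP) /=.
  have i0 : i.+1%:R != 0 :> F.
    rewrite -(dvdn_pcharf (pcharF iota pK)) gtnNdvd //.
    by rewrite -[X in (_ < X)%N](prednK p0) ltnS ltn_ord.
  rewrite (derV DP) (der_natr DP) oppr0 mul0r mulr0 add0r.
  by move: i0; move: (i.+1%:R : F) => q q0; field.
have xp y : y ^+ p = y * y ^+ p.-1 :> F by rewrite -exprS prednK.
transitivity (x p.-1 * D t * (x p.-1 ^+ p.-1 * t ^+ p.-1)); last by rewrite -xt mul0r.
by rewrite xp; ring.
Qed.

(** C maps the differential of index (p I mod n, p J mod m) to a multiple of the one of index (I,
    J), which is nonzero when the two quotients add up to less than p and zero otherwise. *)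
Definition frob_quo (N I : nat) := ((p * I) %/ N)%N.
Definition frob_mod (N I : nat) := ((p * I) %% N)%N.
Local Notation qn := (frob_quo n).
Local Notation qm := (frob_quo m).
Local Notation rn := (frob_mod n).
Local Notation rm := (frob_mod m).

Let frob_eq N I : (p * I = frob_quo N I * N + frob_mod N I)%N.
Proof. exact: divn_eq. Qed.

Let frob_quo_lt N I : (I < N)%N -> (frob_quo N I < p)%N.
Proof. by move=> IN; rewrite /frob_quo ltn_divLR ?(leq_ltn_trans _ IN) // ltn_pmul2l. Qed.

Let frob_mod_gt0 N I : N%:R != 0 :> K -> (0 < I < N)%N -> (0 < frob_mod N I)%N.
Proof.
move=> NK /andP[I0 IN]; rewrite lt0n; apply/negP => /eqP r0.
have : (N %| p * I)%N by rewrite /dvdn; apply/eqP.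
rewrite Gauss_dvdr; last by rewrite coprime_sym prime_coprime // (dvdn_pcharf pK).
by rewrite gtnNdvd.
Qed.

(* The substitution u^n = - (v^m + 1) writes the differential as a combination
   of p-th powers times powers of v. *)
Lemma monomial_expand I J : (0 < I < n)%N -> (0 < rm J)%N ->
  u ^+ (rn I).-1 * v ^+ (rm J).-1 / D v =
  - n%:R^-1 * (u ^+ (n - I))^-1 ^+ p *
    \sum_(l < (p.-1 - qn I).+1) ((-1) ^+ (p.-1 - qn I) * 'C(p.-1 - qn I, l)%:R) *
      v ^+ (m * l + (rm J).-1).
Proof.
move=> /andP[I0 In] rJ0; set k := (p.-1 - qn I)%N.
have qp : (qn I < p)%N := frob_quo_lt In.
have rI0 : (0 < rn I)%N by apply: frob_mod_gt0; rewrite ?(fermat_nK C) ?I0.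
(* This is p I = q n + r rearranged; it splits u^(r-1) / u^(n-1) into a power of u^n and a p-th
   power. *)
have nk : (n * k + n = rn I + p * (n - I))%N.
  by have := frob_eq n I; rewrite mulnBr /k; nia.
have unk : u ^+ (n * k) = (-1) ^+ k * \sum_(l < k.+1) 'C(k, l)%:R * v ^+ (m * l).
  have un : u ^+ n = -1 * (1 + v ^+ m).
    by apply/eqP; rewrite mulN1r -addr_eq0 [1 + _]addrC addrA (fermat_eq C).
  rewrite exprM un exprMn; congr (_ * _); rewrite exprDn; apply: eq_bigr => l _.
  by rewrite expr1n mul1r -exprM mulr_natl.
have uI : u ^+ (rn I).-1 / u ^+ n.-1 = u ^+ (n * k) * (u ^+ (n - I))^-1 ^+ p.
  rewrite exprVn -exprM; apply/eqP; rewrite eqr_div ?expf_neq0 // -!exprD; apply/eqP.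
  congr (_ ^+ _); move: nk; rewrite [((n - I) * p)%N]mulnC; lia.
have -> : u ^+ (rn I).-1 * v ^+ (rm J).-1 / D v =
    - n%:R^-1 * (u ^+ (rn I).-1 / u ^+ n.-1) * v ^+ (rm J).-1.
  by rewrite Dv; field; rewrite oppr_eq0 mulf_neq0 ?nF ?expf_neq0.
rewrite uI unk -!mulrA mulr_suml; congr (_ * _).
rewrite !mulr_sumr; apply: eq_bigr => l _.
by rewrite exprD; ring.
Qed.

Let natr_dvd k : (k%:R == 0 :> K) = (p %| k)%N.
Proof. by rewrite (dvdn_pcharf pK). Qed.

Let coprime_pm : coprime p m.
Proof. by rewrite prime_coprime // -natr_dvd (fermat_mK C). Qed.

(** Since p does not divide m, the numbers m l + r with l < p meet each class modulo p once, and l =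
    [qm J] gives p J. *)
Lemma frob_quo_uniq J l : (0 < J < m)%N -> (l < p)%N ->
  (p %| m * l + rm J)%N = (l == qm J).
Proof.
move=> /andP[J0 Jm] lp; have qp := frob_quo_lt Jm; have e := frob_eq m J.
apply/idP/eqP => [pl|->]; last by rewrite mulnC -e dvdn_mulr.
have pJ : (p %| m * qm J + rm J)%N by rewrite mulnC -e dvdn_mulr.
have diff0 a b : (p %| m * a + rm J)%N -> (p %| m * b + rm J)%N -> (a < p)%N -> (a <= b)%N.
  move=> pa pb ap; have := dvdn_sub pa pb; rewrite subnDr -mulnBr Gauss_dvdr //.
  move=> pab; rewrite leqNgt -subn_gt0; apply/negP => ab.
  by have := dvdn_leq ab pab; lia.
by apply/eqP; rewrite eqn_leq (diff0 _ _ pl pJ lp) (diff0 _ _ pJ pl qp).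
Qed.

(** The factor -1/n comes from D v, the binomial from the term l = [qm J] of the expansion, and the
    falling factorial from differentiating v^(pJ-1) p - 1 times. *)
Definition cartier_coef I J : K :=
  - n%:R^-1 * ((-1) ^+ (p.-1 - qn I) * 'C(p.-1 - qn I, qm J)%:R) * ((p * J).-1 ^_ p.-1)%:R.

Lemma bin_pchar_neq0 k l : (l <= k)%N -> (k < p)%N -> 'C(k, l)%:R != 0 :> K.
Proof.
move=> lk kp; have := fact_pchar_neq0 pK kp.
rewrite -(bin_fact lk) natrM mulf_eq0 negb_or.
by case/andP.
Qed.

Lemma cartier_coef_neq0 I J : (qn I + qm J < p)%N -> (0 < J)%N -> cartier_coef I J != 0.
Proof.
move=> qp J0; rewrite /cartier_coef !mulf_neq0 ?oppr_eq0 ?invr_eq0 ?(fermat_nK C) //.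
- by rewrite expf_neq0 // oppr_eq0 oner_eq0.
- by apply: bin_pchar_neq0; lia.
- exact: (ffact_pchar_neq0 (@idfun K) pK J0).
Qed.

Let E_iota c : E (iota c) = 0. Proof. exact: (der_iota EP). Qed.

(** Only the term l = [qm J] can survive, and it occurs in the sum over l <= p - 1 - [qn I] exactly
    when the quotients add up to less than p. *)
Lemma iter_monomial I J : (0 < I < n)%N -> (0 < J < m)%N ->
  iter p.-1 E (u ^+ (rn I).-1 * v ^+ (rm J).-1 / D v) =
  (if (qn I + qm J < p)%N then iota (cartier_coef I J) else 0) *
    ((u ^+ (n - I))^-1 * v ^+ J.-1) ^+ p.
Proof.
move=> In Jm; have rJ0 : (0 < rm J)%N by apply: frob_mod_gt0; rewrite ?(fermat_mK C).
have qp := frob_quo_lt (andP In).2; have [J0 J1] := andP Jm.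
rewrite monomial_expand //; set k := (p.-1 - qn I)%N.
have kp : (k < p)%N by rewrite /k; lia.
rewrite (der_iterZ EP); last first.
  rewrite (derM EP) (der_pth pK EP) mulr0 add0r (_ : - _ = iota (- n%:R^-1)).
    by rewrite E_iota mulr0.
  by rewrite rmorphN fmorphV rmorph_nat.
rewrite (der_iter_sum EP).
have termE (l : 'I_k.+1) : iter p.-1 E ((-1) ^+ k * 'C(k, l)%:R * v ^+ (m * l + (rm J).-1)) =
    if l == qm J :> nat then (-1) ^+ k * 'C(k, l)%:R * ((p * J).-1 ^_ p.-1)%:R * (v ^+ J.-1) ^+ p
    else 0.
  rewrite (der_iterZ EP); last first.
    rewrite (_ : _ * _ = iota ((-1) ^+ k * 'C(k, l)%:R)) ?E_iota //.
    by rewrite rmorphM rmorphXn rmorphN1 rmorph_nat.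
  rewrite (der_iter_exp EP Ev) -mulrA; have lp : (l < p)%N by apply: leq_ltn_trans kp; rewrite -ltnS.
  have := frob_quo_uniq Jm lp; rewrite (_ : m * l + rm J = (m * l + (rm J).-1).+1)%N; last first.
    by rewrite -addnS prednK.
  case: eqP => [->|_] pl; last by rewrite (ffact_pchar0 iota pK) ?mul0r ?mulr0 // pl.
  have -> : (m * qm J + (rm J).-1 = (p * J).-1)%N by rewrite (frob_eq m J) [(qm J * m)%N]mulnC; lia.
  rewrite -exprM; congr (_ * (_ * _ ^+ _)).
  by move: p0 J0; case: (p) => // q _; case: (J) => // j _; rewrite /=; lia.
under eq_bigr => l _ do rewrite termE.
case: ifP => qq.
  have qk : (qm J < k.+1)%N by rewrite /k; lia.
  rewrite (bigD1 (Ordinal qk)) //= eqxx big1 ?addr0 => [|l]; last first.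
    by rewrite -val_eqE /= => /negbTE ->.
  rewrite /cartier_coef !rmorphM rmorphN fmorphV rmorphXn rmorphN1 !rmorph_nat /= -/k exprMn.
  by ring.
rewrite mul0r big1 ?mulr0 // => l _; case: eqP => // lq.
have lk := ltn_ord l; rewrite lq /k in lk; lia.
Qed.

Variable A : {set 'I_n * 'I_m}.
Hypothesis A_pos : forall t, t \in A -> (0 < t.1)%N && (0 < t.2)%N.

Local Notation mon t := (u ^+ (rn t.1).-1 * v ^+ (rm t.2).-1).

(** E^(p-1) of the sum is E^p y = 0. What survives is a sum of p-th powers, hence the p-th power of
    a combination of independent monomials. *)
Lemma cartier_zero_coef (c : 'I_n * 'I_m -> K) :
    cartier p ((\sum_(t in A) iota (c t) * mon t) *: omega) 0 ->
  forall t, t \in A -> (qn t.1 + qm t.2 < p)%N -> c t = 0.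
Proof.
move=> /cartier_zero_exact [y zE].
have E0 : iter p.-1 E ((\sum_(t in A) iota (c t) * mon t) / D v) = 0.
  by rewrite zE mulrC -[_ * _]/(E y) -iterSr prednK // iter_p_zero.
have [rt rtE] := choice (fun t : 'I_n * 'I_m => K_perfect.2 (c t * cartier_coef t.1 t.2)).
pose B := [pred t : 'I_n * 'I_m | (t \in A) && (qn t.1 + qm t.2 < p)%N].
have S0 : \sum_(t | B t) iota (rt t) * (u ^+ t.1 * v ^+ t.2.-1) = 0.
  (* This factor turns the negative powers u^(I-n) into u^I, with exponents below n. *)
  have : (u ^+ n) ^+ p * iter p.-1 E ((\sum_(t in A) iota (c t) * mon t) / D v) = 0.
    by rewrite E0 mulr0.
  rewrite mulr_suml (der_iter_sum EP) mulr_sumr.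
  rewrite (@pth_power_sum _ p _ _ _ _ (fun t : 'I_n * 'I_m => if (qn t.1 + qm t.2 < p)%N then
    iota (rt t) * (u ^+ t.1 * v ^+ t.2.-1) else 0)) ?(pcharF iota pK) //.
    by rewrite -big_mkcondr => /eqP; rewrite expf_eq0 => /andP[_ /eqP].
  move=> t At; have [t1 t2] := andP (A_pos At).
  have In : (0 < t.1 < n)%N by rewrite t1 ltn_ord.
  have Jm : (0 < t.2 < m)%N by rewrite t2 ltn_ord.
  rewrite -mulrA (der_iterZ EP) ?E_iota // iter_monomial //.
  have uE : u ^+ n = u ^+ t.1 * u ^+ (n - t.1) by rewrite -exprD subnKC // ltnW.
  case: ifP => _; last by rewrite mul0r !mulr0 expr0n gtn_eqF.
  rewrite [in RHS]exprMn -rmorphXn -rtE rmorphM uE !exprMn.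
  by rewrite exprVn; field; rewrite !expf_neq0.
move=> t At tp; have Bt : B t by rewrite /B /= At.
have inj t' t'' : B t' -> B t'' -> t'.1 = t''.1 :> nat -> t'.2.-1 = t''.2.-1 -> t' = t''.
  move=> /andP[/A_pos/andP[_ p'] _] /andP[/A_pos/andP[_ p''] _] e1 e2.
  by apply: injective_projections; [exact: val_inj | exact: ord_pred_inj].
have := monomial_indep (fun t _ => ltn_ord t.1) inj S0 Bt.
move=> r0; have := rtE t; rewrite r0 expr0n gtn_eqF //= => /eqP.
rewrite mulf_eq0 => /orP[/eqP //|]; rewrite (negbTE (cartier_coef_neq0 tp _)) //.
by case/andP: (A_pos At).
Qed.

(* The differentials f dv with C(f dv) = 0. *)
Definition cartier_kernel (f : F) :=
  exists x : nat -> F, x p.-1 = 0 /\ f = \sum_(i < p) x i ^+ p * v ^+ i.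

Lemma cartier_kernel0 : cartier_kernel 0.
Proof.
exists (fun _ => 0); split=> //; rewrite big1 // => i _.
by rewrite expr0n gtn_eqF //= mul0r.
Qed.

Lemma cartier_kernelD f g : cartier_kernel f -> cartier_kernel g -> cartier_kernel (f + g).
Proof.
move=> [x [x0 ->]] [y [y0 ->]]; exists (fun i => x i + y i); rewrite x0 y0 addr0; split=> //.
rewrite -big_split /=; apply: eq_bigr => i _.
have pn : [pchar F].-nat p by rewrite pnatE // (pcharF iota pK).
by rewrite exprDn_pchar // mulrDl.
Qed.

(** The condition says that e mod p is not p - 1, so the monomial fits into a slot other than the
    last. *)
Lemma cartier_kernel_mono l y e : ~~ (p %| e.+1)%N ->
  cartier_kernel (iota l * y ^+ p * v ^+ e).
Proof.
move=> pe; have [r ->] := K_perfect.2 l.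
exists (fun i => if i == (e %% p)%N then iota r * y * v ^+ (e %/ p) else 0); split.
  case: eqP => // ep; case/negP: pe.
  by rewrite (divn_eq e p) -ep -addnS prednK // dvdn_addr ?dvdn_mull.
rewrite (bigD1 (Ordinal (ltn_pmod e p0))) //= eqxx big1 ?addr0 => [|i].
  by rewrite {1}(divn_eq e p) exprD !exprMn rmorphXn exprM; ring.
by rewrite -val_eqE /= => /negbTE ->; rewrite expr0n gtn_eqF //= mul0r.
Qed.

Hypothesis v_sep : separating iota v.

Lemma cartier_kernelP z : cartier_kernel (z / D v) -> cartier p (z *: omega) 0.
Proof.
move=> [x [x0 zE]]; exists v, x; split=> //; last by rewrite x0 scale0r.
by rewrite (diffE C DP Du Dv) scalerA -zE divfK.
Qed.

(** If the quotients add up to at least p, every l in the expansion is below [qm J], so no exponent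
    of v is congruent to -1 modulo p. *)
Lemma cartier_zero_sum (c : 'I_n * 'I_m -> K) :
    (forall t, t \in A -> (qn t.1 + qm t.2 < p)%N -> c t = 0) ->
  cartier p ((\sum_(t in A) iota (c t) * mon t) *: omega) 0.
Proof.
move=> c0; apply: cartier_kernelP; rewrite mulr_suml.
apply: (big_ind cartier_kernel) => [||t At]; [exact: cartier_kernel0|exact: cartier_kernelD|].
have [t1 t2] := andP (A_pos At).
have In : (0 < t.1 < n)%N by rewrite t1 ltn_ord.
have Jm : (0 < t.2 < m)%N by rewrite t2 ltn_ord.
have rJ0 : (0 < rm t.2)%N by apply: frob_mod_gt0; rewrite ?(fermat_mK C).
have [qp|pq] := ltnP (qn t.1 + qm t.2) p.
  by rewrite c0 // rmorph0 !mul0r; exact: cartier_kernel0.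
rewrite -mulrA monomial_expand // !mulr_sumr.
apply: (big_ind cartier_kernel) => [||l _]; [exact: cartier_kernel0|exact: cartier_kernelD|].
set k := (p.-1 - _)%N.
have -> : iota (c t) * (- n%:R^-1 * (u ^+ (n - t.1))^-1 ^+ p *
      ((-1) ^+ k * 'C(k, l)%:R * v ^+ (m * l + (rm t.2).-1))) =
    iota (c t * - n%:R^-1 * ((-1) ^+ k * 'C(k, l)%:R)) * (u ^+ (n - t.1))^-1 ^+ p *
      v ^+ (m * l + (rm t.2).-1).
  by rewrite !rmorphM rmorphN fmorphV rmorphXn rmorphN1 !rmorph_nat /=; ring.
apply: cartier_kernel_mono; rewrite -addnS prednK //.
have lk := ltn_ord l; have q0 := frob_quo_lt (ltn_ord t.1).
rewrite (frob_quo_uniq Jm); last by lia.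
by apply/eqP; lia.
Qed.

End Cartier.

(** * Separability of F over K(v) *)

Section Separating.
Variables (K F : fieldType) (iota : {rmorphism K -> F}) (p n m : nat) (u v : F).
Hypotheses (C : fermat_curve iota n m u v) (K_perfect : perfect K p).
Variable D : F -> F.
Hypotheses (DP : is_derivation iota D) (Dv0 : D v != 0).

Let pK := K_perfect.1.
Let p_pr : prime p := pcharf_prime pK.
Let p0 : (0 < p)%N := prime_gt0 p_pr.

(** With N the top index, E^N kills the lower powers of v and leaves N! x_N^p. *)
Lemma pth_powers_indep N (x : nat -> F) : (N <= p)%N ->
  \sum_(i < N) x i ^+ p * v ^+ i = 0 -> forall i, (i < N)%N -> x i = 0.
Proof.
pose E z := (D v)^-1 * D z.
have EP : is_derivation iota E by exact: derivation_scale.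
have Ev : E v = 1 by exact: mulVf.
elim: N => // N IHN Np; rewrite big_ord_recr /= => S0.
have xN : x N = 0.
  have := congr1 (iter N E) S0; rewrite (der_iterD EP) (der_iter_sum EP) (der_iter0 EP).
  rewrite big1 ?add0r => [|i _]; last first.
    rewrite (der_iterZ EP) ?(der_pth pK EP) // (der_iter_exp EP Ev).
    by rewrite ffact_small // mul0r mulr0.
  rewrite (der_iterZ EP) ?(der_pth pK EP) // (der_iter_exp EP Ev) subnn mulr1 ffactnn.
  move/eqP; rewrite mulf_eq0 (negbTE (fact_pchar_neq0 (pcharF iota pK) Np)) orbF.
  by rewrite expf_eq0 => /andP[_ /eqP].
move=> i; rewrite ltnS leq_eqVlt => /predU1P[->//|iN]; apply: IHN => //; first exact: ltnW.
by move: S0; rewrite xN expr0n gtn_eqF //= mul0r addr0.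
Qed.

Local Notation ev y := (ev2 iota v y).

Lemma poly_pth_decomposition (c : {poly K}) : exists x : nat -> {poly K},
  c = \sum_(i < p) x i ^+ p * 'X^i.
Proof.
have [r rE] := choice K_perfect.2.
exists (fun i => \sum_(j < size c | (j %% p)%N == i) r (c`_j) *: 'X^(j %/ p)%N).
have pKX : p \in [pchar {poly K}] by rewrite pchar_poly.
rewrite -[LHS]coefK poly_def (partition_big (fun j : 'I_(size c) => Ordinal (ltn_pmod j p0)) predT) //=.
apply: eq_bigr => i _.
rewrite -(@pth_power_sum _ p _ _ _ (fun j : 'I_(size c) => c`_j *: 'X^(j %/ p * p)%N)) //.
  rewrite mulr_suml; apply: eq_big => [j|j /eqP <-]; first by rewrite -val_eqE.
  by rewrite -scalerAl -exprD -divn_eq.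
by move=> j _; rewrite exprZn -rE -exprM.
Qed.

Lemma fermat_algebraic y : exists2 g : {poly {poly K}}, g != 0 & ev y g = 0.
Proof.
have fm := fermat_monic K m (fermat_n0 C); have fr := ev2_fermat iota (fermat_eq C).
have [A [B [B0 yE]]] := fermat_genE C y.
have [c [s [c0 cE]]] := chart_algebraic fm fr B0.
have [g gm /rootP gr] := ev2_integral fm fr (A * s).
have cn : c != 0 by apply: contra_neq c0 => ->; rewrite rmorph0.
have cy : ev1 iota v c * y = ev2 iota v u (A * s).
  by rewrite cE yE ev2M; field.
(* An integral equation of c y over K[v], read as an equation of y. *)
exists (\poly_(i < size g) (g`_i * c ^+ i)).
  apply/eqP => /(congr1 (fun h : {poly {poly K}} => h`_((size g).-1))).
  rewrite coef0 coef_poly prednK ?size_poly_gt0 ?monic_neq0 // leqnn.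
  rewrite -lead_coefE (monicP gm) mul1r => /eqP.
  by rewrite expf_eq0 (negbTE cn) andbF.
rewrite -[RHS]gr -ev2E [in RHS]ev2_sum poly_def rmorph_sum /=; apply: eq_bigr => i _.
by rewrite ev2Z rmorphXn /= ev2X rmorphM rmorphXn /= -mulrA -exprMn cy.
Qed.

(* A relation f(v, y) = 0 of minimal degree in y with zero derivative in y would
   split, as 1, v, ..., v^(p-1) are independent over F^p, into relations of
   smaller degree. *)
Lemma fermat_separating : separating iota v.
Proof.
move=> y; have [g g0 gy] := fermat_algebraic y.
pose S k := `[< exists g : {poly {poly K}}, [/\ g != 0, ev y g = 0 & size g = k] >].
have exS : exists k, S k by exists (size g); apply/asboolP; exists g.
have [N /asboolP [f [f0 fy fk]] kmin] := ex_minnP exS.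
have {kmin} fmin h : ev y h = 0 -> (size h < size f)%N -> h = 0.
  move=> hy hf; apply/eqP; apply: contraTT hf => h0; rewrite -leqNgt fk.
  by apply: kmin; apply/asboolP; exists h.
have f'0 : f^`() != 0.
  apply/eqP => f'0; case/eqP: (f0).
  have [x xE] := choice poly_pth_decomposition.
  have fpi i : ~~ (p %| i)%N -> f`_i = 0.
    case: i => [|i] pi; first by rewrite dvdn0 in pi.
    have := coef_deriv f i; rewrite f'0 coef0 -mulr_natr => /esym/eqP.
    rewrite mulf_eq0 => /orP[/eqP //|]; rewrite -polyC_natr polyC_eq0 -(dvdn_pcharf pK).
    by rewrite (negbTE pi).
  pose h : {poly {poly K}} := \poly_(k < size f) f`_(k * p).
  have fE : f = h \Po 'X^p.
    apply/polyP => i; rewrite coef_comp_poly_Xn //; case: ifP => pi; last by rewrite fpi ?pi.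
    rewrite coef_poly divnK //; case: ltnP => // fi.
    by rewrite nth_default // (leq_trans fi) // leq_div.
  have f1 : (1 < size f)%N.
    rewrite ltnNge; apply/negP => /size1_polyC f1; case/eqP: (f0).
    have a0 : f`_0 = 0 by apply: (ev1_inj (fermat_trans C)); rewrite -(ev2C iota v y) -f1.
    by rewrite f1 a0.
  have hf : (size h < size f)%N.
    have := size_comp_poly h 'X^p; rewrite -fE size_polyXn /= => e.
    by move: f1 e; case: (size f) => [|[|s]] //= _; case: (size h) => [|[|t]] //=;
      have := prime_gt1 p_pr; nia.
  (* Writing each coefficient of h as a sum of p-th powers times v^j gives f(v, y) as the sum of
     fj(v, y)^p v^j. *)
  pose fj j : {poly {poly K}} := \poly_(k < size h) x (h`_k) j.
  have evf : \sum_(j < p) ev y (fj j) ^+ p * v ^+ j = 0.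
    rewrite -[RHS]fy [in RHS]fE [in RHS]ev2E map_comp_poly map_polyXn horner_comp hornerXn -ev2E ev2_sum.
    have pF := pcharF iota pK.
    rewrite [RHS](eq_bigr (fun k : 'I_(size h) =>
      \sum_(j < p) ev1 iota v (x h`_k j ^+ p * 'X^j) * (y ^+ p) ^+ k)); last first.
      by move=> k _; rewrite [in LHS](xE h`_k) rmorph_sum /= mulr_suml.
    rewrite exchange_big /=; apply: eq_bigr => j _.
    rewrite /fj poly_def rmorph_sum /=.
    rewrite -(@pth_power_sum _ p _ _ _ (fun k : 'I_(size h) =>
      ev1 iota v (x h`_k j) ^+ p * (y ^+ p) ^+ k)) //.
      rewrite mulr_suml; apply: eq_bigr => k _.
      by rewrite ev1M !rmorphXn /= ev1X; ring.
    by move=> k _; rewrite ev2Z rmorphXn /= ev2X exprMn -!exprM mulnC.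
  have fj0 j : (j < p)%N -> fj j = 0.
    move=> jp; apply: fmin; last by apply: leq_ltn_trans hf; exact: size_poly.
    exact: (pth_powers_indep (x := fun j => ev y (fj j)) (leqnn p) evf jp).
  rewrite fE (_ : h = 0) ?comp_poly0 //.
  apply/polyP => k; rewrite coef0; case: (ltnP k (size h)) => hk; last by rewrite nth_default.
  rewrite [LHS](xE h`_k) big1 // => j _.
  have := fj0 j (ltn_ord j) => /(congr1 (fun h : {poly {poly K}} => h`_k)).
  rewrite coef0 coef_poly hk => ->.
  by rewrite expr0n gtn_eqF //= mul0r.
(* If d divides f and f', then d or its cofactor vanishes at (v, y); minimality excludes d, and
   excludes the cofactor unless d is constant in Y. *)
have cop : coprimep f f^`().
  apply/coprimepP => d df df'; rewrite -size_poly_eq1.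
  have d0 : d != 0 by apply: contraTneq df => ->; rewrite dvd0p.
  have sd : (size d < size f)%N.
    by rewrite (leq_ltn_trans (dvdp_leq f'0 df')) // lt_size_deriv.
  have /Pdiv.Idomain.dvdpP [[c q] /= c0 cE] := df.
  have q0 : q != 0.
    apply: contra_neq f0 => q0; move/eqP: cE; rewrite q0 mul0r -mul_polyC mulf_eq0 polyC_eq0.
    by rewrite (negbTE c0) => /eqP.
  have := congr1 (ev y) cE; rewrite ev2Z fy mulr0 ev2M => /esym/eqP.
  rewrite mulf_eq0 => /orP[] /eqP; last by move/fmin/(_ sd)/eqP; rewrite (negbTE d0).
  move=> qy; have := congr1 (fun h : {poly {poly K}} => size h) cE.
  rewrite size_scale // size_mul // => sE.
  apply/eqP; apply: contraTeq isT => sd1.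
  have sd2 : (1 < size d)%N by rewrite ltn_neqAle eq_sym sd1 size_poly_gt0.
  have : (size q < size f)%N.
    rewrite sE -[X in (X < _)%N]addn0 -ltnS prednK ?addn_gt0 ?size_poly_gt0 ?q0 //.
    by rewrite -addnS ltn_add2l.
  by move/(fmin _ qy)/eqP; rewrite (negbTE q0).
exists (map_poly (ev1 iota v) f); split.
- move=> i; rewrite coef_map; exists f`_i, 1.
  by rewrite rmorph1 hornerC oner_neq0 divr1.
- have [[a b] /= /eqpP [[c1 c2] /= /andP[c10 c20] cE]] := Bezout_coprimepP _ _ cop.
  rewrite separable_poly.unlock; apply/Bezout_coprimepP.
  exists (map_poly (ev1 iota v) a, map_poly (ev1 iota v) b) => /=.
  rewrite deriv_map -!rmorphM -rmorphD; apply/eqpP.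
  exists (ev1 iota v c1, ev1 iota v c2) => /=; last first.
    rewrite -map_polyZ cE map_polyZ rmorph1.
    by [].
  have nz c : c != 0 -> ev1 iota v c != 0.
    by apply: contra_neq => /(ev1_inj (fermat_trans C)).
  by rewrite !nz.
- by apply/rootP; rewrite -ev2E.
Qed.

End Separating.

(** * Dimensions *)

Section Dimension.
Variables (K F : fieldType) (iota : {rmorphism K -> F}).

Lemma is_basis_leq (W : set (differential iota)) d d' (b : 'I_d -> differential iota)
    (b' : 'I_d' -> differential iota) :
  is_basis W b -> is_basis W b' -> (d' <= d)%N.
Proof.
move=> [bW binj bsurj] [b'W b'inj b'surj]; rewrite leqNgt; apply/negP => dd'.
have b'in i : W (b' i).
  have -> : b' i = \sum_(j < d') iota ((delta_mx 0 i : 'rV[K]_d') 0 j) *: b' j.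
    rewrite (bigD1 i) //= mxE !eqxx rmorph1 scale1r big1 ?addr0 // => j ji.
    by rewrite mxE (negbTE ji) andbF rmorph0 scale0r.
  exact: b'W.
have ex i : exists c : 'rV[K]_d, \sum_(j < d) iota (c 0 j) *: b j = b' i.
  by have [c _ cE] := bsurj _ (b'in i); exists c.
have [c cE] := choice ex.
pose A := \matrix_(i < d', j < d) c i 0 j.
have kA : kermx A != 0.
  by rewrite -mxrank_eq0 mxrank_ker subn_eq0 -ltnNge (leq_ltn_trans (rank_leq_col A)).
have [i xi] : exists i, row i (kermx A) != 0.
  apply/existsP; apply: contraNT kA => /existsPn A0; apply/eqP/row_matrixP => i.
  by have := A0 i; rewrite negbK row0 => /eqP.
set x := row i (kermx A) in xi.
have xA : x *m A = 0 by rewrite -row_mul mulmx_ker row0.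
case/eqP: xi; apply: b'inj; rewrite ?inE //.
transitivity (0 : differential iota); last first.
  by rewrite big1 // => j _; rewrite mxE rmorph0 scale0r.
under eq_bigr => j _ do rewrite -cE scaler_sumr.
rewrite exchange_big big1 //= => k _.
under eq_bigr => j _ do rewrite scalerA -rmorphM.
rewrite -scaler_suml -rmorph_sum /=.
have -> : \sum_(j < d') x 0 j * c j 0 k = 0; last by rewrite rmorph0 scale0r.
transitivity ((x *m A) 0 k); last by rewrite xA mxE.
by rewrite [RHS]mxE; apply: eq_bigr => j _; rewrite [A j k]mxE.
Qed.

Lemma Kdim_basis (W : set (differential iota)) d (b : 'I_d -> differential iota) :
  is_basis W b -> Kdim W = d.
Proof.
move=> Wb; apply: xget_unique; first by exists b.
move=> d' [b' Wb']; apply/eqP; rewrite eqn_leq.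
by rewrite (is_basis_leq Wb Wb') (is_basis_leq Wb' Wb).
Qed.

Lemma Kdim_card (T : finType) (A : {set T}) (g : T -> differential iota)
    (W : set (differential iota)) :
    (forall c : T -> K, W (\sum_(t in A) iota (c t) *: g t)) ->
    (forall w, W w -> exists c : T -> K, w = \sum_(t in A) iota (c t) *: g t) ->
    (forall c : T -> K, \sum_(t in A) iota (c t) *: g t = 0 -> forall t, t \in A -> c t = 0) ->
  Kdim W = #|A|.
Proof.
move=> Wsum Wex indep.
apply: (@Kdim_basis _ _ (fun i => g (enum_val i))).
have sumE (r : 'rV[K]_#|A|) : exists2 c : T -> K, forall i, c (enum_val i) = r 0 i &
    \sum_(i < #|A|) iota (r 0 i) *: g (enum_val i) = \sum_(t in A) iota (c t) *: g t.
  pose c t := if [pick i | enum_val i == t] is Some i then r 0 i else 0.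
  have cE i : c (enum_val i) = r 0 i.
    rewrite /c; case: pickP => [j /eqP /enum_val_inj -> //|/(_ i)].
    by rewrite eqxx.
  exists c => //; rewrite [RHS]big_enum_val /=.
  by apply: eq_bigr => i _; rewrite cE.
split.
- by move=> r _; have [c _ ->] := sumE r; exact: Wsum.
- move=> r r' _ _ e; have [c cE cS] := sumE (r - r').
  have : \sum_(t in A) iota (c t) *: g t = 0.
    rewrite -cS; under eq_bigr => i _ do rewrite !mxE rmorphB scalerBl.
    by rewrite sumrB e subrr.
  move=> /indep c0; apply/rowP => i; apply/eqP; rewrite -subr_eq0.
  by have := cE i; rewrite !mxE c0 ?enum_valP // => <-.
- move=> w /Wex [c ->]; exists (\row_i c (enum_val i)) => //.
  rewrite [RHS]big_enum_val /=; apply: eq_bigr => i _.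
  by rewrite mxE.
Qed.

End Dimension.

(** On a finite field the injective Frobenius map is onto; in a closed field X^p - c has a root. *)
Lemma perfect_base_field p (K : fieldType) : base_field p K -> perfect K p.
Proof.
move=> [pK Kbase]; split=> // c; have p0 : (0 < p)%N := prime_gt0 (pcharf_prime pK).
case: Kbase => [closedK|[e e0 ordK]].
  have [x xE] := closedK p (fun i => if i == 0%N then c else 0) p0.
  exists x; rewrite xE; case: p p0 {pK closedK xE} => // q _.
  rewrite big_ord_recl /= expr0 mulr1 big1 ?addr0 // => i _.
  by rewrite mul0r.
have /finite_seqP [s sE] : finite_set [set: K] by exists ((p ^ e) ^ 2)%N.
pose r := undup s.
have rT x : x \in r by rewrite mem_undup; have : [set: K] x by []; rewrite sE.
have frob_inj : injective (fun x : K => x ^+ p).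
  by move=> x y; rewrite -!(pFrobenius_autE pK) => /fmorph_inj.
have fr_uniq : uniq [seq x ^+ p | x <- r] by rewrite map_inj_uniq ?undup_uniq.
have [|_ memE] := uniq_min_size fr_uniq (fun x _ => rT x).
  by rewrite size_map.
by have := rT c; rewrite -memE => /mapP [x _ ->]; exists x.
Qed.

(** * Genus and a-number *)

Section HolomorphicBasis.
Variables (K F : fieldType) (iota : {rmorphism K -> F}) (p n m : nat) (u v : F).
Hypotheses (C : fermat_curve iota n m u v) (K_perfect : perfect K p).
Variable D : F -> F.
Hypotheses (DP : is_derivation iota D) (Du : D u = m%:R * v ^+ m.-1)
  (Dv : D v = - (n%:R * u ^+ n.-1)).
Variables (d n' m' a b : nat).
Hypotheses (nE : n = (d * n')%N) (mE : m = (d * m')%N) (bezout : (b * n' = a * m' + 1)%N).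

Local Notation omega := (@omega _ _ iota v D).
Local Notation T := ('I_n * 'I_m)%type.

Let n0 := fermat_n0 C.
Let m0 := fermat_m0 C.

(** An index is the pair of exponents of u and v, both increased by one; the weight bound makes it
    fit into T. *)
Definition hol_set : {set T} :=
  [set t : T | [&& (0 < t.1)%N, (0 < t.2)%N & (t.1 * m + t.2 * n < n * m)%N]].

Lemma holomorphic_sum (I : finType) (A : {set I}) (al be : I -> nat) (c : I -> K) :
    (forall t, t \in A -> ((al t).+1 * m + (be t).+1 * n < n * m)%N) ->
  holomorphic ((\sum_(t in A) iota (c t) * (u ^+ al t * v ^+ be t)) *: omega).
Proof.
move=> Ab; apply/(holomorphic_omegaE C K_perfect DP Du Dv nE mE bezout).
exists (monomial_sum (fun t => t \in A) al be c); split.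
- apply: monomial_sum_size => t At; have := Ab t At.
  by rewrite [(n * m)%N]mulnC => /(leq_ltn_trans (leq_addr _ _)); rewrite mulnC ltn_pmul2l // => /ltnW.
- by rewrite monomial_sum_ev.
- move=> i j; rewrite monomial_sum_coef => Zij.
  have [/existsP [t /andP[At /andP[/eqP <- /eqP <-]]]|/existsPn nt] :=
      boolP [exists t, (t \in A) && ((al t == i) && (be t == j))]; first exact: Ab.
  case/eqP: Zij; rewrite big1 // => t At; have := nt t; rewrite At /= => /negbTE ->.
  by [].
Qed.

Lemma holomorphic_ex w : holomorphic w -> exists c : T -> K,
  w = (\sum_(t in hol_set) iota (c t) * (u ^+ t.1.-1 * v ^+ t.2.-1)) *: omega.
Proof.
move=> hol; have [O OP] := exists_infinite_place C nE mE bezout.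
have [t [f [_ _ wE]]] := hol O OP.
have {wE} [z wE] : exists z, w = z *: omega.
  by exists (f * D t); rewrite wE (diffE C DP Du Dv) scalerA.
move: hol; rewrite wE => /(holomorphic_omegaE C K_perfect DP Du Dv nE mE bezout).
move=> [Z [Zn -> Zb]]; exists (fun t : T => Z`_(t.1.-1)`_(t.2.-1)); congr (_ *: _).
rewrite -(@monomial_sum_ev _ _ (fun t => t \in hol_set) (fun t : T => t.1.-1) (fun t : T => t.2.-1)
  (fun t : T => Z`_(t.1.-1)`_(t.2.-1))); congr (ev2 _ _ _ _).
apply/polyP => i; apply/polyP => j; rewrite monomial_sum_coef.
have [Zij|Zij] := eqVneq Z`_i`_j 0.
  rewrite Zij big1 // => s _; case: andP => // -[/eqP -> /eqP ->].
  by rewrite Zij.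
have ijb := Zb _ _ Zij.
have in_ : (i.+1 < n)%N.
  by rewrite -(ltn_pmul2r m0); apply: leq_ltn_trans ijb; rewrite leq_addr.
have jm : (j.+1 < m)%N.
  by rewrite -(ltn_pmul2r n0) [(m * n)%N]mulnC; apply: leq_ltn_trans ijb; rewrite leq_addl.
rewrite (bigD1 (Ordinal in_, Ordinal jm)) /=; last by rewrite inE.
rewrite !eqxx mulr1n big1 ?addr0 // => -[x y] /andP[].
rewrite inE /= => /and3P[x0 y0 _] xy; case: andP => // -[/eqP xi /eqP yj].
by case/eqP: xy; congr (_, _); apply: val_inj => /=; lia.
Qed.

Lemma scale_sum (I : finType) (A : {set I}) (c : I -> K) (g : I -> F) :
  \sum_(t in A) iota (c t) *: (g t *: omega) = (\sum_(t in A) iota (c t) * g t) *: omega.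
Proof. by rewrite scaler_suml; apply: eq_bigr => t _; rewrite scalerA. Qed.

Lemma hol_set_pos t : t \in hol_set -> (0 < t.1)%N && (0 < t.2)%N.
Proof. by rewrite inE => /and3P[-> ->]. Qed.

Lemma genus_card : genus iota = #|hol_set|.
Proof.
apply: (Kdim_card (g := fun t : T => (u ^+ t.1.-1 * v ^+ t.2.-1) *: omega)).
- move=> c; rewrite scale_sum; apply: holomorphic_sum => t.
  by rewrite inE => /and3P[t1 t2]; rewrite !prednK.
- by move=> w /holomorphic_ex [c ->]; exists c; rewrite scale_sum.
- move=> c; rewrite scale_sum -[X in _ = X](scale0r omega) => /(omega_inj C DP Dv) c0.
  apply: (monomial_indep C _ _ c0) => [t _|s t /hol_set_pos/andP[s1 s2] /hol_set_pos/andP[t1 t2] e1 e2].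
    by apply: leq_ltn_trans (ltn_ord t.1); rewrite leq_pred.
  by apply: injective_projections; exact: ord_pred_inj.
Qed.

Let pK := K_perfect.1.
Let p_pr : prime p := pcharf_prime pK.

Definition frob_map (t : T) : T :=
  (Ordinal (ltn_pmod (p * t.1) n0), Ordinal (ltn_pmod (p * t.2) m0)).

Lemma frob_map_inj : injective frob_map.
Proof.
have inj N (x y : 'I_N) : N%:R != 0 :> K -> (p * x = p * y %[mod N])%N -> x = y.
  move=> NK; have cop : coprime N p.
    by rewrite coprime_sym prime_coprime // (dvdn_pcharf pK).
  move=> e; apply: val_inj; rewrite /= -(modn_small (ltn_ord x)) -(modn_small (ltn_ord y)).
  wlog yx : x y e / (y <= x)%N.
    move=> H; have [|/ltnW] := leqP y x; first exact: H.
    by move=> xy; apply/esym/H.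
  apply/eqP; rewrite eqn_mod_dvd // -(Gauss_dvdr _ cop) mulnBr -eqn_mod_dvd ?leq_mul2l ?yx ?orbT //.
  exact/eqP.
move=> [x y] [x' y'] [/inj ex /inj ey].
by rewrite ex ?ey ?(fermat_nK C) ?(fermat_mK C).
Qed.

(** Elements of the kernel are indexed by t while their own index is [frob_map t]; the second
    condition says that the candidate image of index t is 0. *)
Definition kernel_set : {set T} := [set t : T | (frob_map t \in hol_set) &&
  (p <= (p * t.1) %/ n + (p * t.2) %/ m)%N].

Lemma frob_map_pos t : frob_map t \in hol_set -> (0 < t.1)%N && (0 < t.2)%N.
Proof.
move=> /hol_set_pos /= /andP[]; rewrite !lt0n => x0 y0; apply/andP.
by split; [apply: contra x0 | apply: contra y0] => /eqP ->; rewrite muln0 mod0n.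
Qed.

Hypothesis v_sep : separating iota v.

Let mon (t : T) := u ^+ (frob_map t).1.-1 * v ^+ (frob_map t).2.-1.

Let frob_inj_pred s t : frob_map s \in hol_set -> frob_map t \in hol_set ->
  (frob_map s).1.-1 = (frob_map t).1.-1 -> (frob_map s).2.-1 = (frob_map t).2.-1 -> s = t.
Proof.
move=> /hol_set_pos/andP[s1 s2] /hol_set_pos/andP[t1 t2] e1 e2; apply: frob_map_inj.
by apply: injective_projections; exact: ord_pred_inj.
Qed.

(** Reindex the holomorphic basis by the injective [frob_map]: elements of the kernel have no
    coefficients outside [kernel_set], and those inside are free. *)
Lemma a_number_card : a_number iota p = #|kernel_set|.
Proof.
pose A : {set T} := [set t : T | frob_map t \in hol_set]%SET.
have A_pos t : t \in A -> (0 < t.1)%N && (0 < t.2)%N by rewrite inE => /frob_map_pos.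
have kerA t : t \in kernel_set -> t \in A.
  by rewrite [t \in kernel_set]inE [t \in A]inE => /andP[].
have hol_bound t : t \in A -> ((frob_map t).1.-1.+1 * m + (frob_map t).2.-1.+1 * n < n * m)%N.
  by rewrite !inE => /and3P[t1 t2]; rewrite !prednK.
have A_n t : ((frob_map t).1.-1 < n)%N.
  by apply: leq_ltn_trans (ltn_ord (frob_map t).1); rewrite leq_pred.
apply: (Kdim_card (g := fun t : T => mon t *: omega)).
- move=> c; rewrite scale_sum; split.
    by apply: holomorphic_sum => t /kerA /hol_bound.
  pose c' t := if t \in kernel_set then c t else 0.
  have -> : \sum_(t in kernel_set) iota (c t) * mon t = \sum_(t in A) iota (c' t) * mon t.
    rewrite [RHS](bigID (mem kernel_set)) /= [X in _ = _ + X]big1 ?addr0.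
      apply: eq_big => [t|t tk]; last by rewrite /c' tk.
      by case: (boolP (t \in kernel_set)) => [/kerA ->|]; rewrite ?andbF.
    by move=> t /andP[_ /negbTE tk]; rewrite /c' tk rmorph0 mul0r.
  apply: (cartier_zero_sum C K_perfect DP Du Dv A_pos v_sep (c := c')) => t At tp.
  by rewrite /c' inE; rewrite inE in At; rewrite At /= leqNgt tp.
- move=> w [/holomorphic_ex [c ->] ker].
  have reindexE : \sum_(t in hol_set) iota (c t) * (u ^+ t.1.-1 * v ^+ t.2.-1) =
      \sum_(t in A) iota (c (frob_map t)) * mon t.
    by rewrite (reindex_inj frob_map_inj) /=; apply: eq_bigl => t; rewrite !inE.
  rewrite reindexE in ker *.
  have c0 := cartier_zero_coef C K_perfect DP Du Dv A_pos ker.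
  exists (fun t => c (frob_map t)); rewrite scale_sum; congr (_ *: _).
  rewrite (bigID (mem kernel_set)) /= [X in _ + X = _]big1 ?addr0.
    apply: eq_bigl => t.
    by case: (boolP (t \in kernel_set)) => [/kerA ->|]; rewrite ?andbF.
  move=> t /andP[At tk]; rewrite (c0 t At) ?rmorph0 ?mul0r // ltnNge.
  by move: tk; rewrite inE; rewrite inE in At; rewrite At.
- move=> c; rewrite scale_sum -[X in _ = X](scale0r omega) => /(omega_inj C DP Dv) c0.
  apply: (monomial_indep C _ _ c0) => [t _ //|s t /kerA + /kerA].
  by rewrite !inE => sA tA; apply: frob_inj_pred; rewrite !inE.
Qed.

End HolomorphicBasis.

(** * Counting indices by weight *)

Section Counting.
Variables n m : nat.
Hypotheses (n0 : (0 < n)%N) (m0 : (0 < m)%N).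
Local Notation T := ('I_n * 'I_m)%type.
Local Open Scope nat_scope.

Definition wt (t : T) := t.1 * m + t.2 * n.
Definition frob_wt p (t : T) := (p * t.1) %% n * m + (p * t.2) %% m * n.
Definition pos (t : T) := (0 < t.1) && (0 < t.2).

Definition a_set p : {set T} := [set t | [&& pos t, frob_wt p t < n * m & n * m <= wt t]]%SET.

Lemma frob_wtE p t :
  p * wt t = frob_wt p t + n * m * ((p * t.1) %/ n + (p * t.2) %/ m).
Proof.
rewrite /wt /frob_wt mulnDr !mulnA {1}(divn_eq (p * t.1) n) {1}(divn_eq (p * t.2) m).
lia.
Qed.

Lemma frob_mod_pos p N I : coprime N p -> 0 < I < N -> 0 < (p * I) %% N.
Proof.
move=> cop /andP[I0 IN]; rewrite lt0n; apply/negP => /eqP/eqP.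
by rewrite -/(dvdn _ _) Gauss_dvdr // gtnNdvd.
Qed.

Let nm0 : 0 < n * m. Proof. by rewrite muln_gt0 n0. Qed.

(** By [frob_wtE] the sum of the quotients is the integral part of p wt / (n m) once the remainder
    is below n m. *)
Lemma frob_quo_wt p t : 0 < p -> frob_wt p t < n * m ->
  (p <= (p * t.1) %/ n + (p * t.2) %/ m) = (n * m <= wt t).
Proof.
move=> p0 X; have E := frob_wtE p t; apply/idP/idP => [pq|W].
  rewrite -(leq_pmul2l p0) E; apply: leq_trans (leq_addl _ _).
  by rewrite mulnC leq_mul2l pq orbT.
rewrite -ltnS -(ltn_pmul2l nm0) mulnS; apply: leq_ltn_trans (_ : p * wt t < _).
  by rewrite mulnC leq_mul2l W orbT.
by rewrite E ltn_add2r.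
Qed.

Lemma hol_setE t : (t \in hol_set n m) = pos t && (wt t < n * m).
Proof. by rewrite inE andbA. Qed.

Lemma wt_lt t : wt t < n * m + n * m.
Proof.
have t1 : t.1 * m < n * m by rewrite ltn_pmul2r.
have t2 : t.2 * n < n * m by rewrite [n * m]mulnC ltn_pmul2r.
by rewrite -addnS leq_add // ltnW.
Qed.

Lemma frob_wt_lt p t : frob_wt p t < n * m + n * m.
Proof. exact: (wt_lt (Ordinal (ltn_pmod _ n0), Ordinal (ltn_pmod _ m0))). Qed.

Lemma wt_pos t : pos t -> 0 < wt t.
Proof. by move=> /andP[t1 _]; rewrite addn_gt0 muln_gt0 t1 m0. Qed.

Lemma dvd_between k : 0 < k < n * m + n * m -> (n * m %| k) = (k == n * m).
Proof.
move=> /andP[k0 k2]; apply/idP/eqP => [/dvdnP [q qE]|-> //].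
move: k0 k2; rewrite qE; case: q {qE} => [|[|q]]; rewrite ?mul1n //.
by move=> _; rewrite !mulSn addnA ltnNge leq_addr.
Qed.

Section Frobenius.
Variable p : nat.
Hypotheses (pn : coprime n p) (pm : coprime m p).

Lemma frob_wt_pos t : pos t -> 0 < frob_wt p t.
Proof.
move=> /andP[t1 _]; rewrite addn_gt0 muln_gt0 m0 frob_mod_pos //.
by rewrite t1 ltn_ord.
Qed.

(** Both weights lie strictly between 0 and 2 n m, so equality with n m is divisibility by n m, and
    multiplication by p preserves it. *)
Lemma frob_wt_eq t : pos t -> (frob_wt p t == n * m) = (wt t == n * m).
Proof.
move=> t0; rewrite -!dvd_between ?wt_lt ?frob_wt_lt ?wt_pos ?frob_wt_pos //.
rewrite -(@Gauss_dvdr _ p (wt t)) ?coprimeMl ?pn // frob_wtE.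
by rewrite dvdn_addl // dvdn_mulr.
Qed.

Lemma frob_mod_opp p' N i : coprime N p -> N %| p + p' -> 0 < i < N ->
  (p' * i) %% N = N - (p * i) %% N.
Proof.
move=> cop dv iN; have N0 : 0 < N by case/andP: iN => /leq_trans H /ltnW /H.
have r0 := frob_mod_pos cop iN; have r1 := ltn_pmod (p * i) N0; have r2 := ltn_pmod (p' * i) N0.
have : N %| (p * i) %% N + (p' * i) %% N.
  by rewrite /dvdn modnDml modnDmr -mulnDl; apply: dvdn_mulr.
move: r0 r1 r2; set r := (p * i) %% N; set r' := (p' * i) %% N => r0 r1 r2 /dvdnP [[|[|q]] qE].
- by move/eqP: qE; rewrite mul0n addn_eq0 -leqn0 leqNgt r0.
- by rewrite mul1n in qE; rewrite -qE addKn.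
- by exfalso; rewrite !mulSn in qE; lia.
Qed.

Lemma frob_wt_opp p' t : n %| p + p' -> m %| p + p' -> pos t ->
  frob_wt p t + frob_wt p' t = n * m + n * m.
Proof.
move=> dn dm /andP[t1 t2]; rewrite /frob_wt.
rewrite (frob_mod_opp pn dn) ?t1 ?ltn_ord // (frob_mod_opp pm dm) ?t2 ?ltn_ord //.
have r1 := ltnW (ltn_pmod (p * t.1) n0); have r2 := ltnW (ltn_pmod (p * t.2) m0).
by rewrite addnACA -!mulnDl !subnKC // mulnDl [m * n]mulnC.
Qed.

(** The residues only matter for coordinate 0, which is sent to itself. *)
Definition refl_map (t : T) : T :=
  (Ordinal (ltn_pmod (n - t.1) n0), Ordinal (ltn_pmod (m - t.2) m0)).

Lemma refl_mapK : involutive refl_map.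
Proof.
have inv N i : i < N -> (N - (N - i) %% N) %% N = i.
  case: i => [|i] iN; first by rewrite subn0 modnn subn0 modnn.
  by rewrite (modn_small (_ : N - i.+1 < N)) ?subKn ?modn_small //; lia.
move=> [x y]; apply: injective_projections; apply: val_inj => /=; exact: inv.
Qed.

Lemma refl_map_hol t : pos t -> pos (refl_map t) /\
  wt t + wt (refl_map t) = n * m + n * m.
Proof.
case: t => x y /andP[/= x0 y0]; rewrite /pos /wt /=.
have xn := ltn_ord x; have ym := ltn_ord y.
have xr : n - x < n by rewrite ltn_subrL x0.
have yr : m - y < m by rewrite ltn_subrL y0.
rewrite !modn_small // !subn_gt0 xn ym; split=> //.
by rewrite addnACA -!mulnDl (subnKC (ltnW xn)) (subnKC (ltnW ym)) mulnDl [m * n]mulnC.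
Qed.

Lemma card_hol_refl : #|hol_set n m| = #|[set t : T | pos t && (n * m < wt t)]%SET|.
Proof.
rewrite -!sum1_card (reindex_inj (inv_inj refl_mapK)); apply: eq_bigl => t /=.
rewrite hol_setE inE; case: (boolP (pos t)) => [/refl_map_hol [-> e]|nt] /=; first by lia.
apply: contraNF nt => /andP[/refl_map_hol []].
by rewrite refl_mapK.
Qed.

(** Split the indices of weight above n m by whether the multiple by p has weight below n m. Weight
    n m itself contributes nothing, and by [frob_wt_opp] weight above n m for p is weight below n m
    for p'. *)
Lemma card_a_set p' : n %| p + p' -> m %| p + p' ->
  #|a_set p| + #|a_set p'| = #|hol_set n m|.
Proof.
move=> dn dm; rewrite card_hol_refl.
rewrite -[RHS](cardsID [set t : T | frob_wt p t < n * m]%SET).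
congr (_ + _); apply: eq_card => t; rewrite !inE.
  case: (boolP (pos t)) => //= t0.
  by have := frob_wt_eq t0; lia.
case: (boolP (pos t)) => [t0|]; last by rewrite andbF.
have opp := frob_wt_opp dn dm t0; have := frob_wt_eq t0.
by lia.
Qed.

End Frobenius.

Lemma kernel_setE (K F : fieldType) (iota : {rmorphism K -> F}) p u v
    (C : fermat_curve iota n m u v) : 0 < p -> coprime n p -> coprime m p ->
  kernel_set p C = a_set p.
Proof.
move=> p0 pn pm; apply/setP => t; rewrite !inE /=.
have -> : [&& 0 < (p * t.1) %% n, 0 < (p * t.2) %% m & frob_wt p t < n * m] =
    pos t && (frob_wt p t < n * m).
  rewrite andbA; congr (_ && _); apply/andP/idP => [[r1 r2]|/andP[t1 t2]].
    apply/andP; rewrite !lt0n; move: r1 r2; rewrite !lt0n => r1 r2.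
    by split; [apply: contra r1 | apply: contra r2] => /eqP ->; rewrite muln0 mod0n.
  by rewrite !frob_mod_pos ?t1 ?t2 ?ltn_ord.
rewrite -andbA; congr (_ && _); case: (boolP (frob_wt p t < n * m)) => //= X.
exact: frob_quo_wt.
Qed.

End Counting.

Lemma fermat_function_field_curve n m p (K F : fieldType) (iota : {rmorphism K -> F}) :
  fermat_function_field n m p iota ->
  [/\ (0 < n)%N, (0 < m)%N, perfect K p, coprime n p /\ coprime m p &
    exists u v, fermat_curve iota n m u v].
Proof.
move=> [/andP[n0 m0] /andP[p_pr pnm] Kbase [u [v [v_trans gen uv]]]].
have Kp := perfect_base_field Kbase.
move: pnm; rewrite Euclid_dvdM // negb_or => /andP[pn pm].
split=> //; first by rewrite ![coprime _ p]coprime_sym !prime_coprime.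
exists u, v; split=> //.
  by rewrite -(dvdn_pcharf Kp.1).
by rewrite -(dvdn_pcharf Kp.1).
Qed.

Lemma fermat_genus_a_number n m p (K F : fieldType) (iota : {rmorphism K -> F}) :
  fermat_function_field n m p iota ->
  genus iota = #|hol_set n m| /\ a_number iota p = #|a_set n m p|.
Proof.
move=> /fermat_function_field_curve [n0 m0 Kp [pn pm] [u [v C]]].
have [D [DP Du Dv]] := exists_derivation C.
have d0 : (0 < gcdn n m)%N by rewrite gcdn_gt0 n0.
have n'0 : (0 < n %/ gcdn n m)%N by rewrite divn_gt0 // dvdn_leq // dvdn_gcdl.
have nE : n = (gcdn n m * (n %/ gcdn n m))%N by rewrite mulnC divnK // dvdn_gcdl.
have mE : m = (gcdn n m * (m %/ gcdn n m))%N by rewrite mulnC divnK // dvdn_gcdr.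
(* Bezout with natural coefficients, b n' = a m' + 1. *)
have [b a bez _] := egcdnP (m %/ gcdn n m) n'0.
have cop : gcdn (n %/ gcdn n m) (m %/ gcdn n m) = 1%N.
  by apply/eqP; rewrite -(eqn_pmul2l d0) muln1 muln_gcdr -nE -mE.
rewrite cop in bez.
split; first exact: (genus_card C Kp DP Du Dv nE mE bez).
rewrite -(kernel_setE n0 m0 C) ?(prime_gt0 (pcharf_prime Kp.1)) //.
apply: (a_number_card C Kp DP Du Dv nE mE bez).
by apply: (fermat_separating C Kp DP); exact: (fermat_Dv0 C Dv).
Qed.

Theorem corollary4p15 (e1 p1 n m p2 : nat)
    (K1 F1 : fieldType) (iota1 : {rmorphism K1 -> F1})
    (K2 F2 : fieldType) (iota2 : {rmorphism K2 -> F2}) :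
  (0 < e1)%N -> prime p1 ->
  let q1 := (p1 ^ e1)%N in
  (0 < n)%N -> (0 < m)%N -> (n %| q1 + 1)%N -> (m %| q1 + 1)%N ->
  let M := lcmn n m in
  let m1 := (p1 %% M)%N in
  let m2 := (M - m1)%N in
  prime p2 -> fermat_maximal n m p2 -> (p2 = m2 %[mod M])%N ->
  fermat_function_field n m p1 iota1 ->
  fermat_function_field n m p2 iota2 ->
  (a_number iota1 p1 + a_number iota2 p2 = genus iota1)%N.
Proof.
move=> _ _ q1 n0 m0 _ _ M m1 m2 _ _ p2E C1 C2.
have [_ _ _ [pn pm] _] := fermat_function_field_curve C1.
have [-> ->] := fermat_genus_a_number C1; have [_ ->] := fermat_genus_a_number C2.
(* As m1 < M, the subtraction in m2 is not truncated, and p1 + p2 is congruent to m1 + (M - m1) =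
   M. *)
have dM : (M %| p1 + p2)%N.
  have M0 : (0 < M)%N by rewrite lcmn_gt0 n0.
  by rewrite /dvdn -modnDmr p2E modnDmr -modnDml /m2 subnKC ?modnn // ltnW // ltn_pmod.
apply: card_a_set => //; apply: dvdn_trans dM; [exact: dvdn_lcml | exact: dvdn_lcmr].
Qed.
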